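(* Let $K$ be a field and let $I\subset K[x,y]$ be a convex monomial ideal of height $2$ with minimal monomial generators $G(I)=\{u_1,\ldots,u_m\}$, where $u_1>u_2>\cdots>u_m$ in the lexicographic order, $u_i=x^{a_i}y^{b_i}$ and $\mathbf{c}_i=(a_i,b_i)$ for $i=1,\ldots,m$. Let $F(I)=K[z_1,\ldots,z_m]/L$ be its fiber cone (with $z_i$ mapping to the class of $u_i$ in $I/\mathfrak m I$), and let $\{\mathbf{c}_{j_1},\ldots,\mathbf{c}_{j_\ell}\}$ with $1=j_1<j_2<\cdots<j_\ell=m$ be the set of corner points of $I$. Then: (a) Let $\mathcal B$ be the set of binomials which is the union of the sets of $2$-minors of the matrices $$M_k=\begin{pmatrix} z_{j_k} & z_{j_k+1} & \cdots & z_{j_{k+1}-1}\\ z_{j_k+1} & z_{j_k+2} & \cdots & z_{j_{k+1}}\end{pmatrix},\qquad k=1,\ldots,\ell-1.$$ Then $\mathcal B\subset L$. (b) Let $<$ be the lexicographic order on $K[z_1,\ldots,z_m]$ induced by $z_1>\cdots>z_m$, and let $\mathcal M$ be the set of monomials $z_iz_j$ with $1\le i<j-1\le m-1$ such that $z_iz_j\neq \mathrm{in}_<(f)$ for every $f\in\mathcal B$. Then $\mathcal M\subset L$. (c) Let $L_0$ be the ideal generated by the binomials of $\mathcal B$ together with the monomials of $\mathcal M$. Then, with respect to the order $<$ of (b), $\mathrm{in}_<(L_0)=(z_iz_j : 1\le i<j-1\le m-1)$. (d) $L_0=L$. (e) $F(I)$ is a reduced Cohen--Macaulay Koszul algeb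ra.
   Context: $K$ is a field, $\mathfrak m=(x,y)\subset K[x,y]$. For a monomial ideal $I\subset K[x,y]$ of height $2$, $G(I)=\{u_1,\ldots,u_m\}$ is its unique minimal set of monomial generators, labeled so that $u_1>\cdots>u_m$ lexicographically (with $x>y$). Writing $u_i=x^{a_i}y^{b_i}$, one has $a_1>\cdots>a_m=0$ and $0=b_1<\cdots<b_m$ (so $m\ge 2$). The exponent vector of $u_i$ is $\mathbf c_i=(a_i,b_i)$. For integer vectors, $\mathbf a\le\mathbf b$ means componentwise inequality, and $\mathbf a<\mathbf b$ means $\mathbf a\le\mathbf b$ and $\mathbf a\ne\mathbf b$. The ideal $I$ is convex if $2\mathbf c_i\le \mathbf c_{i-1}+\mathbf c_{i+1}$ for $i=2,\ldots,m-1$. For convex $I$, $\mathbf c_i$ is a corner point of $I$ if $i=1$, or $i=m$, or $2\mathbf c_i<\mathbf c_{i-1}+\mathbf c_{i+1}$. The fiber cone of $I$ is $F(I)=R(I)/\mathfrak mR(I)=\bigoplus_{k\ge0}I^k/\mathfrak mI^k$, where $R(I)=\bigoplus_{k\ge 0}I^k$ is the Rees ring. $L$ is the kernel of the surjective $K$-algebra homomorphism $K[z_1,\ldots,z_m]\to F(I)$ sending $z_i$ to the residue class of $u_i$ in $F(I)_1=I/\mathfrak mI$. $\mathrm{in}_<(f)$ denotes the initial monomial of $f$ (without coefficient) and $\mathrm{in}_<(L_0)$ the initial ideal. A standard graded $K$-algebra is Koszul if its residue field $K$ has a linear free resolution over it. *)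

(* Defs.v *)
From HB Require Import structures.
From mathcomp Require Import all_boot all_order all_algebra.
From mathcomp Require Import ring_quotient generic_quotient.
From mathcomp Require Import boolp.
From mathcomp Require Import mpoly.

Set Implicit Arguments.
Unset Strict Implicit.
Unset Printing Implicit Defensive.

Import GRing.Theory.

Local Open Scope ring_scope.
Local Open Scope quotient_scope.

Definition ideal_gen (R : comNzRingType) (S : {pred R}) : {pred R} :=
  [pred f | `[< exists (n : nat) (a s : 'I_n -> R),
     (forall i, s i \in S) /\ f = \sum_(i < n) a i * s i >]].

Definition ideal_mul (R : comNzRingType) (I J : {pred R}) : {pred R} :=
  ideal_gen [pred f | `[< exists g h, [/\ g \in I, h \in J & f = g * h] >]].

Definition ideal_exp (R : comNzRingType) (I : {pred R}) (k : nat) : {pred R} :=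
  iter k (ideal_mul I) predT.

(* [idealr_closed] includes properness. *)
Definition prime_ideal (R : comNzRingType) (P : {pred R}) : Prop :=
  idealr_closed P /\ prime_idealr_closed P.

Definition proper_subset (R : comNzRingType) (P Q : {pred R}) : Prop :=
  {subset P <= Q} /\ ~ {subset Q <= P}.

(* P_0 < P_1 < ... < P_n are primes; only the values of P at indices <= n
   matter. *)
Definition prime_chain (R : comNzRingType) (n : nat) (P : nat -> {pred R}) :
    Prop :=
  (forall i, (i <= n)%N -> prime_ideal (P i)) /\
  (forall i, (i < n)%N -> proper_subset (P i) (P i.+1)).

Definition is_krull_dim (R : comNzRingType) (d : nat) : Prop :=
  (exists P : nat -> {pred R}, prime_chain d P) /\
  ~ (exists P : nat -> {pred R}, prime_chain d.+1 P).

(* The infimum of the heights of the primes containing I is at least n. *)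
Definition height_ge (R : comNzRingType) (I : {pred R}) (n : nat) : Prop :=
  forall Q : {pred R}, prime_ideal Q -> {subset I <= Q} ->
    exists2 P : nat -> {pred R}, prime_chain n P & P n =i Q.

Definition is_height (R : comNzRingType) (I : {pred R}) (n : nat) : Prop :=
  height_ge I n /\ ~ height_ge I n.+1.

Definition regular_seq (R : comNzRingType) (s : seq R) : Prop :=
  1 \notin ideal_gen (mem s) /\
  forall i, (i < size s)%N -> forall x : R,
    s`_i * x \in ideal_gen (mem (take i s)) -> x \in ideal_gen (mem (take i s)).

Definition is_depth (R : comNzRingType) (I : {pred R}) (d : nat) : Prop :=
  (exists s : seq R, [/\ regular_seq s, {subset s <= I} & size s = d]) /\
  (forall s : seq R, regular_seq s -> {subset s <= I} -> (size s <= d)%N).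

Definition reduced (R : comNzRingType) : Prop :=
  forall (x : R) (n : nat), x ^+ n = 0 -> x = 0.

(* [gr k] is the homogeneous component of degree k. *)
Record standard_graded (K : fieldType) (A : comAlgType K)
    (gr : nat -> {pred A}) : Prop := StandardGraded {
  sg_submod : forall k, submod_closed (gr k);
  sg_mul : forall k l x y, x \in gr k -> y \in gr l -> x * y \in gr (k + l)%N;
  sg_span : forall x : A, exists (n : nat) (c : nat -> A),
    (forall k, c k \in gr k) /\ x = \sum_(k < n) c k;
  sg_direct : forall (n : nat) (c : nat -> A), (forall k, c k \in gr k) ->
    \sum_(k < n) c k = 0 -> forall k, (k < n)%N -> c k = 0;
  sg_degree0 : forall x : A, x \in gr 0%N <-> exists a : K, x = a%:A;
  sg_degree1 : exists (n : nat) (e : 'I_n -> A), (forall i, e i \in gr 1%N) /\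
    forall x : A, exists p : {mpoly K[n]}, x = mmap (in_alg A) e p
}.

Definition irrelevant (K : fieldType) (A : comAlgType K)
    (gr : nat -> {pred A}) : {pred A} :=
  ideal_gen [pred x | `[< exists2 k, (0 < k)%N & x \in gr k >]].

(* depth A = dim A, where the depth of a standard graded K-algebra is the
   maximal length of a regular sequence in its graded maximal ideal. *)
Definition cohen_macaulay (K : fieldType) (A : comAlgType K)
    (gr : nat -> {pred A}) : Prop :=
  standard_graded gr /\
  exists d : nat, is_krull_dim A d /\ is_depth (irrelevant gr) d.

(* The rank of the i-th module A(-i)^(b_i) of the resolution.  In degree 0 a
   linear resolution of K = A/A_+ starts with K^(b_0) = K, so b_0 = 1. *)
Definition lin_rank (b : nat -> nat) (i : nat) : nat :=
  if i is j.+1 then b j else 1.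

(* A resolution ... -> A(-2)^(b_2) -> A(-1)^(b_1) -> A -> A/A_+ -> 0, where
   [D i : A(-i-1)^(b_(i+1)) -> A(-i)^(b_i)] acts on row vectors; homogeneity of
   degree 0 means that the entries of [D i] have degree 1. *)
Definition residue_field_linear_resolution (K : fieldType) (A : comAlgType K)
    (gr : nat -> {pred A}) : Prop :=
  exists (b : nat -> nat)
         (D : forall i, 'M[A]_(lin_rank b i.+1, lin_rank b i)),
  [/\ forall i r s, D i r s \in gr 1%N,
      forall v : 'rV[A]_1,
        v 0 0 \in irrelevant gr <-> exists w, v = w *m D 0%N
    & forall i (v : 'rV[A]_(lin_rank b i.+1)),
        v *m D i = 0 <-> exists w, v = w *m D i.+1].

Definition koszul (K : fieldType) (A : comAlgType K) (gr : nat -> {pred A}) :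
    Prop :=
  standard_graded gr /\ residue_field_linear_resolution gr.

Section IdealLemmas.
Variable R : comNzRingType.
Implicit Types (S I : {pred R}).

Lemma ideal_genP S f :
  reflect (exists (n : nat) (a s : 'I_n -> R),
     (forall i, s i \in S) /\ f = \sum_(i < n) a i * s i) (f \in ideal_gen S).
Proof. exact: asboolP. Qed.

Lemma ideal_gen0 S : 0 \in ideal_gen S.
Proof.
apply/ideal_genP; exists 0%N, (fun _ => 0), (fun _ => 0).
by split=> [[]|] //; rewrite big_ord0.
Qed.

Lemma ideal_genD S f g :
  f \in ideal_gen S -> g \in ideal_gen S -> f + g \in ideal_gen S.
Proof.
move=> /ideal_genP[n [a [s [sS ->]]]] /ideal_genP[m [b [t [tS ->]]]].
apply/ideal_genP; exists (n + m)%N.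
exists (fun i => match split i with inl i => a i | inr i => b i end).
exists (fun i => match split i with inl i => s i | inr i => t i end).
split=> [i|]; first by case: (split i).
rewrite big_split_ord; congr (_ + _); apply: eq_bigr => i _ /=.
  by rewrite (unsplitK (inl i)).
by rewrite (unsplitK (inr i)).
Qed.

Lemma ideal_genM S a f : f \in ideal_gen S -> a * f \in ideal_gen S.
Proof.
move=> /ideal_genP[n [b [s [sS ->]]]]; apply/ideal_genP.
exists n, (fun i => a * b i), s; split=> //.
by rewrite mulr_sumr; apply: eq_bigr => i _; rewrite mulrA.
Qed.

Lemma mem_ideal_gen S f : f \in S -> f \in ideal_gen S.
Proof.
move=> fS; apply/ideal_genP; exists 1%N, (fun _ => 1), (fun _ => f).
by split=> //; rewrite big_ord1 mul1r.
Qed.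

Lemma ideal_gen_sum S n (F : 'I_n -> R) :
  (forall i, F i \in ideal_gen S) -> \sum_(i < n) F i \in ideal_gen S.
Proof.
move=> FS; elim/big_rec: _ => [|i x _]; first exact: ideal_gen0.
exact: ideal_genD.
Qed.

Lemma ideal_exp0 I k : 0 \in ideal_exp I k.
Proof. by case: k => [|k] //; apply: ideal_gen0. Qed.

Lemma ideal_expD I k f g :
  f \in ideal_exp I k -> g \in ideal_exp I k -> f + g \in ideal_exp I k.
Proof. by case: k => [|k] //; apply: ideal_genD. Qed.

Lemma ideal_expM I k a f : f \in ideal_exp I k -> a * f \in ideal_exp I k.
Proof. by case: k => [|k] //; apply: ideal_genM. Qed.

Lemma ideal_exp_mul I k l f g :
  f \in ideal_exp I k -> g \in ideal_exp I l -> f * g \in ideal_exp I (k + l).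
Proof.
move=> + gl; elim: k f => [|k IHk] f; first by move=> _; apply: ideal_expM.
move=> /ideal_genP[n [a [s [sS ->]]]]; rewrite mulr_suml.
apply: ideal_gen_sum => i; rewrite -mulrA; apply: ideal_genM.
have /asboolP[u [v [uI vI ->]]] := sS i.
rewrite -mulrA; apply: mem_ideal_gen; apply/asboolP.
by exists u, (v * g); split=> //; apply: IHk.
Qed.

End IdealLemmas.

Section Rees.
Variables (R : comNzRingType) (I : {pred R}).

(* R(I) is realized as the subring of those sums f_0 + f_1 t + f_2 t^2 + ...
   of R[t] with f_k in I^k. *)
Definition rees_pred : {pred {poly R}} :=
  [pred p : {poly R} | `[< forall k, p`_k \in ideal_exp I k >]].

Lemma rees_predP (p : {poly R}) :
  reflect (forall k, p`_k \in ideal_exp I k) (p \in rees_pred).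
Proof. exact: asboolP. Qed.

Lemma rees_subring : subring_closed rees_pred.
Proof.
split=> [|p q /rees_predP pI /rees_predP qI|p q /rees_predP pI /rees_predP qI];
  apply/rees_predP => k.
- by rewrite coef1; case: k => [|k]; [exact: isT | exact: ideal_exp0].
- by rewrite coefB -mulN1r; apply: ideal_expD => //; apply: ideal_expM.
- rewrite coefM; elim/big_rec: _ => [|i x _ xI]; first exact: ideal_exp0.
  apply: ideal_expD => //.
  have le_ik : (i <= k)%N by rewrite -ltnS.
  have := ideal_exp_mul (pI i) (qI (k - i)%N); rewrite subnKC //.
Qed.

HB.instance Definition _ := GRing.isSubringClosed.Build {poly R} rees_pred
  rees_subring.

Record rees : Type := Rees {
  rees_val : {poly R};
  rees_valP : rees_val \in rees_pred
}.

HB.instance Definition _ := [isSub for rees_val].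
HB.instance Definition _ := [Choice of rees by <:].
HB.instance Definition _ := [SubChoice_isSubComNzRing of rees by <:].

(* The extension of an ideal of R = R(I)_0 to R(I). *)
Definition rees_ext (J : {pred R}) : {pred rees} :=
  ideal_gen [pred r | `[< exists2 g, g \in J & \val r = g%:P >]].

End Rees.

Definition varx (K : fieldType) : {mpoly K[2]} := 'X_0.
Definition vary (K : fieldType) : {mpoly K[2]} := 'X_1.

Definition maxxy (K : fieldType) : {pred {mpoly K[2]}} :=
  ideal_gen [pred f | (f == varx K) || (f == vary K)].
Arguments maxxy K : clear implicits.

Section FiberCone.
Variables (K : fieldType) (I : {pred {mpoly K[2]}}).

Definition max_rees : {pred rees I} := rees_ext (I := I) (maxxy K).

Lemma maxxy_eval0 f : f \in maxxy K -> f.@[fun => 0] = 0.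
Proof.
move=> /ideal_genP[n [a [s [sS ->]]]]; rewrite raddf_sum big1 // => i _ /=.
rewrite mevalM; suff -> : (s i).@[fun => 0] = 0 by rewrite mulr0.
by have /orP[/eqP->|/eqP->] := sS i; rewrite /varx /vary mevalXU.
Qed.

Lemma max_rees_idealr : idealr_closed max_rees.
Proof.
split; first exact: ideal_gen0; last first.
  by move=> a u v uS vS; apply: ideal_genD => //; apply: ideal_genM.
apply/negP => /ideal_genP[n [a [s [sS e1]]]].
have: ((\val (1 : rees I))`_0).@[fun => 0] = 1 by rewrite rmorph1 coef1 meval1.
rewrite e1 raddf_sum coef_sum raddf_sum big1 => [/esym/eqP|i _ /=].
  by rewrite oner_eq0.
have /asboolP[g gm eg] := sS i.
by rewrite eg coefMC mevalM (maxxy_eval0 gm) mulr0.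
Qed.

HB.instance Definition _ := isIdealr.Build (rees I) max_rees max_rees_idealr.

Definition fiber_cone : Type := {ideal_quot max_rees}.

HB.instance Definition _ := GRing.ComNzRing.on fiber_cone.

Definition fiber_pi (r : rees I) : fiber_cone := \pi_({ideal_quot max_rees}) r.

Lemma fiber_piD r s : fiber_pi (r + s) = fiber_pi r + fiber_pi s.
Proof. exact: (rmorphD (\pi_({ideal_quot max_rees}))). Qed.

Lemma fiber_piM r s : fiber_pi (r * s) = fiber_pi r * fiber_pi s.
Proof. exact: (rmorphM (\pi_({ideal_quot max_rees}))). Qed.

Lemma fiber_pi1 : fiber_pi 1 = 1.
Proof. exact: (rmorph1 (\pi_({ideal_quot max_rees}))). Qed.

Lemma rees_const_subproof (a : K) : (a%:MP : {mpoly K[2]})%:P \in rees_pred I.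
Proof.
by apply/rees_predP => -[|k]; rewrite coefC; [exact: isT | exact: ideal_exp0].
Qed.

Definition rees_const (a : K) : rees I := Rees (rees_const_subproof a).

Lemma rees_constD a b : rees_const (a + b) = rees_const a + rees_const b.
Proof. by apply: val_inj; rewrite rmorphD /= mpolyCD polyCD. Qed.

Lemma rees_constM a b : rees_const (a * b) = rees_const a * rees_const b.
Proof. by apply: val_inj; rewrite rmorphM /= mpolyCM polyCM. Qed.

Lemma rees_const1 : rees_const 1 = 1.
Proof. by apply: val_inj; rewrite rmorph1 /= mpolyC1 polyC1. Qed.

Definition fiber_scale (a : K) (x : fiber_cone) : fiber_cone :=
  fiber_pi (rees_const a) * x.

Lemma fiber_scaleA a b x :
  fiber_scale a (fiber_scale b x) = fiber_scale (a * b) x.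
Proof. by rewrite /fiber_scale rees_constM fiber_piM mulrA. Qed.

Lemma fiber_scale1 : left_id 1 fiber_scale.
Proof. by move=> x; rewrite /fiber_scale rees_const1 fiber_pi1 mul1r. Qed.

Lemma fiber_scaleDr : right_distributive fiber_scale +%R.
Proof. by move=> a x y; rewrite /fiber_scale mulrDr. Qed.

Lemma fiber_scaleDl x : {morph fiber_scale^~ x : a b / a + b}.
Proof.
by move=> a b; rewrite /fiber_scale rees_constD fiber_piD mulrDl.
Qed.

HB.instance Definition _ := GRing.Zmodule_isLmodule.Build K fiber_cone
  fiber_scaleA fiber_scale1 fiber_scaleDr fiber_scaleDl.

Lemma fiber_scaleAl (a : K) (x y : fiber_cone) : a *: (x * y) = a *: x * y.
Proof. exact: mulrA. Qed.

HB.instance Definition _ := GRing.Lmodule_isLalgebra.Build K fiber_cone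
  fiber_scaleAl.
HB.instance Definition _ := GRing.Lalgebra_isComAlgebra.Build K fiber_cone.

(* F(I)_k = I^k / mI^k, the set of the classes of the f t^k with f in I^k. *)
Definition fiber_gr (k : nat) : {pred fiber_cone} :=
  [pred x | `[< exists2 r : rees I,
     (forall j, j != k -> (\val r)`_j = 0) & x = fiber_pi r >]].

(* The class of f in F(I)_1 = I/mI; [insubd] makes the definition total, and
   the value is meaningful for f in I only. *)
Definition fiber_class (f : {mpoly K[2]}) : fiber_cone :=
  fiber_pi (insubd 0 (f *: 'X)).

End FiberCone.

Definition lex_lt (n : nat) (s t : 'X_{1..n}) : bool :=
  [exists i : 'I_n, [forall (j : 'I_n | (j < i)%N), s j == t j] && (s i < t i)%N].

Section MonomialIdeal.
Variables (K : fieldType) (m : nat) (c : 'I_m -> 'X_{1..2}).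

(* The 'X_[c i] are the elements of G(I): they generate I, no proper subfamily
   does, and they are listed in decreasing lexicographic order (x > y), which
   makes them distinct. *)
Definition monomials_of (B : {set 'I_m}) : {pred {mpoly K[2]}} :=
  [pred f | [exists i in B, f == 'X_[c i]]].

Definition minimal_monomial_generators (I : {pred {mpoly K[2]}}) : Prop :=
  [/\ I =i ideal_gen (monomials_of [set: 'I_m]),
      forall B : {set 'I_m}, B \proper [set: 'I_m] ->
        ~ (I =i ideal_gen (monomials_of B))
    & forall i j : 'I_m, (i < j)%N -> lex_lt (c j) (c i)].

Definition convex : Prop :=
  forall h i k : 'I_m, i = h.+1 :> nat -> k = i.+1 :> nat ->
    (c i + c i <= c h + c k)%MM.

Definition corner (i : 'I_m) : Prop :=
  [\/ i = 0 :> nat, i.+1 = m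
    | exists h k : 'I_m, [/\ i = h.+1 :> nat, k = i.+1 :> nat,
        (c i + c i <= c h + c k)%MM & (c i + c i != c h + c k)%MM]].

Definition fiber_map (I : {pred {mpoly K[2]}}) : {mpoly K[m]} -> fiber_cone I :=
  mmap (in_alg (fiber_cone I)) (fun i => fiber_class I 'X_[c i]).

Definition fiber_ideal (I : {pred {mpoly K[2]}}) : {pred {mpoly K[m]}} :=
  [pred f | fiber_map I f == 0].

End MonomialIdeal.

Section Initial.
Variables (K : fieldType) (m : nat).
Implicit Types (f g : {mpoly K[m]}).

(* [lex_lt] on exponents is the lexicographic order induced by
   'X_0 > 'X_1 > ..., unlike the degree order behind [mlead]. *)
Definition is_init f (t : 'X_{1..m}) : Prop :=
  t \in msupp f /\ forall s, s \in msupp f -> s != t -> lex_lt s t.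

Definition init_ideal (J : {pred {mpoly K[m]}}) : {pred {mpoly K[m]}} :=
  ideal_gen [pred g | `[< exists f t,
    [/\ f \in J, is_init f t & g = 'X_[t]] >]].

(* The i-th variable; the default 0 is not used for i < m. *)
Definition zvar (i : nat) : {mpoly K[m]} := oapp (fun k : 'I_m => 'X_k) 0 (insub i).

Definition minor_matrix (p q : nat) : 'M[{mpoly K[m]}]_(2, q - p) :=
  \matrix_(r < 2, s < q - p) zvar (p + s + r).

Definition two_minors (n : nat) (M : 'M[{mpoly K[m]}]_(2, n)) :
    {pred {mpoly K[m]}} :=
  [pred f | `[< exists g : 'I_2 -> 'I_n,
     {homo g : r s / (r < s)%N} /\ f = \det (colsub g M) >]].

Variables (l : nat) (j : 'I_l -> 'I_m).

Definition corner_binomials : {pred {mpoly K[m]}} :=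
  [pred f | `[< exists k k' : 'I_l,
     k' = k.+1 :> nat /\ f \in two_minors (minor_matrix (j k) (j k')) >]].

Definition nonadjacent_products : {pred {mpoly K[m]}} :=
  [pred f | `[< exists i k : 'I_m, (i.+1 < k)%N /\ f = 'X_i * 'X_k >]].

Definition corner_monomials : {pred {mpoly K[m]}} :=
  [pred f | `[< exists i k : 'I_m, [/\ (i.+1 < k)%N, f = 'X_i * 'X_k
     & forall g, g \in corner_binomials -> ~ is_init g (U_(i) + U_(k))%MM] >]].

Definition corner_ideal : {pred {mpoly K[m]}} :=
  ideal_gen [predU corner_binomials & corner_monomials].

End Initial.

Arguments zvar K {m} i.
Arguments minor_matrix K {m} p q.
Arguments corner_binomials K {m l} j.
Arguments nonadjacent_products K m : clear implicits.
Arguments corner_monomials K {m l} j.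
Arguments corner_ideal K {m l} j.
Arguments fiber_gr {K} I k.
Arguments fiber_class {K} I f.

(* Main.v *)
(* Convexity says that replacing z_i z_k by z_(i+1) z_(k-1) divides the product of
   generators, with equality exactly when no corner lies strictly between i and k.
   Iterating, every monomial becomes, modulo L_0, zero or a standard monomial
   z_q^a z_(q+1)^b.  A standard monomial is determined by its degree and the sum of
   its indices, is lexicographically smallest among the monomials sharing them, and
   the corresponding products are the minimal generators of I^k.  Hence the standard
   monomials are linearly independent in F(I), which gives L_0 = L and the initial
   ideal.

   Between two consecutive corners p < q, sending z_i to s t^i for p <= i <= q and the
   other variables to 0 maps F(I) to K[s, t], and these maps are jointly injective, so
   F(I) is reduced.  They also show that F(I) is free over S = K[th_0, th_1], where th_0
   and th_1 are the sums of the corners of even and of odd index, with basis 1 and m - 2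
   elements w_i of degree 1 satisfying w_i w_k in (th_0, th_1) F(I)_1.  Thus th_0, th_1 is
   a regular sequence, while quadratic growth of F(I) excludes longer regular sequences
   and prime chains of length 3.  Finally, over such an algebra the relations between
   elements that form an S-basis of a module on which the w_i act through linear forms
   have again an S-basis of the same kind, made of linear relations; starting with
   th_0, th_1, w_1, ..., w_(m-2) this yields the linear resolution of K. *)

From HB Require Import structures.
Require Import Defs.
From mathcomp Require Import all_boot all_order all_algebra.
From mathcomp Require Import mpoly.
From mathcomp Require Import ring_quotient generic_quotient boolp.
From mathcomp Require Import zify ring.

Set Implicit Arguments.
Unset Strict Implicit.
Unset Printing Implicit Defensive.

Import GRing.Theory.
Local Open Scope ring_scope.

(** Linear independence is read off in the Rees ring: each monomial in the degree k part of m R(I)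
    is a proper multiple of a product of k generators, whereas the standard products of degree k
    form an antichain under divisibility, because their two exponents move strictly and in opposite
    directions with the index sum.

    Modulo th_0, th_1 all products of elements of degree 1 vanish, and this, rather than the
    quadratic initial ideal, drives the linear resolution. If [P i] is the matrix over K[th_0, th_1]
    by which [w i] acts on a family, the relations to add are the rows of [w i - P i]. Multiplying
    them by [w k] leaves an error that is quadratic in th_0, th_1; it must be a multiple, with
    linear coefficients, of the relations over K[th_0, th_1]. Only at the start is there such a
    relation, the Koszul one between th_0 and th_1; afterwards the error vanishes.

    The upper bounds for dimension and depth are one count: three elements, each regular modulo the
    ideal preceding it in a chain that ends in a proper ideal, would be algebraically independent
    and give N^3 independent products in a space of dimension O(N^2). *)

Lemma mpoly_subring_ind (K : fieldType) (n : nat) (P : {mpoly K[n]} -> Prop) :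
  (forall a, P a%:MP) -> (forall k, P 'X_k) ->
  (forall f g, P f -> P g -> P (f + g)) -> (forall f g, P f -> P g -> P (f * g)) ->
  forall f, P f.
Proof.
move=> PC PX PD PM; have P1 : P 1 by rewrite -mpolyC1.
have P0 : P 0 by rewrite -mpolyC0.
elim/mpolyind => [//|c u f _ _ Pf]; apply: (PD) => //.
rewrite -mul_mpolyC; apply: (PM) => //; rewrite mpolyXE_id.
elim/big_rec: _ => // k x _; apply: (PM); elim: (u k) => // v.
by rewrite exprS; apply: PM.
Qed.

(** * Setting a variable to zero, and the syzygy of two variables *)

Section VariableSubstitution.
Variables (K : fieldType) (n : nat).
Implicit Types (f g : {mpoly K[n]}) (i : 'I_n).

Definition subst0 i : {mpoly K[n]} -> {mpoly K[n]} :=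
  mmap (@mpolyC n K) (fun k => if k == i then 0 else 'X_k).

HB.instance Definition _ i := GRing.RMorphism.on (subst0 i).

Lemma subst0X i k : subst0 i 'X_k = if k == i then 0 else 'X_k.
Proof. by rewrite /subst0 mmapX mmap1U. Qed.

Lemma subst0_split i f : exists g, f = subst0 i f + g * 'X_i.
Proof.
elim/mpoly_subring_ind: f => [a|k|f g [f' ef] [g' eg]|f g [f' ef] [g' eg]].
- by exists 0; rewrite /subst0 mmapC mul0r addr0.
- rewrite subst0X; case: eqP => [->|_]; last by exists 0; rewrite mul0r addr0.
  by exists 1; rewrite add0r mul1r.
- by exists (f' + g'); rewrite rmorphD /= {1}ef {1}eg; ring.
- exists (f' * g + subst0 i f * g').
  by rewrite rmorphM /= {1}ef mulrDl {1}eg; ring.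
Qed.

Lemma subst0_eq0 i f : subst0 i f = 0 <-> exists g, f = g * 'X_i.
Proof.
split=> [f0|[g ->]]; first by have [g] := subst0_split i f; rewrite f0 add0r; exists g.
by rewrite rmorphM /= subst0X eqxx mulr0.
Qed.

Lemma mpolyXU_neq0 i : 'X_i != 0 :> {mpoly K[n]}.
Proof. by rewrite -msize_poly_eq0 msizeX. Qed.

Lemma dhomogXU i : ('X_i : {mpoly K[n]}) \is 1.-homog.
Proof. by rewrite dhomogX; apply/eqP/mdeg1. Qed.

Lemma dhomogMX_inv i d f : f * 'X_i \is d.+1.-homog -> f \is d.-homog.
Proof.
move=> /dhomogP h; apply/dhomogP => u fu.
suff : mdeg (U_(i) + u) = d.+1 by rewrite mdegD mdeg1 => -[].
by apply: h; rewrite (perm_mem (msuppMX f _)); apply: map_f.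
Qed.

(** Setting ['X_i] to zero leaves [subst0 i g] times ['X_k] equal to zero, so ['X_i] divides [g];
    cancelling ['X_i] in the relation then determines [f]. *)
Lemma koszul_relation i k f g : i != k -> f * 'X_i + g * 'X_k = 0 ->
  exists h, f = h * 'X_k /\ g = - h * 'X_i.
Proof.
move=> ik e; have /subst0_eq0[h eg] : subst0 i g = 0.
  have /eqP := congr1 (subst0 i) e.
  rewrite rmorphD !rmorphM /= !subst0X eqxx [k == i]eq_sym (negPf ik) mulr0 add0r rmorph0.
  by rewrite mulf_eq0 (negPf (mpolyXU_neq0 k)) orbF => /eqP.
exists (- h); split; last by rewrite opprK.
apply: (mulIf (mpolyXU_neq0 i)); apply/eqP; rewrite -subr_eq0 -[X in _ == X]e eg.
by apply/eqP; ring.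
Qed.

End VariableSubstitution.

(** * Linear resolutions over algebras free over a polynomial ring in two parameters *)

Section LinearResolution.
Variables (K : fieldType) (A : comAlgType K).
Variables (r : nat) (th : 'I_2 -> A) (w : 'I_r -> A).

Local Notation S := {mpoly K[2]}.
Local Notation ev := (mmap (in_alg A) th).

Definition homog_mx (d a b : nat) (P : 'M[S]_(a, b)) : Prop :=
  forall x y, P x y \is d.-homog.

Lemma homog_mx0 d a b : homog_mx d (0 : 'M[S]_(a, b)).
Proof. by move=> x y; rewrite mxE rpred0. Qed.

Lemma homog_mxD d a b (P Q : 'M[S]_(a, b)) :
  homog_mx d P -> homog_mx d Q -> homog_mx d (P + Q).
Proof. by move=> hP hQ x y; rewrite mxE rpredD. Qed.

Lemma homog_mxN d a b (P : 'M[S]_(a, b)) : homog_mx d P -> homog_mx d (- P).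
Proof. by move=> hP x y; rewrite mxE rpredN. Qed.

Lemma homog_mxM d e a b c (P : 'M[S]_(a, b)) (Q : 'M[S]_(b, c)) :
  homog_mx d P -> homog_mx e Q -> homog_mx (d + e) (P *m Q).
Proof.
by move=> hP hQ x y; rewrite mxE; apply: rpred_sum => i _; apply: dhomogM.
Qed.

Lemma homog_mx_scalar d a (p : S) : p \is d.-homog -> homog_mx d (p%:M : 'M_a).
Proof. by move=> hp x y; rewrite mxE; case: (x == y); rewrite ?mulr1n ?mulr0n ?rpred0. Qed.

Lemma homog_mx_sum d a b (I : finType) (P : I -> 'M[S]_(a, b)) :
  (forall i, homog_mx d (P i)) -> homog_mx d (\sum_i P i).
Proof. by move=> hP x y; rewrite summxE; apply: rpred_sum => i _; apply: hP. Qed.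

Definition algebra_basis : Prop :=
  (forall a : A, exists (p0 : S) (p : 'I_r -> S),
     a = ev p0 + \sum_i ev (p i) * w i) /\
  (forall (p0 : S) (p : 'I_r -> S), ev p0 + \sum_i ev (p i) * w i = 0 ->
     p0 = 0 /\ forall i, p i = 0).

Hypothesis basis : algebra_basis.

Hypothesis mul_basis : forall k i : 'I_r,
  exists (l : 'I_2 -> S) (la : 'I_r -> S),
  [/\ forall j, l j \is 1.-homog, forall j, la j \is 1.-homog
    & w k * w i = \sum_j ev (l j) * th j + \sum_j ev (la j) * w j].

Lemma evX j : ev 'X_j = th j.
Proof. by rewrite mmapX mmap1U. Qed.

Lemma mul_basis_quad (k i : 'I_r) : exists (q : S) (la : 'I_r -> S),
  [/\ q \is 2.-homog, forall l, la l \is 1.-homog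
    & w k * w i = ev q + \sum_l ev (la l) * w l].
Proof.
have [l [la [l1 la1 ->]]] := mul_basis k i.
exists (\sum_j l j * 'X_j), la; split=> //.
  by apply: rpred_sum => j _; apply: (@dhomogM _ _ _ 1 _ 1) => //; apply: dhomogXU.
rewrite rmorph_sum; congr (_ + _); apply: eq_bigr => j _.
by rewrite rmorphM /= evX.
Qed.

(* The rows of [M] generate over K[th 0, th 1] a submodule stable under [w i],
   which acts on them through linear forms in [th], and the rows of [Z] are a
   basis of their relations over K[th 0, th 1].  Then the relations over the whole
   algebra are generated by [Z] and the [w i *: M = P *m M], again linear. *)
Record linear_pair z n p (Z : 'M[S]_(z, n)) (M : 'M[A]_(n, p)) : Prop := LinearPair {
  lp_act : forall i, exists2 P : 'M[S]_n, homog_mx 1 P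
    & w i *: M = map_mx ev P *m M;
  lp_homog : homog_mx 1 Z;
  lp_rel : map_mx ev Z *m M = 0;
  lp_free : forall y : 'rV[S]_z, y *m Z = 0 -> y = 0;
  lp_span : forall u : 'rV[S]_n, map_mx ev u *m M = 0 -> exists y, u = y *m Z;
  lp_span2 : forall u : 'rV[S]_n, homog_mx 2 u -> map_mx ev u *m M = 0 ->
    exists2 y, homog_mx 1 y & u = y *m Z
}.

Lemma lp_span2_mx z n p (Z : 'M[S]_(z, n)) (M : 'M[A]_(n, p)) a (U : 'M[S]_(a, n)) :
  linear_pair Z M -> homog_mx 2 U -> map_mx ev U *m M = 0 ->
  exists2 Y, homog_mx 1 Y & U = Y *m Z.
Proof.
move=> ZM hU UM.
have /choice[Y hY] : forall x, exists y, homog_mx 1 y /\ row x U = y *m Z.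
  move=> x; have [||y hy e] := lp_span2 ZM (u := row x U).
  - by move=> s t; rewrite mxE.
  - by rewrite map_row -row_mul UM row0.
  by exists y.
exists (\matrix_x Y x) => [x y|]; first by rewrite mxE; have [h _] := hY x.
by apply/row_matrixP => x; rewrite row_mul rowK; have [_] := hY x.
Qed.

Lemma ev_free n (u0 : 'rV[S]_n) (u : 'I_r -> 'rV[S]_n) :
  map_mx ev u0 + \sum_i map_mx ev (u i) *m (w i)%:M = 0 ->
  u0 = 0 /\ forall i, u i = 0.
Proof.
move=> e; have h x : u0 0 x = 0 /\ forall i, u i 0 x = 0.
  apply: (basis.2 (u0 0 x) (fun i => u i 0 x)).
  have := congr1 (fun v : 'rV_n => v 0 x) e; rewrite mxE summxE [X in X + _]mxE [RHS]mxE => ex.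
  rewrite -[RHS]ex.
  congr (_ + _); apply: eq_bigr => i _.
  by rewrite mul_mx_scalar !mxE mulrC.
by split=> [|i]; apply/rowP => x; rewrite [RHS]mxE; have [h0 h1] := h x.
Qed.

Lemma ev_span n (v : 'rV[A]_n) : exists (u0 : 'rV[S]_n) (u : 'I_r -> 'rV[S]_n),
  v = map_mx ev u0 + \sum_i map_mx ev (u i) *m (w i)%:M.
Proof.
have /choice[p0 /choice[p hp]] := fun x => basis.1 (v 0 x).
exists (\row_x p0 x), (fun i => \row_x p x i).
apply/rowP => x; rewrite hp [RHS]mxE summxE [X in _ = X + _]mxE mxE; congr (_ + _); apply: eq_bigr => i _.
by rewrite mul_mx_scalar !mxE mulrC.
Qed.

(** Modulo the rows of [w i - P i] every relation has a representative over S, hence a combination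
    of [Z], so these rows and [Z] generate. They are free over S: the coordinates along the [w i]
    give the coefficients of the new rows, and then [Z] is free. The new family thus has no
    S-relations, whence the matrix with zero rows. *)
Lemma linear_pair_step z n p (Z : 'M[S]_(z, n)) (M : 'M[A]_(n, p)) :
  linear_pair Z M ->
  exists M' : 'M[A]_(z + \sum_(i < r) n, n),
    [/\ linear_pair (0 : 'M[S]_(0, z + \sum_(i < r) n)) M',
        forall (V : {pred A}), (forall i, w i \in V) ->
          (forall p : S, p \is 1.-homog -> ev p \in V) ->
          submod_closed V -> forall x y, M' x y \in V
      & forall v : 'rV_n, v *m M = 0 <-> exists v', v = v' *m M'].
Proof.
move=> ZM; have /choice[P hP] : forall i, exists P : 'M[S]_n,
    homog_mx 1 P /\ w i *: M = map_mx ev P *m M.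
  by move=> i; have [P] := lp_act ZM i; exists P.
have hP1 i : homog_mx 1 (P i) by case: (hP i).
have hPM i : map_mx ev (P i) *m M = w i *: M by case: (hP i).
pose B i : 'M[A]_n := (w i)%:M - map_mx ev (P i).
have BM i : B i *m M = 0 by rewrite mulmxBl mul_scalar_mx hPM subrr.
pose M' : 'M[A]_(z + \sum_(i < r) n, n) := col_mx (map_mx ev Z) (\mxcol_(i < r) B i).
have mulM' (y : 'rV[A]_z) (u : 'I_r -> 'rV[A]_n) :
    row_mx y (\mxrow_i u i) *m M' = y *m map_mx ev Z + \sum_i u i *m B i.
  by rewrite mul_row_col mul_mxrow_mxcol.
have M'M (v' : 'rV_(z + \sum_(i < r) n)) : v' *m M' *m M = 0.
  rewrite -[v']hsubmxK -[rsubmx v']submxrowK mulM' mulmxDl -mulmxA (lp_rel ZM) mulmx0.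
  by rewrite add0r mulmx_suml big1 // => i _; rewrite -mulmxA BM mulmx0.
exists M'; split; last first.
- move=> v; split=> [vM|[v' ->]]; last exact: M'M.
  have [u0 [u ev_v]] := ev_span v.
  pose t := u0 + \sum_i u i *m P i.
  have et : v = map_mx ev t + \sum_i map_mx ev (u i) *m B i.
    rewrite ev_v map_mxD map_mx_sum -addrA -big_split /=; congr (_ + _).
    by apply: eq_bigr => i _; rewrite mulmxBr map_mxM addrC subrK.
  have [|y ey] := lp_span ZM (u := t).
    move: vM; rewrite et mulmxDl mulmx_suml.
    by rewrite [X in _ + X]big1 ?addr0 // => i _; rewrite -mulmxA BM mulmx0.
  exists (row_mx (map_mx ev y) (\mxrow_i map_mx ev (u i))).
  by rewrite mulM' et ey map_mxM.
- move=> V Vw Vev Vmod x y.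
  have VB : forall a b, a \in V -> b \in V -> a - b \in V.
    move=> a b Va Vb; rewrite -scaleN1r addrC.
    exact: (Vmod.2 (-1) b a).
  rewrite /M' mxE; case: (split x) => x'; first by rewrite mxE; apply/Vev/(lp_homog ZM).
  rewrite !mxE; apply: VB; last exact/Vev/hP1.
  by case: (_ == _); rewrite ?mulr1n ?mulr0n //; case: Vmod.
have freeM' (u : 'rV[S]_(z + \sum_(i < r) n)) : map_mx ev u *m M' = 0 -> u = 0.
  rewrite -[u]hsubmxK -[rsubmx u]submxrowK; move: (lsubmx u) (submxrow _) => y v.
  have -> : map_mx ev (row_mx y (\mxrow_j v j)) =
      row_mx (map_mx ev y) (\mxrow_j map_mx ev (v j)).
    by rewrite map_row_mx; congr row_mx; apply/matrixP => a b; rewrite !mxE.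
  rewrite mulM' -map_mxM.
  have -> : \sum_i map_mx ev (v i) *m B i =
      \sum_i map_mx ev (v i) *m (w i)%:M - \sum_i map_mx ev (v i *m P i).
    by rewrite -sumrB; apply: eq_bigr => i _; rewrite mulmxBr -map_mxM.
  rewrite -map_mx_sum addrCA addrC -map_mxB => /ev_free[e0 ev0].
  have e1 : \sum_i v i *m P i = 0 by rewrite big1 // => i _; rewrite ev0 mul0mx.
  rewrite e1 subr0 in e0; rewrite (lp_free ZM e0).
  apply/matrixP => a b; rewrite !mxE; case: split => c; rewrite mxE // ev0 !mxE //.
split=> //.
- move=> k.
  have /choice[q /choice[la hq]] := mul_basis_quad k.
  (* With [w k * w i] equal to q_i + sum_l la_il w_l, the row w_k (w_i - P_i) equals sum_l la_il
     (w_l - P_l) - P_i (w_k - P_k) plus the quadratic matrix below. That matrix annihilates [M], so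
     it is a linear multiple of [Z]. *)
  have /choice[F hF] : forall i, exists F : 'M[S]_(n, z), homog_mx 1 F /\
      (q i)%:M + \sum_l (la i l)%:M *m P l - P i *m P k = F *m Z.
    move=> i; have [q2 la1 ewk] := hq i.
    have [||F hF ->] := lp_span2_mx (U := (q i)%:M + \sum_l (la i l)%:M *m P l - P i *m P k) ZM.
    - apply: homog_mxD; last exact/homog_mxN/(homog_mxM (hP1 i) (hP1 k)).
      apply: homog_mxD; first exact: homog_mx_scalar.
      apply: homog_mx_sum => l; apply: (homog_mxM (d := 1) (e := 1)) => //.
      exact: homog_mx_scalar.
    - rewrite map_mxB map_mxD map_mx_sum !mulmxBl mulmxDl map_mxM -mulmxA hPM.
      rewrite -scalemxAr hPM scalerA ewk scalerDl mulmx_suml map_scalar_mx.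
      rewrite mul_scalar_mx [X in _ - (_ + X)]scaler_suml opprD addrACA subrr add0r.
      rewrite -sumrB big1 // => l _.
      by rewrite map_mxM map_scalar_mx -mulmxA hPM mul_scalar_mx scalerA subrr.
    by exists F.
  (* For the rows of [Z] the decomposition is w_k Z = Z (w_k - P_k) + Z P_k, with [Z *m P k] again a
     quadratic relation. *)
  have [||Y hY eY] := lp_span2_mx (U := Z *m P k) ZM.
  - exact: (homog_mxM (lp_homog ZM) (hP1 k)).
  - by rewrite map_mxM -mulmxA hPM -scalemxAr (lp_rel ZM) scaler0.
  pose Q i l : 'M[S]_n := (la i l)%:M - (if l == k then P i else 0).
  exists (block_mx Y (\mxrow_(l < r) (if l == k then Z else 0))
           (\mxcol_(i < r) F i) (\mxblock_(i < r, l < r) Q i l)).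
    move=> x y; rewrite mxE; case: split => x'; rewrite mxE; case: split => y'.
    + exact: hY.
    + by rewrite mxE; case: eqP => _; [apply: (lp_homog ZM)|rewrite mxE rpred0].
    + by rewrite mxE; case: (hF (tagnat.sig1 x')).
    + rewrite mxE /Q; apply: homog_mxD; last first.
        by apply: homog_mxN; case: eqP => _ //; apply: homog_mx0.
      by apply: homog_mx_scalar; case: (hq (tagnat.sig1 x')).
  have -> : map_mx ev (block_mx Y (\mxrow_(l < r) (if l == k then Z else 0))
           (\mxcol_(i < r) F i) (\mxblock_(i < r, l < r) Q i l)) =
    block_mx (map_mx ev Y) (\mxrow_(l < r) (if l == k then map_mx ev Z else 0))
      (\mxcol_(i < r) map_mx ev (F i)) (\mxblock_(i < r, l < r) map_mx ev (Q i l)).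
    rewrite map_block_mx; congr block_mx; apply/matrixP => a b; rewrite !mxE //.
    by case: eqP => _; rewrite ?mxE ?rmorph0.
  rewrite /M' mul_block_col mul_mxrow_mxcol mul_mxblock_mxrow mxcol_mul scale_col_mx.
  congr col_mx.
    rewrite (bigD1 k) //= eqxx big1 ?addr0; last first.
      by move=> l /negPf->; rewrite mul0mx.
    by rewrite -!map_mxM -eY mulmxBr mul_mx_scalar map_mxM addrC subrK.
  rewrite -mxcolD; have -> : w k *: \mxcol_i B i = \mxcol_i (w k *: B i).
    by apply/matrixP => a b; rewrite !mxE.
  apply: eq_mxcol => i; have [q2 la1 ewk] := hq i; have [_ eF] := hF i.
  rewrite -map_mxM -eF.
  have -> : \sum_l map_mx ev (Q i l) *m B l =
    \sum_l (map_mx ev (la i l)%:M *m B l) - map_mx ev (P i) *m B k.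
    rewrite (eq_bigr (fun l => map_mx ev (la i l)%:M *m B l -
      map_mx ev (if l == k then P i else 0) *m B l)) => [|l _]; last first.
      by rewrite map_mxB mulmxBl.
    rewrite sumrB; congr (_ - _); rewrite (bigD1 k) //= eqxx big1 ?addr0 //.
    by move=> l /negPf->; rewrite map_mx0 mul0mx.
  have -> : \sum_l map_mx ev (la i l)%:M *m B l =
     (\sum_l ev (la i l) * w l)%:M - map_mx ev (\sum_l (la i l)%:M *m P l).
    rewrite map_mx_sum (raddf_sum (scalar_mx : A -> 'M[A]_n)) -sumrB; apply: eq_bigr => l _.
    by rewrite map_mxM map_scalar_mx mulmxBr -scalar_mxM.
  rewrite mulmxBr mul_mx_scalar !map_mxB !map_mxD map_mxM map_scalar_mx.
  rewrite scalerBr scale_scalar_mx ewk (raddfD (scalar_mx : A -> 'M[A]_n)) /= opprB.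
  by rewrite [RHS]addrACA addKr [X in _ = X - _]addrACA subrr addr0.
- exact: homog_mx0.
- by rewrite map_mx0 mul0mx.
- by move=> y _; apply/rowP; case.
- by move=> u /freeM'->; exists 0; rewrite mul0mx.
- by move=> u _ /freeM'->; exists 0; [apply: homog_mx0|rewrite mul0mx].
Qed.

Definition koszul_mx : 'M[S]_(1, 2 + r) :=
  row_mx (\row_(j < 2) (if j == 0 then 'X_1 else - 'X_0)) 0.

Lemma koszul_mxl j : koszul_mx 0 (lshift r j) = if j == 0 then 'X_1 else - 'X_0.
Proof. by rewrite /koszul_mx row_mxEl mxE. Qed.

Lemma koszul_mxr i : koszul_mx 0 (rshift 2 i) = 0.
Proof. by rewrite /koszul_mx row_mxEr mxE. Qed.

Definition generator_col : 'M[A]_(2 + r, 1) := col_mx (\col_j th j) (\col_i w i).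

Lemma mul_generator_col (u : 'rV[A]_(2 + r)) :
  u *m generator_col =
  (\sum_j u 0 (lshift r j) * th j + \sum_i u 0 (rshift 2 i) * w i)%:M.
Proof.
rewrite -[u]hsubmxK mul_row_col [RHS]mx11_scalar [LHS]mx11_scalar; congr (_%:M).
rewrite [RHS]mxE eqxx mulr1n mxE.
by congr (_ + _); rewrite mxE; apply: eq_bigr => x _; rewrite (row_mxEl, row_mxEr) !mxE.
Qed.

(** Since 1 and the [w i] are free over S, a relation among [th 0], [th 1] and the [w i] has
    coefficient zero on each [w i], and what remains is a syzygy of the two variables. *)
Lemma koszul_generator_pair : linear_pair koszul_mx generator_col.
Proof.
have span (u : 'rV[S]_(2 + r)) : map_mx ev u *m generator_col = 0 ->
    exists y, u = y *m koszul_mx.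
  rewrite mul_generator_col -(rmorph0 (@scalar_mx A 1)).
  move=> /(congr1 (fun x : 'M_1 => x 0 0)); rewrite !mxE eqxx !mulr1n => e.
  have [] := basis.2 (\sum_j u 0 (lshift r j) * 'X_j) (fun i => u 0 (rshift 2 i)).
    rewrite -[RHS]e rmorph_sum; congr (_ + _); apply: eq_bigr => x _.
      by rewrite rmorphM /= evX mxE.
    by rewrite mxE.
  rewrite big_ord_recl big_ord1 => /koszul_relation[] // h [e0 e1] e2.
  exists h%:M; apply/rowP => x; rewrite mul_scalar_mx mxE.
  rewrite -(splitK x); case: (split x) => j /=; last first.
    by rewrite koszul_mxr e2 mulr0.
  rewrite koszul_mxl; case: (unliftP 0 j) => [j' ->|->] /=.
    rewrite [j']ord1 mulrN -mulNr.
    by rewrite -e1; congr (u _ _); apply: val_inj.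
  by rewrite -e0; congr (u _ _); apply: val_inj.
split.
- move=> k; have /choice[l /choice[la hl]] := mul_basis k.
  exists (block_mx 0 (\matrix_(j < 2, i < r) (if i == k then 'X_j else 0))
     (\matrix_(i < r, j < 2) l i j) (\matrix_(i < r, j < r) la i j)).
    move=> x y; rewrite mxE; case: split => x'; rewrite mxE; case: split => y'.
    + by rewrite mxE rpred0.
    + by rewrite mxE; case: eqP => _; rewrite ?rpred0 ?dhomogXU.
    + by rewrite mxE; have [] := hl x'.
    + by rewrite mxE; have [] := hl x'.
  rewrite /generator_col map_block_mx mul_block_col scale_col_mx.
  congr col_mx; apply/colP => x; rewrite !mxE.
    rewrite big1 ?add0r => [|i _]; last by rewrite !mxE rmorph0 mul0r.
    rewrite (bigD1 k) //= !mxE eqxx evX big1 ?addr0 1?mulrC // => i /negPf ik.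
    by rewrite !mxE ik rmorph0 mul0r.
  have [_ _ ->] := hl x.
  by congr (_ + _); apply: eq_bigr => i _; rewrite !mxE.
- move=> x y; rewrite mxE; case: split => y'; rewrite mxE ?rpred0 //.
  by case: (_ == _); rewrite ?rpredN dhomogXU.
- rewrite mul_generator_col [X in _ + X]big1 ?addr0 => [|i _]; last first.
    by rewrite mxE koszul_mxr rmorph0 mul0r.
  rewrite big_ord_recl big_ord1 ![map_mx _ _ _ _]mxE !koszul_mxl /= rmorphN /= !evX.
  rewrite -(rmorph0 (@scalar_mx A 1)); congr (_%:M).
  have -> : lift ord0 ord0 = 1 :> 'I_2 by apply: val_inj.
  by rewrite mulNr mulrC subrr.
- move=> y /(congr1 (fun v : 'rV_(2 + r) => v 0 (lshift r 0))).
  rewrite mxE big_ord1 koszul_mxl mxE /= => /eqP.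
  rewrite mulf_eq0 (negPf (mpolyXU_neq0 _ _)) orbF => /eqP y0.
  by apply/rowP => i; rewrite ord1 y0 mxE.
- exact: span.
move=> u hu /span[y ey]; exists y => // i x; rewrite !ord1.
apply: (@dhomogMX_inv _ _ 1).
have := hu 0 (lshift r 0); by rewrite ey mxE big_ord1 koszul_mxl.
Qed.

Lemma ev_homog1 (V : {pred A}) (p : S) :
  submod_closed V -> (forall j, th j \in V) -> p \is 1.-homog -> ev p \in V.
Proof.
move=> [V0 Vlin] Vth /dhomogP p1; rewrite /mmap big_seq.
elim/big_rec: _ => // u x up Vx; rewrite /= mulr_algl.
apply: Vlin => //; have /mdeg1P[j /eqP->] : mdeg u == 1 by apply/eqP/p1.
by rewrite mmap1U.
Qed.

Lemma scalar_mx11_eq (x : A) (M : 'M[A]_1) : M = x%:M <-> M 0 0 = x.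
Proof.
split=> [->|<-]; first by rewrite mxE.
by rewrite -mx11_scalar.
Qed.

(** The first summand counts the rows of [Z]: one Koszul relation at the start, none later. The sum
    of [r] equal terms is left unevaluated so that the size agrees by conversion with that of
    [linear_pair_step]. *)
Fixpoint betti (i : nat) : nat :=
  if i is j.+1 then ((j == 0%N) + \sum_(x < r) betti j)%N else (2 + r)%N.

Lemma linear_resolution (gr : nat -> {pred A}) :
    submod_closed (gr 1) -> (forall j, th j \in gr 1) -> (forall i, w i \in gr 1) ->
    (forall x, x \in irrelevant gr <-> exists (a : 'I_2 -> A) (b : 'I_r -> A),
       x = \sum_j a j * th j + \sum_i b i * w i) ->
  residue_field_linear_resolution gr.
Proof.
move=> gr1 gr_th gr_w irr.
pose ok (i : nat) (Z : 'M[S]_(i == 0%N, betti i)) (M : 'M[A]_(betti i, lin_rank betti i)) :=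
  linear_pair Z M /\ forall x y, M x y \in gr 1.
pose T (i : nat) := {ZM : 'M[S]_(i == 0%N, betti i) * 'M[A]_(betti i, lin_rank betti i) |
  ok i ZM.1 ZM.2}.
(* The next matrix has to be data and not a mere existence statement, so that [nat_rect] can build
   the whole sequence. *)
have step (i : nat) (t : T i) : {t' : T i.+1 | forall v : 'rV_(betti i),
    v *m (sval t).2 = 0 <-> exists v', v = v' *m (sval t').2}.
  case: t => -[Z M] [/= ZM grM]; apply: cid.
  have [M' [ZM' grM' exM']] := linear_pair_step ZM.
  have okM' : ok i.+1 0 M' by split=> //; apply: grM' => // p; apply: ev_homog1.
  by exists (exist _ (0, M') okM').
have ok0 : ok 0%N koszul_mx generator_col.
  split; first exact: koszul_generator_pair.
  by move=> x y; rewrite /generator_col mxE; case: split => x'; rewrite mxE.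
pose t0 : T 0%N := exist _ (koszul_mx, generator_col) ok0.
pose t i : T i := nat_rect T t0 (fun i t => sval (step i t)) i.
exists betti, (fun i => (sval (t i)).2); split=> [i x y|v|i v].
- by case: (svalP (t i)).
- rewrite irr; split=> [[a [b ev00]]|[u ->]].
    exists (row_mx (\row_j a j) (\row_i b i)); rewrite /= mul_generator_col.
    apply/scalar_mx11_eq; rewrite ev00; congr (_ + _); apply: eq_bigr => x _.
      by rewrite row_mxEl mxE.
    by rewrite row_mxEr mxE.
  exists (fun j => u 0 (lshift r j)), (fun i => u 0 (rshift 2 i)).
  by rewrite mul_generator_col mxE eqxx mulr1n.
- exact: (svalP (step i (t i)) v).
Qed.

End LinearResolution.

(** * Dimension and depth *)

Section AlgebraicDependence.
Variables (K : fieldType) (A : comAlgType K).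

Definition ideal_closed (J : {pred A}) : Prop :=
  (forall u v, u \in J -> v \in J -> u + v \in J) /\
  (forall a u, u \in J -> a * u \in J).

(** Nested three times over [in_alg A], this evaluates a polynomial in three variables one variable
    at a time, so that algebraic independence can be proved by adding one element at a time. *)
Definition eval_poly (B : comNzRingType) (e : {rmorphism B -> A}) (f : A) :
  {poly B} -> A := horner_eval f \o map_poly e.

HB.instance Definition _ B e f := GRing.RMorphism.on (@eval_poly B e f).

Lemma eval_poly_poly (B : comNzRingType) (e : {rmorphism B -> A}) f n (E : nat -> B) :
  eval_poly e f (\poly_(i < n) E i) = \sum_(i < n) e (E i) * f ^+ i.
Proof.
rewrite poly_def rmorph_sum /=; apply: eq_bigr => i _.
by rewrite /eval_poly /= /horner_eval map_polyZ map_polyXn hornerZ hornerXn.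
Qed.

(* Modulo [J'] only the constant coefficient of a relation survives; once it is
   zero, the relation can be divided by [f]. *)
Lemma eval_poly_inj (B : comNzRingType) (e : {rmorphism B -> A}) f (J J' : {pred A}) :
    ideal_closed J' -> {subset J <= J'} -> f \in J' ->
    (forall b, e b \in J' -> b = 0) -> (forall x, f * x \in J -> x \in J) ->
  forall p, eval_poly e f p \in J -> p = 0.
Proof.
move=> [addJ' mulJ'] JJ' J'f e_inj f_reg; elim/poly_ind => [//|p b IHp].
have -> : eval_poly e f (p * 'X + b%:P) = eval_poly e f p * f + e b.
  by rewrite rmorphD rmorphM /= /eval_poly /= /horner_eval map_polyX map_polyC hornerX hornerC.
move=> pJ; have b0 : b = 0.
  apply: e_inj; have -> : e b = (eval_poly e f p * f + e b) + (- eval_poly e f p) * f by ring.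
  by apply: addJ'; [apply: JJ'|apply: mulJ'].
move: pJ; rewrite b0 rmorph0 addr0 mulrC => /f_reg/IHp->.
by rewrite mul0r addr0.
Qed.

Lemma row_dependence (p q : nat) (M : 'M[K]_(p, q)) :
  (q < p)%N -> exists2 v : 'rV_p, v != 0 & v *m M = 0.
Proof.
move=> qp; have : kermx M != 0.
  by rewrite -mxrank_eq0 mxrank_ker subn_eq0 -ltnNge (leq_ltn_trans (rank_leq_col M)).
move=> /rowV0Pn[v /sub_kermxP vM v0]; by exists v.
Qed.

(** An exhaustive multiplicative filtration whose pieces have dimension O(d^2). It replaces the
    Hilbert function and forbids three algebraically independent elements. *)
Definition quadratic_growth : Prop := exists (V : nat -> {pred A}) (C : nat),
  [/\ forall x, exists d, x \in V d,
      forall d e, (d <= e)%N -> {subset V d <= V e},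
      1 \in V 0%N,
      forall d e x y, x \in V d -> y \in V e -> x * y \in V (d + e)%N
    & forall d, exists (n : nat) (g : 'I_n -> A), (n <= C * d.+1 ^ 2)%N /\
        forall x, x \in V d -> exists a : 'I_n -> K, x = \sum_i a i *: g i].

Lemma quadratic_growth_dependence f0 f1 f2 : quadratic_growth ->
  (forall p, eval_poly (eval_poly (eval_poly (in_alg A) f2) f1) f0 p = 0 -> p = 0) ->
  False.
Proof.
move=> [V [C [Vall Vmono V1 VM Vdim]]] inj.
have [d0 Vf0] := Vall f0; have [d1 Vf1] := Vall f1; have [d2 Vf2] := Vall f2.
pose d := (d0 + d1 + d2)%N.
have VX f k : f \in V d -> f ^+ k \in V (d * k)%N.
  move=> Vf; elim: k => [|k IHk]; first by rewrite muln0 expr0.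
  by rewrite exprS mulnS; apply: (VM).
have {}Vf0 : f0 \in V d by apply: Vmono Vf0; rewrite /d; lia.
have {}Vf1 : f1 \in V d by apply: Vmono Vf1; rewrite /d; lia.
have {}Vf2 : f2 \in V d by apply: Vmono Vf2; rewrite /d; lia.
(* The N^3 products with exponents below N lie in [V (3 * d * N)], which is spanned by at most C
   (3dN + 1)^2 <= C (3d + 1)^2 N^2 elements. This N is the least one exceeding C (3d + 1)^2. *)
pose N := (C * (3 * d).+1 ^ 2).+1.
have [n [g [n_le span]]] := Vdim (3 * d * N)%N.
have lt_n : (n < #|{: 'I_N * 'I_N * 'I_N}|)%N.
  rewrite !card_prod !card_ord; apply: leq_ltn_trans n_le _.
  have le1 : ((3 * d * N).+1 <= (3 * d).+1 * N)%N by rewrite /N; nia.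
  have le2 : ((3 * d * N).+1 ^ 2 <= (3 * d).+1 ^ 2 * N ^ 2)%N by rewrite -expnMn leq_sqr.
  apply: (@leq_ltn_trans (C * ((3 * d).+1 ^ 2 * N ^ 2))); first by rewrite leq_mul2l le2 orbT.
  rewrite mulnA -[(N * N * N)%N]mulnA -[(N * (N * N))%N]/(N * (N * N))%N -mulnn.
  by rewrite ltn_mul2r; apply/andP; split; rewrite ?muln_gt0 /N.
have /choice[a ha] (t : 'I_N * 'I_N * 'I_N) : exists a : 'I_n -> K,
    f0 ^+ t.1.1 * f1 ^+ t.1.2 * f2 ^+ t.2 = \sum_i a i *: g i.
  apply: span; case: t => -[i j] k /=.
  apply: (Vmono (d * i + d * j + d * k)%N); last by apply: (VM); [apply: (VM)|]; apply: VX.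
  rewrite -!mulnDr -mulnA mulnCA leq_mul2l; apply/orP; right.
  have := ltn_ord i; have := ltn_ord j; have := ltn_ord k; lia.
have [v v_neq0 vM] := row_dependence (\matrix_(t < _, i < n) a (enum_val t) i) lt_n.
pose c i j k := v 0 (enum_rank (inord i, inord j, inord k) : 'I_#|{: 'I_N * 'I_N * 'I_N}|).
pose p := \poly_(i < N) \poly_(j < N) \poly_(k < N) c i j k.
have p0 : p = 0.
  apply: inj; rewrite eval_poly_poly.
  transitivity (\sum_(t : 'I_N * 'I_N * 'I_N)
     v 0 (enum_rank t) *: (f0 ^+ t.1.1 * f1 ^+ t.1.2 * f2 ^+ t.2)).
    transitivity (\sum_(i < N) \sum_(j < N) \sum_(k < N)
       v 0 (enum_rank (i, j, k)) *: (f0 ^+ i * f1 ^+ j * f2 ^+ k)).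
      apply: eq_bigr => i _; rewrite -[X in X * _]/(eval_poly _ _ _) eval_poly_poly mulr_suml; apply: eq_bigr => j _.
      rewrite -[X in X * _ * _]/(eval_poly _ _ _) eval_poly_poly !mulr_suml; apply: eq_bigr => k _.
      rewrite /c !inord_val /= -!mulrA mulr_algl; congr (_ *: _); ring.
    by rewrite pair_bigA pair_bigA; apply: eq_bigr => -[[i j] k].
  under eq_bigr do rewrite ha scaler_sumr.
  rewrite exchange_big big1 // => i _ /=.
  under eq_bigr do rewrite scalerA.
  rewrite -scaler_suml (reindex (enum_val : 'I_#|{: 'I_N * 'I_N * 'I_N}| -> _)) /=; last first.
    by apply: onW_bij; apply: enum_val_bij.
  have := congr1 (fun u : 'rV_n => u 0 i) vM; rewrite !mxE => vMi.
  rewrite [X in X *: _](_ : _ = 0) ?scale0r // -[RHS]vMi.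
  by apply: eq_bigr => t _; rewrite enum_valK mxE.
move/eqP: v_neq0; apply; apply/rowP => t; rewrite mxE.
have := congr1 (fun q : {poly {poly {poly K}}} =>
  q`_((enum_val t).1.1)`_((enum_val t).1.2)`_((enum_val t).2)) p0.
rewrite !coef0 /p !(coef_poly, ltn_ord) /c !inord_val.
by rewrite -!surjective_pairing enum_valK.
Qed.

End AlgebraicDependence.

Section CohenMacaulay.
Variables (K : fieldType) (A : comAlgType K).

(* Such a chain would make [f 0], [f 1], [f 2] algebraically independent; chains
   of primes and regular sequences are both instances. *)
Lemma no_regular_chain (J : nat -> {pred A}) (f : nat -> A) :
    quadratic_growth A ->
    (forall i, (i <= 3)%N -> ideal_closed (J i)) -> 0 \in J 0%N -> 1 \notin J 3%N ->
    (forall i, (i < 3)%N -> [/\ {subset J i <= J i.+1}, f i \in J i.+1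
       & forall x, f i * x \in J i -> x \in J i]) ->
  False.
Proof.
move=> growth idJ J0 J3 hf; have [J01 f0 r0] := hf 0%N isT.
have [J12 f1 r1] := hf 1%N isT; have [J23 f2 r2] := hf 2%N isT.
apply: (quadratic_growth_dependence (f0 := f 0%N) (f1 := f 1%N) (f2 := f 2%N) growth) => p ep.
rewrite -ep in J0.
apply: (eval_poly_inj (J := J 0%N) (J' := J 1%N) (idJ 1%N isT) J01 f0 _ r0) J0.
apply: (eval_poly_inj (J := J 1%N) (J' := J 2%N) (idJ 2%N isT) J12 f1 _ r1).
apply: (eval_poly_inj (J := J 2%N) (J' := J 3%N) (idJ 3%N isT) J23 f2 _ r2) => b J3b.
apply/eqP/negPn/negP => b0; case/negP: J3.
have -> : 1 = (b^-1)%:A * b%:A :> A by rewrite mulr_algl scalerA mulVf // scale1r.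
exact: (idJ 3%N isT).2.
Qed.

Lemma prime_ideal_closed (P : {pred A}) : prime_ideal P -> ideal_closed P.
Proof.
move=> [[P0 _ Pl] _]; split=> [u v Pu Pv|a u Pu]; first by rewrite -[u]mul1r Pl.
by rewrite -[_ * _]addr0 Pl.
Qed.

Lemma ideal_gen_closed (S : {pred A}) : ideal_closed (ideal_gen S).
Proof. by split=> *; [apply: ideal_genD|apply: ideal_genM]. Qed.

(** An element of [P i.+1] outside [P i] is regular modulo the prime [P i], so a chain of length 3
    feeds [no_regular_chain]. *)
Lemma prime_chain_le2 : quadratic_growth A -> ~ exists P : nat -> {pred A}, prime_chain 3 P.
Proof.
move=> growth [P [Pprime Plt]].
have /choice[f hf] : forall i, exists x, (i < 3)%N -> x \in P i.+1 /\ x \notin P i.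
  move=> i; case: (boolP (i < 3)%N) => [i3|]; last by exists 0.
  have /existsNP[x xP] := (Plt i i3).2; exists x => _.
  by split; apply/negP => Px; apply: xP => // Px'; rewrite Px' in Px.
apply: (no_regular_chain (J := P) (f := f) growth).
- by move=> i /Pprime; apply: prime_ideal_closed.
- by have [[]] := Pprime 0%N isT.
- by have [[]] := Pprime 3%N isT.
move=> i i3; have [Pf1 Pf] := hf i i3; have [Pi _] := Plt i i3; split=> // x.
have [_ Pp] := Pprime i (ltnW i3); move=> /Pp; by rewrite (negPf Pf).
Qed.

Lemma regular_seq_le2 (s : seq A) : quadratic_growth A -> regular_seq s -> (size s <= 2)%N.
Proof.
move=> growth [s1 s_reg]; rewrite leqNgt; apply/negP => s3.
have gen_sub (t u : seq A) : {subset t <= u} ->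
    {subset ideal_gen (mem t) <= ideal_gen (mem u)}.
  move=> tu x /ideal_genP[n [a [v [tv ->]]]]; apply/ideal_genP; exists n, a, v.
  by split=> // i; apply/tu/tv.
apply: (no_regular_chain (J := fun i => ideal_gen (mem (take i s))) (f := nth 0 s) growth).
- by move=> i _; apply: ideal_gen_closed.
- exact: ideal_gen0.
- by apply: contra s1; apply: gen_sub => x; apply: mem_take.
move=> i i3; have si : (i < size s)%N by apply: leq_trans s3.
split; last exact: s_reg.
  by apply: gen_sub => x; rewrite (take_nth 0 si) mem_rcons inE => ->; rewrite orbT.
have : s`_i \in take i.+1 s by rewrite (take_nth 0 si) mem_rcons inE eqxx.
exact: mem_ideal_gen.
Qed.

Section RegularParameters.
Variables (r : nat) (th : 'I_2 -> A) (w : 'I_r -> A).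
Hypothesis basis : algebra_basis th w.
Local Notation ev := (mmap (in_alg A) th).

Lemma ideal_gen1 (x y : A) : y \in ideal_gen (mem [:: x]) <-> exists a, y = a * x.
Proof.
split=> [/ideal_genP[n [a [s [xs ->]]]]|[a ->]]; last first.
  by apply/ideal_genM/mem_ideal_gen; rewrite !inE.
exists (\sum_i a i); rewrite mulr_suml; apply: eq_bigr => i _.
by have := xs i; rewrite !inE => /eqP->.
Qed.

(** In coordinates over S, multiplication by [th 0] is multiplication by ['X_0], which is injective.
    If [th 1 * x] equals [y * th 0], each coordinate pair is a syzygy of ['X_0] and ['X_1], so
    ['X_0] divides every coordinate of [x]. *)
Lemma basis_regular_seq :
  1 \notin ideal_gen (mem [:: th 0; th 1]) -> regular_seq [:: th 0; th 1].
Proof.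
move=> n1; split=> // -[|[|//]] _ x /=.
  move=> e; suff -> : x = 0 by apply: ideal_gen0.
  have {}e : th 0 * x = 0.
    move: e => /ideal_genP[n [a [s [s0 ->]]]]; rewrite big1 // => i _.
    by have : s i \in [::] := s0 i.
  have [p0 [p ex]] := basis.1 x; rewrite ex in e *.
  have [|q0 q] := basis.2 (p0 * 'X_0) (fun i => p i * 'X_0).
    transitivity (th 0 * (ev p0 + \sum_i ev (p i) * w i)); last exact: e.
    rewrite mulrDr [X in _ = _ + X]mulr_sumr rmorphM /= evX mulrC; congr (_ + _).
    by apply: eq_bigr => i _; rewrite rmorphM /= evX; ring.
  have X0 : 'X_0 != 0 :> {mpoly K[2]} by apply: mpolyXU_neq0.
  have -> : p0 = 0 by apply: (mulIf X0); rewrite mul0r.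
  rewrite rmorph0 add0r big1 // => i _.
  have -> : p i = 0 by apply: (mulIf X0); rewrite mul0r.
  by rewrite rmorph0 mul0r.
move=> /ideal_gen1[y]; have [p0 [p ->]] := basis.1 x; have [q0 [q ->]] := basis.1 y => e.
have [|e0 ei] := basis.2 (q0 * 'X_0 + (- p0) * 'X_1) (fun i => q i * 'X_0 + (- p i) * 'X_1).
  transitivity ((ev q0 + \sum_i ev (q i) * w i) * th 0 -
                th 1 * (ev p0 + \sum_i ev (p i) * w i)); last by rewrite e subrr.
  rewrite mulrDl mulrDr [X in _ = _ + X - _]mulr_suml [X in _ = _ - (_ + X)]mulr_sumr opprD addrACA -sumrB; congr (_ + _).
    by rewrite rmorphD !rmorphM rmorphN /= !evX; ring.
  by apply: eq_bigr => i _; rewrite rmorphD !rmorphM rmorphN /= !evX; ring.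
have [h0 [_ eh0]] := koszul_relation (i := 0) (k := 1) isT e0.
have /choice[h hh] : forall i, exists h, p i = h * 'X_0.
  by move=> i; have [h [_ /eqP]] := koszul_relation (i := 0) (k := 1) isT (ei i);
    rewrite mulNr eqr_opp => /eqP ->; exists h.
apply/ideal_gen1; exists (ev h0 + \sum_i ev (h i) * w i).
have -> : p0 = h0 * 'X_0 by apply: oppr_inj; rewrite eh0 mulNr.
rewrite mulrDl [X in _ = _ + X]mulr_suml rmorphM /= evX; congr (_ + _); apply: eq_bigr => i _.
by rewrite hh rmorphM /= evX; ring.
Qed.

Lemma basis_cohen_macaulay (gr : nat -> {pred A}) :
    standard_graded gr -> quadratic_growth A ->
    (exists P : nat -> {pred A}, prime_chain 2 P) ->
    (forall x, th x \in irrelevant gr) -> 1 \notin irrelevant gr ->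
  cohen_macaulay gr.
Proof.
move=> gr_std growth chain irr_th irr1; split=> //; exists 2; split; split=> //.
- exact: prime_chain_le2.
- exists [:: th 0; th 1].
  have sub : {subset [:: th 0; th 1] <= irrelevant gr}.
    by move=> x; rewrite !inE => /orP[]/eqP->; apply: irr_th.
  split=> //; apply: basis_regular_seq; apply: contra irr1.
  move=> /ideal_genP[n [a [s [sS ->]]]]; apply: ideal_gen_sum => i.
  exact/ideal_genM/sub/sS.
by move=> s s_reg _; apply: regular_seq_le2.
Qed.

End RegularParameters.
End CohenMacaulay.

(** * Standard monomials and convex exponents *)

Section StandardMonomials.
Variable m : nat.
Implicit Types (e t : 'X_{1..m}) (i k q : 'I_m).

Definition mweight e : nat := (\sum_(i < m) i * e i)%N.

Lemma mweightD e t : mweight (e + t) = (mweight e + mweight t)%N.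
Proof.
by rewrite /mweight -big_split; apply: eq_bigr => i _; rewrite mnmDE mulnDr.
Qed.

Lemma mweightU i : mweight U_(i) = i.
Proof.
rewrite /mweight (bigD1 i) //= big1 ?addn0 => [|k ki]; first by rewrite mnm1E eqxx muln1.
by rewrite mnm1E eq_sym (negPf ki) muln0.
Qed.

Lemma mweightM e n : mweight (e *+ n) = (mweight e * n)%N.
Proof.
by rewrite /mweight big_distrl; apply: eq_bigr => i _; rewrite mulmnE mulnA.
Qed.

Definition standard e : bool :=
  [forall i : 'I_m, forall k : 'I_m, (i.+1 < k)%N ==> (e i == 0%N) || (e k == 0%N)].

Lemma standardP e : reflect
  (forall i k : 'I_m, (i.+1 < k)%N -> e i = 0%N \/ e k = 0%N) (standard e).
Proof.
apply: (iffP idP) => [/forallP h i k ik|h].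
  by have /forallP/(_ k) := h i; rewrite ik => /orP[] /eqP; [left|right].
apply/forallP => i; apply/forallP => k; apply/implyP => /h[]->; by rewrite eqxx ?orbT.
Qed.

Lemma nonstandardP e : ~~ standard e ->
  exists (i k : 'I_m) e', (i.+1 < k)%N /\ e = (e' + U_(i) + U_(k))%MM.
Proof.
move=> /forallPn[i] /forallPn[k]; rewrite negb_imply negb_or => /and3P[ik ei ek].
exists i, k, (e - U_(i) - U_(k))%MM; split=> //.
rewrite -addmA [(U_(i) + _)%MM]addmC addmA !submK ?lep1mP //.
by rewrite mnmBE mnm1E (_ : i == k = false) ?subn0 //; apply/eqP => eik; move: ik; rewrite eik; lia.
Qed.

(* Replacing z_i z_k by z_(i+1) z_(k-1) decreases the sum of the squared
   indices and stops at the standard monomials. *)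
Lemma standard_ind (P : 'X_{1..m} -> Prop) :
  (forall e, standard e -> P e) ->
  (forall e i i1 k1 k, i1 = i.+1 :> nat -> k = k1.+1 :> nat -> (i < k1)%N ->
     P (e + U_(i1) + U_(k1))%MM -> P (e + U_(i) + U_(k))%MM) ->
  forall e, P e.
Proof.
move=> Pstd Pstep; pose mu e := (\sum_(i < m) i ^ 2 * e i)%N.
have muD e t : mu (e + t)%MM = (mu e + mu t)%N.
  by rewrite /mu -big_split; apply: eq_bigr => i _; rewrite mnmDE mulnDr.
have muU i : mu U_(i)%MM = (i ^ 2)%N.
  rewrite /mu (bigD1 i) //= big1 ?addn0 => [|k ki]; first by rewrite mnm1E eqxx muln1.
  by rewrite mnm1E eq_sym (negPf ki) muln0.
move=> e; have [n] := ubnP (mu e); elim: n e => // n IHn e le_mu.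
have [/Pstd//|/nonstandardP[i [k [e' [ik ee]]]]] := boolP (standard e).
have lt_i1 : (i.+1 < m)%N by apply: ltn_trans ik (ltn_ord k).
have lt_k1 : (k.-1 < m)%N by apply: leq_ltn_trans (leq_pred k) (ltn_ord k).
rewrite ee; apply: (Pstep _ i (Ordinal lt_i1) (Ordinal lt_k1) k) => //=; try lia.
apply: IHn; move: le_mu; rewrite ee !muD !muU /=.
move: (nat_of_ord i) (nat_of_ord k) ik => a b ab.
have [c ->] : exists c, b = (a + c.+2)%N by exists (b - a - 2)%N; lia.
by rewrite -!mulnn; nia.
Qed.

Lemma standard_form e : (1 < m)%N -> standard e ->
  exists (q q1 : 'I_m) (a b : nat), q1 = q.+1 :> nat /\ e = (U_(q) *+ a + U_(q1) *+ b)%MM.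
Proof.
move=> m1 /standardP std_e.
pose p i := e i != 0%N.
have [q [q1 [eq1 e0]]] : exists q q1 : 'I_m, q1 = q.+1 :> nat /\
    forall i, i != q -> i != q1 -> e i = 0%N.
  have [/existsP[i0 pi0]|/existsPn none] := boolP [exists i, p i]; last first.
    exists (Ordinal (ltnW m1)), (Ordinal m1); split=> // i _ _.
    by have := none i; rewrite negbK => /eqP.
  case: (arg_minnP (fun i : 'I_m => nat_of_ord i) pi0) => i pi min_i.
  have [i1|i1] := ltnP i.+1 m.
    exists i, (Ordinal i1); split=> // k ki ki1; apply/eqP/negPn/negP => pk.
    have ik := min_i k pk; have : (i.+1 < k)%N.
      by move: ki ki1; rewrite -!val_eqE /=; lia.
    move=> /std_e[] e0; first by move: pi; rewrite /p e0.
    by move: pk; rewrite e0.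
  (* When the smallest index that occurs is the last one, the pair must start one place earlier. *)
  have im : (i.-1 < m)%N by apply: leq_ltn_trans (leq_pred i) (ltn_ord i).
  exists (Ordinal im), i; split=> [/=|k _ ki]; first by have := ltn_ord i; lia.
  apply/eqP/negPn/negP => /min_i; move: ki; rewrite -val_eqE /=.
  by have := ltn_ord k; lia.
exists q, q1, (e q), (e q1); split=> //; apply/mnmP => i.
rewrite mnmDE !mulmnE !mnm1E.
have q1q : (q1 == q) = false by rewrite -val_eqE /= eq1; lia.
have [<-|qi] := eqVneq q i; first by rewrite q1q mul1n mul0n addn0.
have [<-|q1i] := eqVneq q1 i; first by rewrite mul1n mul0n.
by rewrite e0 1?eq_sym.
Qed.

Lemma standard_inj e t : (1 < m)%N -> standard e -> standard t ->
  mdeg e = mdeg t -> mweight e = mweight t -> e = t.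
Proof.
move=> m1 /(standard_form m1)[q [q1 [a [b [eq1 ->]]]]].
move=> /(standard_form m1)[s [s1 [a' [b' [es1 ->]]]]].
rewrite !mdegD !mdegMn !mdeg1 !mweightD !mweightM !mweightU eq1 es1 !mul1n => eab ew.
have [ab0|ab_gt0] := posnP (a + b).
  have [-> [-> [-> ->]]] : a = 0%N /\ b = 0%N /\ a' = 0%N /\ b' = 0%N by lia.
  by rewrite !mulm0n.
(* The mean index of z_q^a z_(q+1)^b lies between q and q+1. Two different intervals can share it
   only at a common end, where both monomials are the same power of one variable. *)
have key x d a1 b1 a2 b2 : (0 < a1 + b1)%N -> (a1 + b1 = a2 + b2)%N ->
    (x * a1 + x.+1 * b1 = (x + d.+1) * a2 + (x + d.+1).+1 * b2)%N ->
    [/\ d = 0, a1 = 0, b2 = 0 & a2 = b1]%N.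
  move=> pos e1 e2; have e3 := congr1 (muln x) e1.
  have e4 : (b1 = d.+1 * (a2 + b2) + b2)%N by nia.
  have d0 : d = 0%N by nia.
  by rewrite d0 in e4 *; split; lia.
have [qs|qs|qs] := ltngtP q s.
- have [d ed] : exists d, (nat_of_ord s = q + d.+1)%N by exists (s - q).-1; lia.
  rewrite ed in ew; have [d0 -> -> ->] := key _ _ _ _ _ _ ab_gt0 eab ew.
  have <- : q1 = s by apply: val_inj; rewrite /= eq1 ed d0; lia.
  by rewrite !mulm0n add0m addm0.
- have [d ed] : exists d, (nat_of_ord q = s + d.+1)%N by exists (q - s).-1; lia.
  rewrite ed in ew; rewrite eab in ab_gt0.
  have [d0 -> -> ->] := key _ _ _ _ _ _ ab_gt0 (esym eab) (esym ew).
  have <- : s1 = q by apply: val_inj; rewrite /= es1 ed d0; lia.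
  by rewrite !mulm0n add0m addm0.
have eqs : q = s by apply: val_inj.
have eqs1 : q1 = s1 by apply: val_inj; rewrite /= eq1 es1 qs.
move: ew; rewrite -eqs -eqs1 qs => ew.
by have [-> ->] : a = a' /\ b = b' by nia.
Qed.

(** A first index where [t] exceeds [e] must occur in [t], hence is [q] or [q1]. Comparing weights
    shows that [e] has at least as many factors z_q as [t], and if equally many, then no index above
    [q1], so the degree fixes the rest. *)
Lemma standard_lex_min e t : (1 < m)%N -> standard t ->
  mdeg e = mdeg t -> mweight e = mweight t -> ~~ lex_lt e t.
Proof.
move=> m1 /(standard_form m1)[q [q1 [a [b [eq1 et]]]]] ede ewe.
apply/negP => /existsP[i /andP[/forallP/= agree lt_i]].
have tE k : t k = ((k == q) * a + (k == q1) * b)%N.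
  by rewrite et mnmDE !mulmnE !mnm1E ![k == _]eq_sym.
have q1q : (q1 == q) = false by rewrite -val_eqE /= eq1; lia.
have tq : t q = a by rewrite tE eqxx eq_sym q1q; lia.
have iq : i = q \/ i = q1.
  by move: lt_i; rewrite tE; case: eqP => [|_]; [left|case: eqP => [|_]; [right|]].
have e0 k : (k < q)%N -> e k = 0%N.
  move=> kq; have ki : (k < i)%N by case: iq => ->; rewrite ?eq1; lia.
  have /implyP/(_ ki)/eqP-> := agree k.
  by rewrite tE -!val_eqE /= eq1; case: eqP; case: eqP; lia.
(* Subtraction on [nat] truncates, so [R] counts only the excess of indices above [q1]; for [t] it
   is zero. Together with [eR] and [tR] this gives [e q] as [t q] plus the excess. *)
pose R := (\sum_(k < m) (k - q1) * e k)%N.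
have eR : (mweight e + e q = q1 * mdeg e + R)%N.
  rewrite /mweight mdegE big_distrr -big_split /=.
  rewrite (_ : e q = \sum_(k < m) (k == q) * e k)%N; last first.
    rewrite (bigD1 q) //= eqxx mul1n big1 ?addn0 // => k /negPf->; lia.
  rewrite -big_split; apply: eq_bigr => k _ /=.
  have [kq|kq|/val_inj->] := ltngtP k q; first by rewrite e0 // !muln0.
    rewrite (_ : k == q = false) ?mul0n; last by rewrite -val_eqE /=; lia.
    have [d ->] : exists d, (nat_of_ord k = q + d.+1)%N by exists (k - q.+1)%N; lia.
    by rewrite eq1; nia.
  by rewrite eqxx eq1; nia.
have tR : (mweight t + t q = q1 * mdeg t)%N.
  rewrite tq et !mdegD !mdegMn !mdeg1 mweightD !mweightM !mweightU eq1; nia.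
have eqR : (e q = t q + R)%N by move: eR tR; rewrite ewe ede; lia.
case: iq => ei; first by move: lt_i; rewrite ei eqR; lia.
have eq_q : e q = t q.
  by have /implyP/(_ _)/eqP-> // := agree q; rewrite ei eq1; lia.
have R0 : R = 0%N by move: eqR; rewrite eq_q; lia.
have e0' k : (q1 < k)%N -> e k = 0%N.
  move=> qk; move/eqP: R0; rewrite sum_nat_eq0 => /forallP/(_ k) /=; nia.
have de : mdeg e = (e q + e q1)%N.
  rewrite mdegE (bigD1 q) //= (bigD1 q1) /= ?q1q // big1 ?addn0 // => k /andP[kq kq1].
  have [|] := ltnP k q; first exact: e0.
  by move=> qk; apply: e0'; move: kq kq1; rewrite -!val_eqE /= eq1; lia.
move: lt_i; rewrite ei tE q1q eqxx mul0n mul1n add0n.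
move: de; rewrite ede eq_q tq et mdegD !mdegMn !mdeg1; lia.
Qed.

End StandardMonomials.

(** * Products of generators with convex exponents *)

Section ExponentGeometry.
Variables (m : nat) (c : 'I_m -> 'X_{1..2}).
Implicit Types (e t : 'X_{1..m}).

Definition cexp e : 'X_{1..2} := (\sum_(i < m) c i *+ e i)%MM.

Lemma cexpE e x : cexp e x = (\sum_(i < m) c i x * e i)%N.
Proof. by rewrite /cexp mnm_sumE; apply: eq_bigr => i _; rewrite mulmnE. Qed.

Lemma cexpD e t : cexp (e + t) = (cexp e + cexp t)%MM.
Proof.
apply/mnmP => x; rewrite mnmDE !cexpE -big_split; apply: eq_bigr => i _.
by rewrite mnmDE mulnDr.
Qed.

Lemma cexpU i : cexp U_(i) = c i.
Proof.
apply/mnmP => x; rewrite cexpE (bigD1 i) //= big1 ?addn0 => [|k ki].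
  by rewrite mnm1E eqxx muln1.
by rewrite mnm1E eq_sym (negPf ki) muln0.
Qed.

Lemma cexpM e n : cexp (e *+ n) = (cexp e *+ n)%MM.
Proof.
apply/mnmP => x; rewrite mulmnE !cexpE big_distrl; apply: eq_bigr => i _.
by rewrite mulmnE mulnA.
Qed.

Hypothesis c_convex : convex c.

Let X x n := if insub n is Some i then c i x else 0%N.

Let XE x (i : 'I_m) : X x i = c i x.
Proof. by rewrite /X valK. Qed.

(** By convexity the increments c_(n+1) - c_n grow componentwise with n, so the step after [i] is at
    most the step before [k]. *)
Lemma convex_slide (i i1 k1 k : 'I_m) : i1 = i.+1 :> nat -> k = k1.+1 :> nat ->
  (i < k1)%N -> (c i1 + c k1 <= c i + c k)%MM.
Proof.
move=> e1 ek ik; apply/mnm_lepP => x; rewrite !mnmDE -!XE e1 ek.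
have [d ed] : exists d, (k1 = i + d.+1 :> nat)%N by exists (k1 - i.+1)%N; lia.
have := ltn_ord k; rewrite ek ed => {e1 ek ik ed i1 k1 k}.
have conv n : (n.+2 < m)%N -> (X x n.+1 + X x n.+1 <= X x n + X x n.+2)%N.
  move=> n2; have n1 := ltnW n2; have n0 := ltnW n1.
  have /mnm_lepP/(_ x) := c_convex (h := Ordinal n0) (i := Ordinal n1) (k := Ordinal n2) erefl erefl.
  by rewrite !mnmDE -!XE.
elim: d => [|d IHd]; first by rewrite addn1; apply: conv.
move=> lt_m; have h1 : ((i + d.+1).+2 < m)%N by lia.
by have := conv _ h1; have := IHd (ltnW h1); rewrite !addnS; lia.
Qed.

Lemma no_corner_eq (i h k : 'I_m) : i = h.+1 :> nat -> k = i.+1 :> nat ->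
  ~ corner c i -> (c i + c i = c h + c k)%MM.
Proof.
move=> ei ek nc; apply/eqP/negPn/negP => neq; apply: nc.
by apply: Or33; exists h, k; split=> //; apply: c_convex.
Qed.

Lemma flat_slide (i i1 k1 k : 'I_m) : i1 = i.+1 :> nat -> k = k1.+1 :> nat ->
  (i < k1)%N -> (forall h : 'I_m, (i < h < k)%N -> ~ corner c h) ->
  (c i1 + c k1 = c i + c k)%MM.
Proof.
move=> e1 ek ik flat; apply/mnmP => x; rewrite !mnmDE -!XE e1 ek.
have [d ed] : exists d, (k1 = i + d.+1 :> nat)%N by exists (k1 - i.+1)%N; lia.
have := ltn_ord k; rewrite ek ed => lt_m.
have conv n : (i <= n)%N -> (n.+1 < k)%N -> (X x n.+1 + X x n.+1 = X x n + X x n.+2)%N.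
  move=> i_n n1k; have n2 : (n.+2 < m)%N by apply: leq_ltn_trans (ltn_ord k).
  have n1 := ltnW n2; have n0 := ltnW n1.
  have in1 : (i < Ordinal n1 < k)%N by apply/andP.
  have := congr1 (fun u : 'X_{1..2} => u x) (no_corner_eq (h := Ordinal n0)
    (i := Ordinal n1) (k := Ordinal n2) erefl erefl (flat (Ordinal n1) in1)).
  by rewrite /= !mnmDE -!XE.
have : (i + d.+1 < k)%N by rewrite ek ed.
elim: d {ed lt_m} => [|d IHd] le_k; first by rewrite addn1; apply: conv => //; lia.
have h1 : ((i + d.+1).+1 < k)%N by lia.
have := conv _ (leq_addr _ _) h1; have := IHd (ltnW h1); rewrite !addnS; lia.
Qed.

(** The slide of (i, k) splits at [h] into slides of (i, h) and (h, k). If the whole were an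
    equality, adding the two inequalities would give c_(h-1) + c_(h+1) <= 2 c_h, against the
    strictness at a corner. *)
Lemma corner_slide_lt (i i1 h k1 k : 'I_m) : i1 = i.+1 :> nat -> k = k1.+1 :> nat ->
  (i < h < k)%N -> corner c h -> (c i1 + c k1 != c i + c k)%MM.
Proof.
move=> e1 ek /andP[ih hk] [h0|hm|[h' [h1 [eh eh1 le neq]]]].
- by move: ih; rewrite h0.
- by have := ltn_ord k; lia.
apply: contra neq => /eqP eqc; apply/eqP/mnmP => x.
have /mnm_lepP/(_ x) := le; have := congr1 (fun u : 'X_{1..2} => u x) eqc; rewrite /= !mnmDE => eq_x le_x.
have le1 : (c i1 x + c h' x <= c i x + c h x)%N.
  have [ih'|ih'] := ltnP i h'.
    by have /mnm_lepP/(_ x) := convex_slide (i := i) (i1 := i1) (k1 := h') (k := h) e1 eh ih'; rewrite !mnmDE.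
  have <- : i = h' by apply: val_inj => /=; lia.
  have <- : i1 = h by apply: val_inj => /=; lia.
  by lia.
have le2 : (c h1 x + c k1 x <= c h x + c k x)%N.
  have [hk1|hk1] := ltnP h k1.
    by have /mnm_lepP/(_ x) := convex_slide (i := h) (i1 := h1) (k1 := k1) (k := k) eh1 ek hk1; rewrite !mnmDE.
  have <- : h = k1 by apply: val_inj => /=; lia.
  have <- : h1 = k by apply: val_inj => /=; lia.
  by lia.
lia.
Qed.

Lemma cexp_standard_le e : exists2 t, standard t &
  [/\ mdeg t = mdeg e, mweight t = mweight e & (cexp t <= cexp e)%MM].
Proof.
elim/standard_ind: e => [e std_e|e i i1 k1 k e1 ek ik [t std_t [dt wt le_t]]].
  by exists e => //; split=> //; apply: lepm_refl.
exists t => //; split.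
- by rewrite dt !mdegD !mdeg1.
- by rewrite wt !mweightD !mweightU e1 ek; lia.
apply: lepm_trans le_t _; rewrite -!addmA !cexpD !cexpU.
by apply/mnm_lepP => x; have /mnm_lepP/(_ x) := convex_slide e1 ek ik; rewrite !mnmDE leq_add2l.
Qed.

Hypothesis m_gt1 : (1 < m)%N.
Hypothesis c_decr : forall i k : 'I_m, (i < k)%N -> (c k 0%R < c i 0%R)%N.
Hypothesis c_incr : forall i k : 'I_m, (i < k)%N -> (c i 1%R < c k 1%R)%N.

(** For fixed degree d, the exponent of a standard product of weight w is d times the piecewise
    linear interpolation of [c] at w/d, and [c] is strictly monotone in each coordinate. *)
Lemma cexp_weight_mono e t : standard e -> standard t -> mdeg e = mdeg t ->
  (mweight e < mweight t)%N -> (cexp t 0%R < cexp e 0%R)%N /\ (cexp e 1%R < cexp t 1%R)%N.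
Proof.
move=> /(standard_form m_gt1)[q [q1 [a [b [eq1 ->]]]]].
move=> /(standard_form m_gt1)[s [s1 [a' [b' [es1 ->]]]]].
rewrite !cexpD !cexpM !cexpU !mnmDE !mulmnE.
rewrite !mdegD !mdegMn !mdeg1 !mweightD !mweightM !mweightU eq1 es1 !mul1n => eab ew.
have dq : (c q1 0%R < c q 0%R)%N /\ (c q 1%R < c q1 1%R)%N.
  by split; [apply: c_decr|apply: c_incr]; rewrite eq1.
have ds : (c s1 0%R < c s 0%R)%N /\ (c s 1%R < c s1 1%R)%N.
  by split; [apply: c_decr|apply: c_incr]; rewrite es1.
have [sq|qs] := ltnP s q.
  exfalso; have [d ed] : exists d, (nat_of_ord q = s + d.+1)%N by exists (q - s).-1; lia.
  have e3 := congr1 (muln s) eab.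
  by move: ew; rewrite ed; nia.
have [eqs|qs'] := eqVneq q s.
  have eqs1 : q1 = s1 by apply: val_inj; rewrite /= eq1 es1 eqs.
  rewrite -eqs -eqs1 in ds ew *; have bb : (b < b')%N.
    by have e3 := congr1 (muln q) eab; nia.
  have [d [eb ea]] : exists d, (b' = b + d.+1 /\ a = a' + d.+1)%N by exists (b' - b).-1; lia.
  by rewrite eb ea; nia.
have {qs qs'} qs : (q < s)%N by move: qs' qs; rewrite -val_eqE /=; lia.
have dqs : (c s 0%R <= c q1 0%R)%N /\ (c q1 1%R <= c s 1%R)%N.
  have [q1s|sq1] := ltnP q1 s; first by split; apply: ltnW; [apply: c_decr|apply: c_incr].
  by have -> : q1 = s by apply: val_inj => /=; lia.
have [ab0|ab_gt0] := posnP (a + b); first by nia.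
(* Strictness has to come from somewhere: if both outer exponents [a] and [b'] vanish, the monomials
   are powers of z_q1 and z_s, and the unequal weights force q1 < s. *)
have strict : (0 < a)%N \/ (0 < b')%N \/ (c s 0%R < c q1 0%R)%N /\ (c q1 1%R < c s 1%R)%N.
  have [a0|] := posnP a; last by left.
  have [b0|] := posnP b'; last by right; left.
  right; right; have q1s : (q1 < s)%N by move: ew eab; rewrite a0 b0 eq1; nia.
  by split; [apply: c_decr|apply: c_incr].
have key x y z w n1 n2 n3 n4 : (x < y)%N -> (y <= z)%N -> (z < w)%N ->
    (n1 + n2 = n3 + n4)%N -> (0 < n1 + n2)%N ->
    (0 < n1)%N \/ (0 < n4)%N \/ (y < z)%N -> (x * n1 + y * n2 < z * n3 + w * n4)%N.
  move=> xy yz zw en n_gt0 st.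
  have le1 : (x * n1 + y * n2 + n1 <= y * (n1 + n2))%N by nia.
  have le2 : (z * (n3 + n4) + n4 <= z * n3 + w * n4)%N by nia.
  have le3 : (y * (n1 + n2) <= z * (n1 + n2))%N by rewrite leq_mul2r yz orbT.
  case: st => [|[|lt_yz]]; [by lia|by lia|].
  by have : (y * (n1 + n2) < z * (n1 + n2))%N; [rewrite ltn_mul2r n_gt0|lia].
split; last by apply: key; [tauto|tauto|tauto|lia|lia|tauto].
rewrite [X in (_ < X)%N]addnC addnC.
by apply: key; [tauto|tauto|tauto|lia|lia|tauto].
Qed.

Lemma cexp_antichain e t : standard e -> standard t -> mdeg e = mdeg t ->
  (cexp e <= cexp t)%MM -> e = t.
Proof.
move=> std_e std_t det /mnm_lepP le; apply: standard_inj => //.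
have [/cexp_weight_mono|/cexp_weight_mono|//] := ltngtP (mweight e) (mweight t).
  by move=> /(_ std_e std_t det)[lt0 _]; have := le 0; rewrite leqNgt lt0.
by move=> /(_ std_t std_e (esym det))[_ lt1]; have := le 1; rewrite leqNgt lt1.
Qed.

End ExponentGeometry.

(** * The fiber cone of a monomial ideal *)

Section MonomialSupports.
Variables (K : fieldType) (n : nat).
Implicit Types (f g : {mpoly K[n]}) (M : 'X_{1..n} -> Prop).

Definition supp_in M f : Prop := forall u, u \in msupp f -> M u.

Lemma supp_in_sum M (T : Type) (r : seq T) (F : T -> {mpoly K[n]}) :
  (forall i, supp_in M (F i)) -> supp_in M (\sum_(i <- r) F i).
Proof.
move=> MF; elim/big_rec: _ => [|i f _ Mf] u; first by rewrite msupp0.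
by move=> /msuppD_le; rewrite mem_cat => /orP[/MF|/Mf].
Qed.

Lemma supp_in_mul M1 M2 M f g : (forall u v, M1 u -> M2 v -> M (u + v)%MM) ->
  supp_in M1 f -> supp_in M2 g -> supp_in M (f * g).
Proof.
move=> M12 Mf Mg u /msuppM_le/allpairsP[[u1 u2] /= [u1f u2g ->]].
by apply: M12; [apply: Mf|apply: Mg].
Qed.

Lemma supp_in_gen M (S : {pred {mpoly K[n]}}) f :
  (forall u v, M v -> M (u + v)%MM) -> (forall s, s \in S -> supp_in M s) ->
  f \in ideal_gen S -> supp_in M f.
Proof.
move=> Mup MS /ideal_genP[k [a [s [sS ->]]]]; apply: supp_in_sum => i.
apply: (supp_in_mul (M1 := fun => True) (M2 := M)) => // [u v _|]; first exact: Mup.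
exact: MS.
Qed.

End MonomialSupports.

Section FiberConeStructure.
Variables (K : fieldType) (I : {pred {mpoly K[2]}}) (m : nat) (c : 'I_m -> 'X_{1..2}).
Hypothesis I_gen : I =i ideal_gen (monomials_of c [set: 'I_m]).
Implicit Types (e t : 'X_{1..m}) (u v : 'X_{1..2}) (f g : {mpoly K[m]}).
Local Notation cexp := (cexp c).
Local Notation phi := (fiber_map c I).

Lemma gen_mem i : 'X_[c i] \in I.
Proof.
rewrite I_gen; apply: mem_ideal_gen; apply/existsP; exists i.
by rewrite inE eqxx.
Qed.

Lemma cexp_mem e : 'X_[cexp e] \in ideal_exp I (mdeg e).
Proof.
have [n] := ubnP (mdeg e); elim: n e => // n IHn e le_n.
have [/eqP|e_neq0] := eqVneq (mdeg e) 0%N.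
  by rewrite mdeg_eq0 => /eqP ->; rewrite mdeg0.
have [i ei] : exists i, e i != 0%N.
  apply/existsP; apply: contraNT e_neq0 => /existsPn e0.
  by rewrite mdegE sum_nat_eq0; apply/forallP => i; have := e0 i; rewrite negbK.
have ee : e = (U_(i) + (e - U_(i)))%MM by rewrite addmC submK // lep1mP.
rewrite ee mdegD mdeg1 cexpD cexpU mpolyXD in le_n *.
apply: mem_ideal_gen; apply/asboolP; exists 'X_[c i], 'X_[cexp (e - U_(i))].
split=> //; first exact: gen_mem.
by apply: IHn; lia.
Qed.

Lemma ideal_exp_supp k (f : {mpoly K[2]}) : f \in ideal_exp I k ->
  supp_in (fun u => exists2 e, mdeg e = k & (cexp e <= u)%MM) f.
Proof.
elim: k f => [|k IHk] f.
  move=> _ u _; exists 0%MM; first exact: mdeg0.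
  by apply/mnm_lepP => x; rewrite cexpE big1 // => i _; rewrite mnm0E muln0.
have up (l : nat) u v : (exists2 e, mdeg e = l & (cexp e <= v)%MM) ->
    exists2 e, mdeg e = l & (cexp e <= u + v)%MM.
  by move=> [e de le_e]; exists e => //; apply: lepm_trans le_e (lem_addl _ _).
apply: supp_in_gen => [u v|s /asboolP[g [h [gI hI ->]]]]; first exact: up.
apply: (supp_in_mul (M1 := fun u => exists2 e, mdeg e = 1%N & (cexp e <= u)%MM)
  (M2 := fun u => exists2 e, mdeg e = k & (cexp e <= u)%MM)).
- move=> u v [e1 d1 le1] [e2 d2 le2]; exists (e1 + e2)%MM; first by rewrite mdegD d1 d2.
  rewrite cexpD; apply/mnm_lepP => x; rewrite !mnmDE; apply: leq_add.
    exact: (mnm_lepP le1).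
  exact: (mnm_lepP le2).
- move: gI; rewrite I_gen; apply: supp_in_gen => [u v|t /existsP[i /andP[_ /eqP->]] u].
    exact: up.
  rewrite msuppX inE => /eqP->; exists U_(i)%MM; first exact: mdeg1.
  by rewrite cexpU lepm_refl.
exact: IHk.
Qed.

Lemma supp_ideal_exp k (f : {mpoly K[2]}) :
  supp_in (fun u => exists2 e, mdeg e = k & (cexp e <= u)%MM) f ->
  f \in ideal_exp I k.
Proof.
move=> Mf; rewrite (mpolyE f) big_seq; elim/big_rec: _ => [|u x /Mf[e <- le_e] xI].
  exact: ideal_exp0.
apply: ideal_expD xI; rewrite -(submK le_e) mpolyXD scalerAl.
exact/ideal_expM/cexp_mem.
Qed.

Lemma fiber_pi0 : fiber_pi (0 : rees I) = 0.
Proof. by apply: (addrI (fiber_pi 0)); rewrite -fiber_piD !addr0. Qed.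

Lemma fiber_pi_eq0 (r : rees I) : fiber_pi r = 0 <-> r \in @max_rees K I.
Proof.
have -> : (r \in @max_rees K I) = (r - 0 \in @max_rees K I) by rewrite subr0.
rewrite Quotient.idealrBE -[X in _ = X <-> _]fiber_pi0; split=> [r0|/eqP//].
exact/eqP.
Qed.

Lemma fiber_pi_sum (T : Type) (s : seq T) (F : T -> rees I) :
  fiber_pi (\sum_(i <- s) F i) = \sum_(i <- s) fiber_pi (F i).
Proof. by apply: (big_morph _ (@fiber_piD K I) fiber_pi0). Qed.

Lemma rees_val_sum (T : Type) (s : seq T) (F : T -> rees I) :
  rees_val (\sum_(i <- s) F i) = \sum_(i <- s) rees_val (F i).
Proof.
exact: (big_morph (@rees_val _ I) (raddfD (val : rees I -> _)) (raddf0 (val : rees I -> _))).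
Qed.

(** Each term of m R(I) in degree k is a term of I^k times a monomial other than 1. This strictness
    is what keeps minimal products out of m R(I). *)
Lemma max_rees_supp (r : rees I) k : r \in @max_rees K I ->
  supp_in (fun u => exists2 e, mdeg e = k & (cexp e <= u)%MM /\ cexp e != u) (rees_val r)`_k.
Proof.
move=> /ideal_genP[n [a [s [sS ->]]]].
have -> := rees_val_sum (index_enum _) (fun i => a i * s i).
rewrite coef_sum; apply: supp_in_sum => i.
have /asboolP[g gm eg] := sS i; rewrite /= eg coefMC.
apply: (supp_in_mul (M1 := fun u => exists2 e, mdeg e = k & (cexp e <= u)%MM)
  (M2 := fun u => u != 0%MM)).
- move=> u v [e de le_e] v0; exists e => //; split.
    exact: lepm_trans le_e (lem_addr _ _).
  apply: contra v0 => /eqP eu; apply/eqP/mnmP => x; rewrite mnm0E.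
  by have /mnm_lepP/(_ x) := le_e; rewrite eu mnmDE; lia.
- by apply: ideal_exp_supp; have /rees_predP := rees_valP (a i).
move: gm; apply: supp_in_gen => [u v|f /orP[]/eqP-> u].
- by apply: contraNN; rewrite mnmD_eq0 => /andP[].
- by rewrite msuppX inE => /eqP->; rewrite mnm1_eq0.
by rewrite msuppX inE => /eqP->; rewrite mnm1_eq0.
Qed.

Definition rees_mono k (f : {mpoly K[2]}) : rees I := insubd 0 (f *: 'X^k).

Lemma rees_monoE k (f : {mpoly K[2]}) : f \in ideal_exp I k -> rees_val (rees_mono k f) = f *: 'X^k.
Proof.
move=> fI; rewrite insubdK //; apply/rees_predP => i.
by rewrite coefZ coefXn; case: eqP => [->|_]; rewrite ?mulr1 // mulr0 ideal_exp0.
Qed.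

Lemma rees_mono_sum (r : rees I) :
  r = \sum_(k < size (rees_val r)) \sum_(u <- msupp (rees_val r)`_k)
        rees_mono k ((rees_val r)`_k@_u *: 'X_[u]).
Proof.
have /rees_predP rI := rees_valP r.
have term_in k u : u \in msupp (rees_val r)`_k ->
    (rees_val r)`_k@_u *: 'X_[u] \in ideal_exp I k.
  move=> uf; apply: supp_ideal_exp => v /msuppZ_le; rewrite msuppX inE => /eqP->.
  exact: (ideal_exp_supp (rI k)).
apply: val_inj; rewrite -[RHS]/(rees_val _) rees_val_sum -[LHS]coefK poly_def.
apply: eq_bigr => k _; rewrite rees_val_sum [X in X *: _]mpolyE scaler_suml.
by rewrite [LHS]big_seq [RHS]big_seq; apply: eq_bigr => u /term_in /rees_monoE.
Qed.

Lemma max_rees_mono k e u a : mdeg e = k -> (cexp e <= u)%MM -> cexp e != u ->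
  rees_mono k (a *: 'X_[u]) \in @max_rees K I.
Proof.
move=> <- le_e neq.
have [x ux] : exists x, (cexp e x < u x)%N.
  apply/existsP; apply: contraNT neq => /existsPn eu; apply/eqP/mnmP => x.
  by apply/eqP; rewrite eqn_leq (mnm_lepP le_e) leqNgt eu.
have le_x : (cexp e <= u - U_(x))%MM.
  apply/mnm_lepP => y; rewrite mnmBE mnm1E; have := mnm_lepP le_e y.
  by case: eqP => [<-|_] /=; lia.
have memI v : (cexp e <= v)%MM -> a *: 'X_[v] \in ideal_exp I (mdeg e).
  by move=> le_v; rewrite -(submK le_v) mpolyXD scalerAl; apply/ideal_expM/cexp_mem.
have -> : rees_mono (mdeg e) (a *: 'X_[u]) =
    rees_mono (mdeg e) (a *: 'X_[u - U_(x)]) * rees_mono 0 'X_x.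
  apply: val_inj; rewrite rmorphM /= !rees_monoE //; try exact: memI.
  rewrite expr0 -scalerAl -scalerAr mulr1 scalerA -scalerAl -mpolyXD submK //.
  by rewrite lep1mP; lia.
refine (@ideal_genM (rees I) _ _ _ (@mem_ideal_gen (rees I) _ _ _)).
apply/asboolP; exists 'X_x.
  apply: mem_ideal_gen; rewrite inE /varx /vary.
  by case: x {ux le_x} => -[|[|//]] lt; apply/orP; [left|right]; apply/eqP; congr 'X__; apply: val_inj.
by rewrite /= rees_monoE // expr0 alg_polyC.
Qed.

Lemma fiber_pi_mono0 k e u a : mdeg e = k -> (cexp e <= u)%MM -> cexp e != u ->
  fiber_pi (rees_mono k (a *: 'X_[u])) = 0.
Proof. by move=> de le_e neq; apply/fiber_pi_eq0/(max_rees_mono _ de). Qed.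

(** The lift z_i -> u_i t of [phi] to the Rees ring, with values in R[t], where coefficients of
    monomials can be read off. *)
Definition rees_lift : {mpoly K[m]} -> {poly {mpoly K[2]}} :=
  mmap (polyC \o @mpolyC 2 K) (fun i => 'X_[c i] *: 'X).

HB.instance Definition _ := GRing.RMorphism.on rees_lift.

Lemma rees_liftX e : rees_lift 'X_[e] = 'X_[cexp e] *: 'X^(mdeg e).
Proof.
rewrite /rees_lift mmapX /mmap1 mdegE.
transitivity (\prod_(i < m) ('X_[c i *+ e i] *: 'X^(e i)) : {poly {mpoly K[2]}}).
  by apply: eq_bigr => i _; rewrite exprZn mpolyXn.
by rewrite scaler_prod /cexp -mprodXE prodrXr.
Qed.

Lemma coef_rees_lift f k :
  (rees_lift f)`_k = \sum_(e <- msupp f | mdeg e == k) f@_e *: 'X_[cexp e].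
Proof.
rewrite [X in rees_lift X]mpolyE raddf_sum coef_sum [RHS]big_mkcond /=.
apply: eq_bigr => e _.
rewrite -mul_mpolyC rmorphM /= rees_liftX /rees_lift mmapC /= coefCM coefZ coefXn.
by rewrite eq_sym; case: eqP => _; rewrite ?mulr1 ?mulr0 // mul_mpolyC.
Qed.

Lemma phi_lift f : exists2 r : rees I, rees_val r = rees_lift f & phi f = fiber_pi r.
Proof.
elim/mpoly_subring_ind: f => [a|i|f g [r1 e1 p1] [r2 e2 p2]|f g [r1 e1 p1] [r2 e2 p2]].
- exists (rees_const I a); first by rewrite /rees_lift mmapC.
  by rewrite /fiber_map mmapC /= /GRing.scale /= /fiber_scale mulr1.
- exists (rees_mono 1 'X_[c i]).
    rewrite rees_monoE ?rees_liftX ?cexpU ?mdeg1 //.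
    by have := cexp_mem U_(i); rewrite cexpU mdeg1.
  by rewrite /fiber_map mmapX mmap1U.
- exists (r1 + r2); last by rewrite fiber_piD -p1 -p2 /fiber_map rmorphD.
  by rewrite rmorphD /= -e1 -e2; apply: (raddfD (val : rees I -> _)).
exists (r1 * r2); last by rewrite fiber_piM -p1 -p2 /fiber_map rmorphM.
by rewrite rmorphM /= -e1 -e2; apply: (rmorphM (val : rees I -> _)).
Qed.

(** The sum is the coefficient of [rees_lift f] at the exponent [cexp t] in degree [mdeg t]. As the
    lift lies in m R(I), a nonzero value would give a product of the same degree properly dividing
    this monomial; its standard reduction divides it too, so it is [t] by the antichain property, a
    contradiction. *)
Lemma fiber_relation f t : (1 < m)%N -> convex c ->
  (forall i k : 'I_m, (i < k)%N -> (c k 0%R < c i 0%R)%N) ->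
  (forall i k : 'I_m, (i < k)%N -> (c i 1%R < c k 1%R)%N) ->
  phi f = 0 -> standard t ->
  \sum_(e <- msupp f | (mdeg e == mdeg t) && (cexp e == cexp t)) f@_e = 0.
Proof.
move=> m1 cvx decr incr f0 std_t.
have [r er pr] := phi_lift f.
have rm : r \in @max_rees K I by apply/fiber_pi_eq0; rewrite -pr.
have -> : \sum_(e <- msupp f | (mdeg e == mdeg t) && (cexp e == cexp t)) f@_e =
    (rees_val r)`_(mdeg t)@_(cexp t).
  rewrite er coef_rees_lift raddf_sum [LHS]big_mkcondr /=; apply: eq_bigr => e _.
  by rewrite mcoeffZ mcoeffX; case: (_ == _); rewrite ?mulr1 ?mulr0.
apply: memN_msupp_eq0; apply/negP => /(max_rees_supp rm)[e de [le_e neq]].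
have [s std_s [ds ws le_s]] := cexp_standard_le cvx e.
have est : s = t.
  by apply: (cexp_antichain m1 decr incr) => //; [rewrite ds|apply: lepm_trans le_e].
case/negP: neq; apply/eqP/mnmP => x; apply/eqP; rewrite eqn_leq (mnm_lepP le_e).
by rewrite -est (mnm_lepP le_s).
Qed.

Lemma phi_mono e : phi 'X_[e] = fiber_pi (rees_mono (mdeg e) 'X_[cexp e]).
Proof.
have [r er ->] := phi_lift 'X_[e]; congr fiber_pi; apply: val_inj.
by rewrite /= er rees_liftX rees_monoE // cexp_mem.
Qed.

Lemma phi_cexp_eq e t : mdeg e = mdeg t -> cexp e = cexp t -> phi 'X_[e] = phi 'X_[t].
Proof. by move=> de ce; rewrite !phi_mono de ce. Qed.

Lemma phi_cexp_lt e t : mdeg e = mdeg t -> (cexp t <= cexp e)%MM -> cexp t != cexp e ->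
  phi 'X_[e] = 0.
Proof.
move=> de le_t neq; rewrite phi_mono -['X_[_]]scale1r.
exact: (fiber_pi_mono0 _ (esym de)).
Qed.

Lemma phi_scale a f : phi (a *: f) = a *: phi f.
Proof. by rewrite /fiber_map mmapZ /= mulr_algl. Qed.

Lemma fiber_pi_component (r : rees I) k : exists2 f, f \is k.-homog &
  fiber_pi (\sum_(u <- msupp (rees_val r)`_k) rees_mono k ((rees_val r)`_k@_u *: 'X_[u]))
  = phi f.
Proof.
have /rees_predP rI := rees_valP r.
rewrite fiber_pi_sum big_seq.
elim/big_rec: _ => [|u x uf [f fk ->]]; first by exists 0; rewrite ?rpred0 // /fiber_map rmorph0.
have [e de le_e] := ideal_exp_supp (rI k) uf.
have [eu|neq] := eqVneq (cexp e) u; last first.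
  by rewrite (fiber_pi_mono0 _ de le_e neq); exists f; rewrite ?add0r.
exists ((rees_val r)`_k@_u *: 'X_[e] + f).
  by rewrite rpredD // rpredZ // dhomogX; apply/eqP.
rewrite /fiber_map rmorphD /= -!/(fiber_map c I _) phi_scale; congr (_ + _).
rewrite phi_mono de eu /GRing.scale /= /fiber_scale -fiber_piM; congr fiber_pi.
have uI : 'X_[u] \in ideal_exp I k by rewrite -eu -de cexp_mem.
have auI : (rees_val r)`_k@_u *: 'X_[u] \in ideal_exp I k.
  by rewrite -mul_mpolyC; apply: ideal_expM.
apply: val_inj; rewrite rmorphM /= !rees_monoE //.
by rewrite mul_polyC scalerA mul_mpolyC.
Qed.

Lemma fiber_pi_lift (r : rees I) k : (forall j, j != k -> (rees_val r)`_j = 0) ->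
  exists2 f, f \is k.-homog & fiber_pi r = phi f.
Proof.
move=> r_conc; rewrite {1}(rees_mono_sum r) fiber_pi_sum.
elim/big_rec: _ => [|j x _ [f fk ->]]; first by exists 0; rewrite ?rpred0 // /fiber_map rmorph0.
have [ejk|/r_conc r0] := eqVneq (j : nat) k.
  have [g gk ->] := fiber_pi_component r j; rewrite ejk in gk.
  by exists (g + f); rewrite ?rpredD // /fiber_map rmorphD.
by exists f => //; rewrite r0 msupp0 big_nil fiber_pi0 add0r.
Qed.

Lemma fiber_cone_lift (x : fiber_cone I) : exists f, x = phi f.
Proof.
have [r ->] : exists r, x = fiber_pi r by exists (repr x); rewrite /fiber_pi reprK.
rewrite (rees_mono_sum r) fiber_pi_sum.
elim/big_rec: _ => [|k y _ [f ->]]; first by exists 0; rewrite /fiber_map rmorph0.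
have [g _ ->] := fiber_pi_component r k.
by exists (g + f); rewrite /fiber_map rmorphD.
Qed.

Lemma fiber_grP k (x : fiber_cone I) :
  x \in fiber_gr I k <-> exists2 f, f \is k.-homog & x = phi f.
Proof.
split=> [/asboolP[r r_conc ->]|[f /dhomogP f_homog ->]].
  by have [f fk ->] := fiber_pi_lift r_conc; exists f.
have [r er ->] := phi_lift f; apply/asboolP; exists r => // j jk.
rewrite -[\val r]/(rees_val r) er coef_rees_lift big_seq_cond big1 // => e /andP[/f_homog de].
by rewrite -de in jk; rewrite eq_sym (negPf jk).
Qed.

End FiberConeStructure.

(** * The ideal of relations *)

Lemma ideal_gen_sub (R : comNzRingType) (S T : {pred R}) :
  (forall s, s \in S -> s \in ideal_gen T) -> {subset ideal_gen S <= ideal_gen T}.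
Proof.
move=> ST f /ideal_genP[n [a [s [sS ->]]]]; apply: ideal_gen_sum => i.
exact/ideal_genM/ST.
Qed.

Lemma det_mx2 (R : comNzRingType) (M : 'M[R]_2) :
  \det M = M 0 0 * M 1 1 - M 0 1 * M 1 0.
Proof.
rewrite (expand_det_row _ 0) big_ord_recl big_ord1 /cofactor !det_mx11 !mxE /=.
rewrite expr0 mul1r expr1 mulN1r mulrN.
by congr (_ * M _ _ - M _ _ * M _ _); apply: val_inj.
Qed.

Section CornerIdeal.
Variables (K : fieldType) (m : nat) (c : 'I_m -> 'X_{1..2}) (l : nat) (j : 'I_l -> 'I_m).
Hypothesis j_incr : forall k k' : 'I_l, (k < k')%N -> (j k < j k')%N.
Hypothesis cornerE : forall i : 'I_m, corner c i <-> exists k : 'I_l, i = j k.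
Implicit Types (f g : {mpoly K[m]}) (i k : 'I_m).

Lemma no_corner_between (a a' : 'I_l) (h : 'I_m) : a' = a.+1 :> nat ->
  (j a < h < j a')%N -> ~ corner c h.
Proof.
move=> ea' /andP[ah ha'] /cornerE[b eb]; rewrite eb in ah ha'.
have [ba|ab|/val_inj eab] := ltngtP b a; last by rewrite eab ltnn in ah.
  by have := j_incr ba; lia.
have [a'b|ba'|/val_inj eab] := ltngtP a' b; last by rewrite eab ltnn in ha'.
  by have := j_incr a'b; lia.
by lia.
Qed.

Lemma zvarE i : zvar K i = 'X_i.
Proof. by rewrite /zvar valK. Qed.

(** The columns of a minor start with z_i and z_k1, so the minor compares z_i z_(k1+1) with the
    result of sliding both indices inward by one, inside a single segment. *)
Lemma corner_binomialsP f : f \in corner_binomials K j <->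
  exists (a a' : 'I_l) (i i1 k1 k : 'I_m), [/\ a' = a.+1 :> nat, i1 = i.+1 :> nat,
    k = k1.+1 :> nat, (i < k1)%N & [/\ (j a <= i)%N, (k <= j a')%N
    & f = 'X_i * 'X_k - 'X_i1 * 'X_k1]].
Proof.
split.
  move=> /asboolP[a [a' [ea' /asboolP[g [g_incr ->]]]]].
  have lt_g (x : 'I_2) : (j a + g x + 1 < m)%N.
    by have := ltn_ord (g x); have := ltn_ord (j a'); lia.
  have lt_g' (x : 'I_2) : (j a + g x < m)%N by have := lt_g x; lia.
  exists a, a', (Ordinal (lt_g' 0%R)), (Ordinal (lt_g 0%R)), (Ordinal (lt_g' 1%R)), (Ordinal (lt_g 1%R)).
  have g01 : (g 0%R < g 1%R)%N by apply: g_incr.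
  split=> //=; rewrite ?addn1 //; first by rewrite ltn_add2l.
  split=> //; first by lia.
    by have := ltn_ord (g 1%R); lia.
  rewrite det_mx2 !mxE /= addn0 -!zvarE /= !addn0.
  by rewrite [X in _ - X]mulrC.
move=> [a [a' [i [i1 [k1 [k [ea' ei1 ek ik1 [ja ja' ->]]]]]]]].
apply/asboolP; exists a, a'; split=> //.
have lt_i : (i - j a < j a' - j a)%N by lia.
have lt_k : (k1 - j a < j a' - j a)%N by lia.
apply/asboolP; exists (fun x => if x == 0 then Ordinal lt_i else Ordinal lt_k); split.
  by move=> [[|[|//]] ?] [[|[|//]] ?] //= _; lia.
rewrite det_mx2 !mxE /= -!zvarE ei1 ek [X in _ - X]mulrC.
by congr (zvar K _ * zvar K _ - zvar K _ * zvar K _) => /=; lia.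
Qed.

Lemma mnmU2_eq0 i k h : (i != h) -> (k != h) -> (U_(i) + U_(k))%MM h = 0%N.
Proof. by move=> ih kh; rewrite mnmDE !mnm1E (negPf ih) (negPf kh). Qed.

Lemma binomial_init i i1 k1 k : i1 = i.+1 :> nat -> k = k1.+1 :> nat -> (i < k1)%N ->
  is_init ('X_i * 'X_k - 'X_i1 * 'X_k1 : {mpoly K[m]}) (U_(i) + U_(k))%MM.
Proof.
move=> ei1 ek ik; rewrite -!mpolyXD.
have i_other : (U_(i1) + U_(k1) : 'X_{1..m})%MM i = 0%N.
  by apply: mnmU2_eq0; rewrite -val_eqE /=; lia.
have neq : (U_(i1) + U_(k1) == U_(i) + U_(k) :> 'X_{1..m})%MM = false.
  apply/negP => /eqP/(congr1 (fun u : 'X_{1..m} => u i)).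
  by rewrite /= i_other mnmDE mnm1E eqxx.
split; first by rewrite mcoeff_msupp mcoeffB !mcoeffX eqxx neq subr0 oner_neq0.
move=> s /msuppB_le; rewrite mem_cat !msuppX !inE => /orP[->//|/eqP-> _].
apply/existsP; exists i; apply/andP; split; last first.
  by rewrite i_other mnmDE mnm1E eqxx.
apply/forallP => h; apply/implyP => hi.
by rewrite !mnmU2_eq0 // -val_eqE /=; lia.
Qed.

(** Both terms of a minor use indices of one segment only. Hence a product with a corner strictly
    between its indices is never the initial term of a minor. *)
Lemma corner_binomial_flat g i k : (i < k)%N -> g \in corner_binomials K j ->
  (U_(i) + U_(k))%MM \in msupp g -> forall h : 'I_m, (i < h < k)%N -> ~ corner c h.
Proof.
move=> ik /corner_binomialsP[a [a' [i' [i1 [k1 [k' [ea' ei1 ek ik1 [ja ja' ->]]]]]]]].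
rewrite -!mpolyXD => /msuppB_le; rewrite mem_cat !msuppX !inE => supp h ihk.
have bounds (x y z : 'I_m) : (U_(i) + U_(k) == U_(x) + U_(y))%MM ->
    (j a <= x <= j a')%N -> (j a <= y <= j a')%N -> (z == i) || (z == k) ->
    (j a <= z <= j a')%N.
  move=> /eqP e jx jy zik; have [<-//|xz] := eqVneq x z; have [<-//|yz] := eqVneq y z.
  have := congr1 (fun u : 'X_{1..m} => u z) e; rewrite /= [RHS]mnmU2_eq0 // mnmDE !mnm1E.
  by move: zik => /orP[] /eqP->; rewrite eqxx ?addn1.
have [/andP[bi _] /andP[_ bk]] : (j a <= i <= j a')%N /\ (j a <= k <= j a')%N.
  by case/orP: supp => e; split; apply: (bounds _ _ _ e); rewrite ?eqxx ?orbT //; lia.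
by apply: (no_corner_between ea'); lia.
Qed.

Hypothesis m_gt1 : (1 < m)%N.

Lemma flat_segment i k : (i < k)%N ->
  (forall h : 'I_m, (i < h < k)%N -> ~ corner c h) ->
  exists a a' : 'I_l, [/\ a' = a.+1 :> nat, (j a <= i)%N & (k <= j a')%N].
Proof.
move=> ik flat.
have [a0 ea0] : exists a0, (j a0 <= i)%N.
  have /cornerE[a0 e0] : corner c (Ordinal (ltnW m_gt1)) by apply: Or31.
  by exists a0; rewrite -e0.
case: (arg_maxnP (fun a : 'I_l => nat_of_ord a) (P := fun a => (j a <= i)%N) ea0) => a ja max_a.
have im : (m.-1 < m)%N by rewrite prednK // ltnW.
have /cornerE[b eb] : corner c (Ordinal im) by apply: Or32; rewrite /= prednK // ltnW.
(* The last index is a corner beyond [i], so [a] is not the last corner and has a successor. *)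
have ab : (a < b)%N.
  rewrite ltnNge; apply/negP => ba.
  have : (j b <= j a)%N.
    by move: ba; rewrite leq_eqVlt => /orP[/eqP/val_inj->//|/j_incr/ltnW].
  by rewrite -eb /=; have := ltn_ord k; lia.
have a1 : (a.+1 < l)%N by apply: leq_ltn_trans (ltn_ord b).
exists a, (Ordinal a1); split=> //; rewrite leqNgt; apply/negP => jk.
apply: (flat (j (Ordinal a1))); last by apply/cornerE; exists (Ordinal a1).
rewrite jk andbT ltnNge; apply/negP => /max_a /=; lia.
Qed.

(** [corner_monomials] is defined through initial terms of minors. This dichotomy replaces that
    condition by the presence of a corner between the indices, which is what decides whether the
    slide is strict. *)
Lemma nonadjacent_cases i k : (i.+1 < k)%N ->
  (exists i1 k1 : 'I_m, [/\ i1 = i.+1 :> nat, k = k1.+1 :> nat, (i < k1)%N,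
      forall h : 'I_m, (i < h < k)%N -> ~ corner c h
    & 'X_i * 'X_k - 'X_i1 * 'X_k1 \in corner_binomials K j]) \/
  (exists2 h : 'I_m, (i < h < k)%N & corner c h) /\ 'X_i * 'X_k \in corner_monomials K j.
Proof.
move=> ik; have [[h ihk ch]|flat] := pselect (exists2 h : 'I_m, (i < h < k)%N & corner c h).
  right; split; first by exists h.
  apply/asboolP; exists i, k; split=> // g gB [supp _].
  exact: (corner_binomial_flat (ltnW ik) gB supp ihk ch).
have {}flat (h : 'I_m) : (i < h < k)%N -> ~ corner c h by move=> ihk ch; apply: flat; exists h.
left; have i1m : (i.+1 < m)%N by apply: ltn_trans (ltn_ord k).
have k1m : (k.-1 < m)%N by apply: leq_ltn_trans (leq_pred k) (ltn_ord k).
exists (Ordinal i1m), (Ordinal k1m); split=> //=; try lia.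
have [a [a' [ea' ja ja']]] := flat_segment (ltnW ik) flat.
apply/corner_binomialsP; exists a, a', i, (Ordinal i1m), (Ordinal k1m), k.
by split=> //=; lia.
Qed.

Lemma corner_monomial_corner i k : (i.+1 < k)%N -> 
  (forall g, g \in corner_binomials K j -> ~ is_init g (U_(i) + U_(k))%MM) ->
  exists2 h : 'I_m, (i < h < k)%N & corner c h.
Proof.
move=> ik none; have [[i1 [k1 [ei1 ek ik1 _ gB]]]|[]//] := nonadjacent_cases ik.
by case: (none _ gB); apply: binomial_init.
Qed.

Lemma corner_normal_mono e : exists2 g, 'X_[e] - g \in corner_ideal K j &
  forall t, t \in msupp g -> [/\ standard t, mdeg t = mdeg e & mweight t = mweight e].
Proof.
elim/standard_ind: e => [e std_e|e i i1 k1 k ei1 ek ik [g eg hg]].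
  exists 'X_[e]; first by rewrite subrr ideal_gen0.
  by move=> t; rewrite msuppX inE => /eqP->.
have lt_ik : (i.+1 < k)%N by lia.
have [[i1' [k1' [ei1' ek' _ _ gB]]]|[_ gM]] := nonadjacent_cases lt_ik.
  have ei : i1' = i1 by apply: val_inj; rewrite /= ei1'.
  have ek1 : k1' = k1 by apply: val_inj; move: ek; rewrite /= ek' => -[].
  rewrite ei ek1 in gB; exists g.
    have -> : 'X_[e + U_(i) + U_(k)] - g = 'X_[e] * ('X_i * 'X_k - 'X_i1 * 'X_k1) +
        ('X_[e + U_(i1) + U_(k1)] - g) by rewrite !mpolyXD; ring.
    by apply: ideal_genD => //; apply/ideal_genM/mem_ideal_gen; rewrite inE gB.
  move=> t /hg[std_t -> ->]; split=> //; first by rewrite !mdegD !mdeg1.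
  by rewrite !mweightD !mweightU ei1 ek; lia.
exists 0; last by move=> t; rewrite msupp0.
rewrite subr0 !mpolyXD -mulrA; apply/ideal_genM/mem_ideal_gen.
by rewrite inE gM orbT.
Qed.

Lemma corner_normal_form f : exists2 g, f - g \in corner_ideal K j &
  forall t, t \in msupp g -> standard t /\ exists2 e, e \in msupp f & mdeg t = mdeg e.
Proof.
rewrite {1}(mpolyE f) big_seq.
elim/big_rec: _ => [|e x ef [g eg hg]].
  by exists 0; rewrite ?subrr ?ideal_gen0 // => t; rewrite msupp0.
have [h eh hh] := corner_normal_mono e; exists (f@_e *: h + g).
  have -> : f@_e *: 'X_[e] + x - (f@_e *: h + g) = (f@_e)%:MP * ('X_[e] - h) + (x - g).
    by rewrite -!mul_mpolyC; ring.
  by apply: ideal_genD => //; apply: ideal_genM.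
move=> t /msuppD_le; rewrite mem_cat => /orP[/msuppZ_le/hh[std_t dt _]|/hg//].
by split=> //; exists e.
Qed.

End CornerIdeal.

Section DefiningIdeal.
Variables (K : fieldType) (I : {pred {mpoly K[2]}}) (m : nat) (c : 'I_m -> 'X_{1..2}).
Variables (l : nat) (j : 'I_l -> 'I_m).
Hypothesis m_gt1 : (1 < m)%N.
Hypothesis I_gen : I =i ideal_gen (monomials_of c [set: 'I_m]).
Hypothesis c_convex : convex c.
Hypothesis c_decr : forall i k : 'I_m, (i < k)%N -> (c k 0%R < c i 0%R)%N.
Hypothesis c_incr : forall i k : 'I_m, (i < k)%N -> (c i 1%R < c k 1%R)%N.
Hypothesis j_incr : forall k k' : 'I_l, (k < k')%N -> (j k < j k')%N.
Hypothesis cornerE : forall i : 'I_m, corner c i <-> exists k : 'I_l, i = j k.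
Implicit Types (f g : {mpoly K[m]}) (i k : 'I_m).
Local Notation phi := (fiber_map c I).

Lemma phi_flat i i1 k1 k : i1 = i.+1 :> nat -> k = k1.+1 :> nat -> (i < k1)%N ->
  (forall h : 'I_m, (i < h < k)%N -> ~ corner c h) ->
  phi ('X_i * 'X_k) = phi ('X_i1 * 'X_k1).
Proof.
move=> ei1 ek ik flat; rewrite -!mpolyXD; apply: (phi_cexp_eq I_gen).
  by rewrite !mdegD !mdeg1.
by rewrite !cexpD !cexpU (flat_slide c_convex ei1 ek ik flat).
Qed.

Lemma phi_corner0 (i h k : 'I_m) : (i < h < k)%N -> corner c h -> phi ('X_i * 'X_k) = 0.
Proof.
move=> /andP[ih hk] ch; have ik : (i.+1 < k)%N by lia.
have i1m : (i.+1 < m)%N by apply: ltn_trans (ltn_ord k).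
have k1m : (k.-1 < m)%N by apply: leq_ltn_trans (leq_pred k) (ltn_ord k).
pose i1 := Ordinal i1m; pose k1 := Ordinal k1m.
have [ei1 ek ik1] : [/\ i1 = i.+1 :> nat, k = k1.+1 :> nat & (i < k1)%N] by split=> /=; lia.
rewrite -mpolyXD; apply: (phi_cexp_lt I_gen (t := (U_(i1) + U_(k1))%MM)).
- by rewrite !mdegD !mdeg1.
- by rewrite !cexpD !cexpU (convex_slide c_convex ei1 ek ik1).
rewrite !cexpD !cexpU; apply: (corner_slide_lt c_convex ei1 ek _ ch).
by rewrite ih hk.
Qed.

Lemma corner_binomials_sub : {subset corner_binomials K j <= fiber_ideal c I}.
Proof.
move=> f /corner_binomialsP[a [a' [i [i1 [k1 [k [ea' ei1 ek ik [ja ja' ->]]]]]]]].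
rewrite inE /fiber_map rmorphB /= -!/(fiber_map c I _) (phi_flat ei1 ek ik) ?subrr //.
move=> h ihk; apply: (no_corner_between j_incr cornerE ea'); lia.
Qed.

Lemma corner_monomials_sub : {subset corner_monomials K j <= fiber_ideal c I}.
Proof.
move=> f /asboolP[i [k [ik -> none]]]; rewrite inE.
have [h ihk ch] := corner_monomial_corner j_incr cornerE m_gt1 ik none.
by rewrite (phi_corner0 ihk ch).
Qed.

Lemma corner_ideal_sub : {subset corner_ideal K j <= fiber_ideal c I}.
Proof.
move=> f /ideal_genP[n [a [s [sB ->]]]]; rewrite inE /fiber_map rmorph_sum big1 // => i _.
rewrite rmorphM /=; have /orP[/corner_binomials_sub|/corner_monomials_sub] := sB i;
  by rewrite inE /fiber_map => /eqP->; rewrite mulr0.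
Qed.

Lemma standard_relation0 g : (forall t, t \in msupp g -> standard t) -> phi g = 0 -> g = 0.
Proof.
move=> std_g g0; apply/msuppnil0; case e_supp : (msupp g) => [//|t s].
have tg : t \in msupp g by rewrite e_supp inE eqxx.
have := fiber_relation I_gen m_gt1 c_convex c_decr c_incr g0 (std_g t tg).
rewrite big_mkcond (bigD1_seq t) ?msupp_uniq //= !eqxx /= big_seq_cond big1 ?addr0.
  by move=> gt0; move: tg; rewrite mcoeff_msupp gt0 eqxx.
move=> e /andP[eg et]; case: ifP => // /andP[/eqP de /eqP ce].
case/eqP: et; apply: (cexp_antichain m_gt1 c_decr c_incr) => //; try exact: std_g.
by rewrite ce lepm_refl.
Qed.

Lemma fiber_ideal_sub : {subset fiber_ideal c I <= corner_ideal K j}.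
Proof.
move=> f; rewrite inE => /eqP f0.
have [g fg std_g] := corner_normal_form j_incr cornerE m_gt1 f.
have g0 : g = 0.
  apply: standard_relation0 => [t /std_g[]//|].
  have := corner_ideal_sub fg; rewrite inE /fiber_map rmorphB /= -!/(fiber_map c I _).
  by rewrite f0 sub0r oppr_eq0 => /eqP.
by rewrite g0 subr0 in fg.
Qed.

Lemma corner_idealE : corner_ideal K j =i fiber_ideal c I.
Proof. by move=> f; apply/idP/idP; [apply: corner_ideal_sub|apply: fiber_ideal_sub]. Qed.

(** If [t] were standard, its coefficient would have to be cancelled by another monomial with the
    same degree and exponent. The standard reduction of that monomial keeps its weight and equals
    [t], so the weights agree, and by [standard_lex_min] the monomial is not below [t]. *)
Lemma init_nonstandard f t : f \in corner_ideal K j -> is_init f t -> ~~ standard t.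
Proof.
move=> fJ [tf t_max]; apply/negP => std_t.
have /eqP f0 := corner_ideal_sub fJ.
have := fiber_relation I_gen m_gt1 c_convex c_decr c_incr f0 std_t.
rewrite big_mkcond (bigD1_seq t) ?msupp_uniq //= !eqxx /= big_seq_cond big1 ?addr0.
  by move=> ft0; move: tf; rewrite mcoeff_msupp ft0 eqxx.
move=> e /andP[ef et]; case: ifP => // /andP[/eqP de /eqP ce].
have we : mweight e = mweight t.
  have [s std_s [ds <- le_s]] := cexp_standard_le c_convex e.
  congr mweight; apply: (cexp_antichain m_gt1 c_decr c_incr) => //; first by rewrite ds.
  by rewrite -ce.
by have := standard_lex_min m_gt1 std_t de we; rewrite t_max.
Qed.

Lemma corner_ideal_init :
  init_ideal (corner_ideal K j) =i ideal_gen (nonadjacent_products K m).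
Proof.
move=> f; apply/idP/idP; apply: ideal_gen_sub => {}f /asboolP.
  move=> [g [t [gJ /(init_nonstandard gJ)/nonstandardP[i [k [e [ik ->]]]] ->]]].
  rewrite !mpolyXD -mulrA; apply/ideal_genM/mem_ideal_gen/asboolP.
  by exists i, k.
move=> [i [k [ik ->]]]; apply: mem_ideal_gen; apply/asboolP.
have [[i1 [k1 [ei1 ek ik1 _ gB]]]|[_ gM]] := nonadjacent_cases K j_incr cornerE m_gt1 ik.
  exists ('X_i * 'X_k - 'X_i1 * 'X_k1), (U_(i) + U_(k))%MM.
  split; last by rewrite mpolyXD.
    by apply: mem_ideal_gen; rewrite inE gB.
  exact: binomial_init.
exists ('X_i * 'X_k), (U_(i) + U_(k))%MM; split; last by rewrite mpolyXD.
  by apply: mem_ideal_gen; rewrite inE gM orbT.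
rewrite -mpolyXD; split; first by rewrite msuppX inE.
by move=> s; rewrite msuppX inE => ->.
Qed.

End DefiningIdeal.

(** * Restriction to a segment between consecutive corners *)

Section MonomialSubstitution.
Variables (K : fieldType) (n k : nat) (P : pred 'I_n) (v : 'I_n -> 'X_{1..k}).

Definition msubst : {mpoly K[n]} -> {mpoly K[k]} :=
  mmap (@mpolyC k K) (fun i => if P i then 'X_[v i] else 0).

HB.instance Definition _ := GRing.RMorphism.on msubst.

Definition mshift (e : 'X_{1..n}) : 'X_{1..k} := (\sum_(i < n) v i *+ e i)%MM.

Lemma mshiftE e x : mshift e x = (\sum_(i < n) v i x * e i)%N.
Proof. by rewrite /mshift mnm_sumE; apply: eq_bigr => i _; rewrite mulmnE. Qed.

Lemma msubstC a : msubst a%:MP = a%:MP.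
Proof. exact: mmapC. Qed.

Lemma msubstXU i : msubst 'X_i = if P i then 'X_[v i] else 0.
Proof. by rewrite /msubst mmapX mmap1U. Qed.

Lemma msubstX e :
  msubst 'X_[e] = if [forall i, P i || (e i == 0%N)] then 'X_[mshift e] else 0.
Proof.
rewrite /msubst mmapX /mmap1; case: ifP => [/forallP Pe|/negbT/forallPn[i]].
  rewrite /mshift -mprodXE; apply: eq_bigr => i _; have := Pe i.
  by case: (P i) => /= [_|/eqP->]; rewrite ?mulm0n ?expr0 ?mpolyX0 // mpolyXn.
rewrite negb_or => /andP[/negPf Pi ei].
by rewrite (bigD1 i) //= Pi expr0n (negPf ei) mul0r.
Qed.

Lemma mcoeff_msubst f u : (msubst f)@_u =
  \sum_(e <- msupp f | [forall i, P i || (e i == 0%N)] && (mshift e == u)) f@_e.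
Proof.
rewrite [X in msubst X]mpolyE rmorph_sum raddf_sum [RHS]big_mkcond /=.
apply: eq_bigr => e _; rewrite -mul_mpolyC rmorphM /= msubstC msubstX mcoeffCM.
by case: ifP => _ /=; rewrite ?mcoeff0 ?mulr0 // mcoeffX; case: eqP; rewrite ?mulr1 ?mulr0.
Qed.

End MonomialSubstitution.

Lemma mpoly_rmorph_ext (K : fieldType) (n : nat) (R : comNzRingType)
    (f g : {rmorphism {mpoly K[n]} -> R}) :
  (forall a, f a%:MP = g a%:MP) -> (forall i, f 'X_i = g 'X_i) -> f =1 g.
Proof.
move=> fgC fgX; elim/mpoly_subring_ind => [//|//|p q ep eq|p q ep eq].
  by rewrite !rmorphD ep eq.
by rewrite !rmorphM ep eq.
Qed.

Definition mnm2 (a b : nat) : 'X_{1..2} := [multinom if x == 0%R then a else b | x < 2].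

Lemma mnm2_0 a b : mnm2 a b 0 = a. Proof. by rewrite mnmE. Qed.
Lemma mnm2_1 a b : mnm2 a b 1 = b. Proof. by rewrite mnmE. Qed.

Lemma mnm2P (u v : 'X_{1..2}) : u 0 = v 0 -> u 1 = v 1 -> u = v.
Proof.
move=> e0 e1; apply/mnmP => -[[|[|//]] lt].
  by have -> : Ordinal lt = 0 by apply: val_inj.
by have -> : Ordinal lt = 1 by apply: val_inj.
Qed.

Lemma ord2_cases (x0 x1 y : 'I_2) : x0 != x1 -> y = x0 \/ y = x1.
Proof.
by case: x0 x1 y => [[|[|//]] ?] [[|[|//]] ?] [[|[|//]] ?] // _;
  by [left; apply: val_inj|right; apply: val_inj].
Qed.

Section Segment.
Variables (K : fieldType) (m : nat).

Definition segment_map (p q : nat) : {mpoly K[m]} -> {mpoly K[2]} :=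
  msubst (fun i : 'I_m => (p <= i <= q)%N) (fun i => mnm2 1 i).

HB.instance Definition _ p q := GRing.RMorphism.on (segment_map p q).

Lemma mshift_segment (e : 'X_{1..m}) :
  mshift (fun i : 'I_m => mnm2 1 i) e = mnm2 (mdeg e) (mweight e).
Proof.
apply: mnm2P; rewrite mshiftE ?mnm2_0 ?mnm2_1.
  by rewrite mdegE; apply: eq_bigr => i _; rewrite mnm2_0 mul1n.
by apply: eq_bigr => i _; rewrite mnm2_1.
Qed.

(* [X_(x0)] and [X_(x1)] go to the images of the two corners p < q of a segment,
   so modulo q - p the weights of the monomials below tell the summands apart. *)
Lemma segment_independence (p q : nat) (x0 x1 : 'I_2)
    (E := msubst predT (fun x : 'I_2 => mnm2 1 (if x == x0 then p else q)))
    (U : {mpoly K[2]}) (V : 'I_m -> {mpoly K[2]}) :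
  x0 != x1 -> (p < q)%N ->
  E U + \sum_(i < m | (p < i < q)%N) E (V i) * 'X_[mnm2 1 i] = 0 ->
  U = 0 /\ forall i : 'I_m, (p < i < q)%N -> V i = 0.
Proof.
move=> x01 pq rel.
pose kap := mshift (fun x : 'I_2 => mnm2 1 (if x == x0 then p else q)).
have sum2 (F : 'I_2 -> nat) : (\sum_(x < 2) F x = F x0 + F x1)%N.
  rewrite (bigD1 x0) //= (bigD1 x1) /= 1?eq_sym // big1 ?addn0 // => y /andP[y0 y1].
  by case: (ord2_cases y x01) y0 y1 => ->; rewrite ?eqxx.
have kap0 e : kap e 0 = (e x0 + e x1)%N.
  by rewrite /kap mshiftE sum2 !mnm2_0 !mul1n.
have kap1 e : kap e 1 = (p * e x0 + q * e x1)%N.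
  by rewrite /kap mshiftE sum2 !mnm2_1 eqxx eq_sym (negPf x01).
have [d ed] : exists d, q = (p + d.+1)%N by exists (q - p).-1; lia.
have EC (W : {mpoly K[2]}) u : (E W)@_u = \sum_(e <- msupp W | kap e == u) W@_e.
  rewrite mcoeff_msubst; apply: eq_bigl => e.
  by rewrite (_ : [forall i, _] = true) //; apply/forallP.
have mnm_x (e e' : 'X_{1..2}) : e x0 = e' x0 -> e x1 = e' x1 -> e = e'.
  by move=> e0 e1; apply/mnmP => y; case: (ord2_cases y x01) => ->.
have kap_inj e e' : kap e = kap e' -> e = e'.
  move=> ek; have := congr1 (fun u : 'X_{1..2} => u 0) ek.
  have := congr1 (fun u : 'X_{1..2} => u 1) ek; rewrite /= !kap0 !kap1 ed => e1 e0.
  have h : (d.+1 * e x1 = d.+1 * e' x1)%N by have := congr1 (muln p) e0; nia.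
  have h1 : e x1 = e' x1 by apply/eqP; rewrite -(eqn_pmul2l (ltn0Sn d)) h.
  by apply: mnm_x => //; lia.
have Ekap W e : (E W)@_(kap e) = W@_e.
  rewrite EC; have [eW|eW] := boolP (e \in msupp W); last first.
    rewrite (memN_msupp_eq0 eW) big_seq_cond big1 // => e' /andP[e'W /eqP/kap_inj ee'].
    by rewrite ee' (negPf eW) in e'W.
  rewrite big_mkcond (bigD1_seq e) ?msupp_uniq //= eqxx big1 ?addr0 // => e' ne.
  by case: eqP => // /kap_inj ee'; rewrite ee' eqxx in ne.
have EX0 W u v : (forall e, (kap e + u)%MM != v) -> (E W * 'X_[u])@_v = 0.
  move=> none; apply: memN_msupp_eq0; rewrite (perm_mem (msuppMX _ _)).
  apply/mapP => -[w]; rewrite mcoeff_msupp EC => wE ev.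
  have [[e /eqP ew]|none'] := pselect (exists e, kap e == w); last first.
    by case/eqP: wE; apply: big1 => e ke; case: none'; exists e.
  by have := none e; rewrite ew addmC -ev eqxx.
(* Subtracting p times the degree from the weight leaves, up to a constant, (q - p) e_x1 + (i - p)
   with 0 < i - p < q - p, so i is the remainder of a division. *)
have sep e e' (i i' : nat) : (p < i < q)%N -> (p < i' < q)%N ->
    (kap e + mnm2 1 i = kap e' + mnm2 1 i')%MM -> i = i'.
  move=> pi pi' ek; have := congr1 (fun u : 'X_{1..2} => u 0) ek.
  have := congr1 (fun u : 'X_{1..2} => u 1) ek.
  rewrite /= !mnmDE !kap0 !kap1 !mnm2_0 !mnm2_1 ed => e1 e0.
  have h : (d.+1 * e x1 + (i - p) = d.+1 * e' x1 + (i' - p))%N.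
    by have := congr1 (muln p) e0; nia.
  have [lt|lt|eq1] := ltngtP (e x1) (e' x1); [nia|nia|].
  by move: h; rewrite eq1 => /addnI; lia.
have sep0 e e' (i : nat) : (p < i < q)%N -> (kap e + mnm2 1 i)%MM != kap e'.
  move=> pi; apply/eqP => ek; have := congr1 (fun u : 'X_{1..2} => u 0) ek.
  have := congr1 (fun u : 'X_{1..2} => u 1) ek.
  rewrite /= !mnmDE !kap0 !kap1 !mnm2_0 !mnm2_1 ed => e1 e0.
  have h : (d.+1 * e x1 + (i - p) = d.+1 * e' x1)%N.
    by have := congr1 (muln p) e0; nia.
  have [lt|lt|eq1] := ltngtP (e x1) (e' x1); nia.
have V0 (i : 'I_m) : (p < i < q)%N -> V i = 0.
  move=> pi; apply/mpolyP => e; rewrite mcoeff0 -Ekap.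
  have := congr1 (mcoeff (kap e + mnm2 1 i)%MM) rel.
  rewrite (bigD1 i) //= !mcoeffD mcoeff0 [X in _ + (_ + X)]raddf_sum addmC mcoeffMX.
  have -> : (E U)@_(mnm2 1 i + kap e) = 0.
    rewrite -[E U]mulr1 -mpolyX0 EX0 // => e'; rewrite addm0 addmC eq_sym; exact: sep0.
  rewrite [X in _ + (_ + X)]big1 ?addr0 ?add0r // => k /andP[pk ki]; apply: EX0 => e'.
  apply: contra ki => /eqP; rewrite addmC [RHS]addmC => ek; apply/eqP/val_inj.
  by apply: (sep e' e) => //; rewrite addmC ek addmC.
split=> //; apply/mpolyP => e; rewrite mcoeff0 -Ekap.
have := congr1 (mcoeff (kap e)) rel.
rewrite mcoeffD mcoeff0 [X in _ + X]raddf_sum big1 ?addr0 // => i pi /=.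
by apply: EX0 => e'; apply: sep0.
Qed.

End Segment.

(** * Reducedness and a chain of three primes *)

Section ReducedAndPrimes.
Variables (K : fieldType) (I : {pred {mpoly K[2]}}) (m : nat) (c : 'I_m -> 'X_{1..2}).
Variables (l : nat) (j : 'I_l -> 'I_m).
Hypothesis m_gt1 : (1 < m)%N.
Hypothesis I_gen : I =i ideal_gen (monomials_of c [set: 'I_m]).
Hypothesis c_convex : convex c.
Hypothesis c_decr : forall i k : 'I_m, (i < k)%N -> (c k 0%R < c i 0%R)%N.
Hypothesis c_incr : forall i k : 'I_m, (i < k)%N -> (c i 1%R < c k 1%R)%N.
Hypothesis j_incr : forall k k' : 'I_l, (k < k')%N -> (j k < j k')%N.
Hypothesis cornerE : forall i : 'I_m, corner c i <-> exists k : 'I_l, i = j k.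
Implicit Types (f g : {mpoly K[m]}) (i k : 'I_m).
Local Notation phi := (fiber_map c I).

Lemma segment_mapXU p q i :
  segment_map p q ('X_i : {mpoly K[m]}) = if (p <= i <= q)%N then 'X_[mnm2 1 i] else 0.
Proof. exact: msubstXU. Qed.

(** A minor of another segment loses both terms, a minor of this one has two terms with equal image,
    and a product across a corner has an index outside the segment. *)
Lemma segment_map_corner_ideal (a a' : 'I_l) f : a' = a.+1 :> nat ->
  f \in corner_ideal K j -> segment_map (j a) (j a') f = 0.
Proof.
move=> ea' /ideal_genP[n [b [s [sB ->]]]]; rewrite rmorph_sum big1 // => x _.
rewrite rmorphM /=; suff -> : segment_map (j a) (j a') (s x) = 0 by rewrite mulr0.
have /orP[/corner_binomialsP|/asboolP] := sB x.
  move=> [t [t' [i [i1 [k1 [k [et' ei1 ek ik [jt jt' ->]]]]]]]].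
  rewrite rmorphB !rmorphM /= !segment_mapXU.
  have [ta|at_|/val_inj eta] := ltngtP t a.
  - have jta : (j t' <= j a)%N.
      have [/j_incr/ltnW//|at'|/val_inj->//] := ltngtP t' a; lia.
    rewrite (_ : (j a <= i <= _)%N = false) ?mul0r ?sub0r; last by lia.
    by rewrite (_ : (j a <= i1 <= _)%N = false) ?mul0r ?oppr0 //; lia.
  - have jta : (j a' <= j t)%N.
      have [/j_incr/ltnW//|at'|/val_inj->//] := ltngtP a' t; lia.
    rewrite (_ : (_ <= k <= j a')%N = false) ?mulr0 ?sub0r; last by lia.
    by rewrite (_ : (_ <= k1 <= j a')%N = false) ?mulr0 ?oppr0 //; lia.
  have eta' : t' = a' by apply: val_inj; rewrite /= et' ea' eta.
  rewrite eta eta' in jt jt'.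
  have in_seg (h : 'I_m) : (i <= h <= k)%N -> (j a <= h <= j a')%N by lia.
  rewrite !in_seg; try lia.
  rewrite -!mpolyXD; apply/eqP; rewrite subr_eq0; apply/eqP; congr 'X_[_].
  by apply: mnm2P; rewrite !mnmDE ?mnm2_0 ?mnm2_1 // ei1 ek; lia.
move=> [i [k [ik -> none]]]; rewrite rmorphM /= !segment_mapXU.
have [h ihk ch] := corner_monomial_corner j_incr cornerE m_gt1 ik none.
have := no_corner_between j_incr cornerE (h := h) ea'.
have [jah|jah] := boolP (j a < h < j a')%N; first by move=> /(_ isT).
move=> _; have [le_h|lt_h] := leqP h (j a).
  by rewrite (_ : (j a <= i <= _)%N = false) ?mul0r //; lia.
by rewrite (_ : (_ <= k <= j a')%N = false) ?mulr0 //; lia.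
Qed.

Lemma segment_map_phi (a a' : 'I_l) f g : a' = a.+1 :> nat -> phi f = phi g ->
  segment_map (j a) (j a') f = segment_map (j a) (j a') g.
Proof.
move=> ea' e; apply/eqP; rewrite -subr_eq0 -rmorphB; apply/eqP.
apply: (segment_map_corner_ideal ea').
rewrite (corner_idealE m_gt1 I_gen c_convex c_decr c_incr j_incr cornerE) inE.
by rewrite /fiber_map rmorphB /= -!/(fiber_map c I _) e subrr.
Qed.

(** The segment maps land in a domain, so they kill the normal form [f] of a nilpotent element. Each
    standard monomial of [f] lives on two adjacent indices, hence survives on some segment, where
    its image records degree and weight and so meets no other standard monomial. *)
Lemma fiber_cone_reduced : reduced (fiber_cone I).
Proof.
move=> x n xn; have [f0 ex0] := fiber_cone_lift I_gen x.
have [f f0f std_f] := corner_normal_form j_incr cornerE m_gt1 f0.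
have ex : x = phi f.
  move: f0f; rewrite (corner_idealE m_gt1 I_gen c_convex c_decr c_incr j_incr cornerE) inE.
  by rewrite /fiber_map rmorphB /= -!/(fiber_map c I _) -ex0 subr_eq0 => /eqP.
suff f_eq0 : f = 0 by rewrite ex f_eq0 /fiber_map rmorph0.
have seg0 (a a' : 'I_l) : a' = a.+1 :> nat -> segment_map (j a) (j a') f = 0.
  (* The exponent [n] may be 0; raising it by one makes [expf_eq0] applicable in every case. *)
  move=> ea'; have : segment_map (j a) (j a') (f ^+ n.+1) = 0.
    rewrite (segment_map_phi (g := 0) ea') ?rmorph0 //.
    by rewrite /fiber_map rmorphXn rmorph0 /= -!/(fiber_map c I _) -ex exprS xn mulr0.
  by move/eqP; rewrite rmorphXn expf_eq0 => /andP[_ /eqP].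
apply/msuppnil0; case e_supp : (msupp f) => [//|t s].
have tf : t \in msupp f by rewrite e_supp inE eqxx.
have [std_t _] := std_f t tf.
have [q [q1 [u [v [eq1 et]]]]] := standard_form m_gt1 std_t.
have qq1 : (q < q1)%N by rewrite eq1.
have [h|a [a' [ea' ja ja']]] := flat_segment j_incr cornerE m_gt1 qq1; first by lia.
have := congr1 (mcoeff (mnm2 (mdeg t) (mweight t))) (seg0 a a' ea').
rewrite mcoeff0 mcoeff_msubst big_mkcond (bigD1_seq t) ?msupp_uniq //= mshift_segment eqxx andbT.
rewrite (_ : [forall i, _] = true); last first.
  apply/forallP => i; rewrite et mnmDE !mulmnE !mnm1E.
  have [<-|_] := eqVneq q i; first by rewrite (_ : (j a <= q <= j a')%N = true) //; lia.
  have [<-|_] := eqVneq q1 i; first by rewrite (_ : (j a <= q1 <= j a')%N = true) //; lia.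
  by rewrite !mul0n eqxx orbT.
rewrite big_seq_cond big1 ?addr0 => [ft0|e /andP[ef et']].
  by move: tf; rewrite mcoeff_msupp ft0 eqxx.
case: ifP => // /andP[_]; rewrite mshift_segment => /eqP ee.
have [std_e _] := std_f e ef.
case/eqP: et'; apply: standard_inj => //.
  by have := congr1 (fun u : 'X_{1..2} => u 0) ee; rewrite /= !mnm2_0.
by have := congr1 (fun u : 'X_{1..2} => u 1) ee; rewrite /= !mnm2_1.
Qed.

Lemma prime_of_morphism (psi : {rmorphism {mpoly K[m]} -> {mpoly K[2]}}) :
  (forall f, phi f = 0 -> psi f = 0) ->
  prime_ideal [pred x : fiber_cone I | `[< exists2 f, x = phi f & psi f = 0 >]].
Proof.
move=> kill; have eq_psi f g : phi f = phi g -> psi f = psi g.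
  move=> e; apply/eqP; rewrite -subr_eq0 -rmorphB; apply/eqP/kill.
  by rewrite /fiber_map rmorphB /= -!/(fiber_map c I _) e subrr.
split; first split.
- by apply/asboolP; exists 0; rewrite ?rmorph0 // /fiber_map rmorph0.
- apply/asboolP => -[f e1 f0]; have := eq_psi 1 f; rewrite f0 rmorph1 /fiber_map rmorph1.
  by move=> /(_ e1)/eqP; rewrite oner_eq0.
- move=> b x y /asboolP[f -> f0] /asboolP[g -> g0]; have [h ->] := fiber_cone_lift I_gen b.
  apply/asboolP; exists (h * f + g); first by rewrite /fiber_map rmorphD rmorphM.
  by rewrite rmorphD rmorphM f0 g0 mulr0 addr0.
move=> x y /asboolP[h exy h0].
have [f ex] := fiber_cone_lift I_gen x; have [g ey] := fiber_cone_lift I_gen y.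
have : psi f * psi g = 0.
  by rewrite -rmorphM -h0; apply: eq_psi; rewrite -exy ex ey /fiber_map rmorphM.
move/eqP; rewrite mulf_eq0 => /orP[] /eqP e0; apply/orP; [left|right]; apply/asboolP.
  by exists f.
by exists g.
Qed.

Lemma first_segment : exists a a' : 'I_l, [/\ a' = a.+1 :> nat, j a = 0%N :> nat & (0 < j a')%N].
Proof.
have [h|a [a' [ea' ja ja']]] := flat_segment j_incr cornerE m_gt1
  (i := Ordinal (ltnW m_gt1)) (k := Ordinal m_gt1) isT; first by move=> /=; lia.
by exists a, a'; split=> //; move: ja ja' => /=; lia.
Qed.

(** These are the preimages of 0, (t) and (s, t) under the map of the first segment. They differ
    because the variables of index 1 and 0 go to s t and s, the first segment starting at index
    0. *)
Lemma fiber_cone_prime_chain : exists P : nat -> {pred fiber_cone I}, prime_chain 2 P.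
Proof.
have [a [a' [ea' ja ja']]] := first_segment.
pose psi0 := segment_map (j a) (j a') : {rmorphism {mpoly K[m]} -> {mpoly K[2]}}.
pose psi1 := subst0 1 \o psi0 : {rmorphism {mpoly K[m]} -> {mpoly K[2]}}.
pose psi2 := subst0 0 \o psi1 : {rmorphism {mpoly K[m]} -> {mpoly K[2]}}.
pose P n : {pred fiber_cone I} :=
  [pred x | `[< exists2 f, x = phi f & (nth psi2 [:: psi0; psi1] n) f = 0 >]].
have kill0 f : phi f = 0 -> psi0 f = 0.
  move=> f0; rewrite /psi0 /= (segment_map_phi (g := 0) ea') ?rmorph0 //.
  by rewrite f0 /fiber_map rmorph0.
have kill1 f : phi f = 0 -> psi1 f = 0 by move=> /kill0 e; rewrite /psi1 /= e rmorph0.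
have kill2 f : phi f = 0 -> psi2 f = 0 by move=> /kill1 e; rewrite /psi2 /= [subst0 1 _]e rmorph0.
have z0 : (0 < m)%N := ltnW m_gt1.
have in_psi (psi : {rmorphism {mpoly K[m]} -> {mpoly K[2]}}) f :
    (forall f, phi f = 0 -> psi f = 0) ->
    [pred x : fiber_cone I | `[< exists2 f, x = phi f & psi f = 0 >]] (phi f) -> psi f = 0.
  move=> kill /asboolP[g e g0]; rewrite -[RHS]g0; apply/eqP.
  rewrite -subr_eq0 -rmorphB; apply/eqP/kill.
  by rewrite /fiber_map rmorphB /= -!/(fiber_map c I _) e subrr.
have psi0X (i : 'I_m) : (i <= 1)%N -> psi0 'X_i = 'X_[mnm2 1 i].
  by move=> i1; rewrite /psi0 /= segment_mapXU ja (leq_trans i1).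
have mnm2X : mnm2 1 0 = U_(0%R)%MM.
  by apply: mnm2P; rewrite ?mnm2_0 ?mnm2_1 mnm1E.
have mnm2XY : mnm2 1 1 = (U_(0%R) + U_(1%R))%MM.
  by apply: mnm2P; rewrite ?mnm2_0 ?mnm2_1 mnmDE !mnm1E.
have psi1X1 : psi1 'X_(Ordinal m_gt1) = 0.
  by rewrite /psi1 /= -/(psi0 _) psi0X //= mnm2XY mpolyXD rmorphM /= !subst0X /= mulr0.
have psi1X0 : psi1 'X_(Ordinal z0) = 'X_0.
  by rewrite /psi1 /= -/(psi0 _) psi0X //= mnm2X subst0X.
exists P; split=> [[|[|[|//]]] _|[|[|//]] _].
- exact: prime_of_morphism.
- exact: prime_of_morphism.
- exact: prime_of_morphism.
- split=> [x /asboolP[f -> f0]|sub].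
    by apply/asboolP; exists f => //; rewrite /psi1 /= [segment_map _ _ f]f0 rmorph0.
  have : phi 'X_(Ordinal m_gt1) \in P 0%N.
    by apply: sub; apply/asboolP; exists 'X_(Ordinal m_gt1).
  move=> /(in_psi psi0 _ kill0)/eqP; rewrite psi0X // -msize_poly_eq0 msizeX.
  by [].
split=> [x /asboolP[f -> f0]|sub].
  apply/asboolP; exists f => //; rewrite /psi2 /=.
  by rewrite [subst0 1 _]f0 rmorph0.
have : phi 'X_(Ordinal z0) \in P 1%N.
  apply: sub; apply/asboolP; exists 'X_(Ordinal z0) => //.
  by rewrite -[LHS]/(subst0 0 (psi1 'X_(Ordinal z0))) psi1X0 subst0X.
move=> /(in_psi psi1 _ kill1)/eqP; rewrite psi1X0.
by rewrite (negPf (mpolyXU_neq0 _ _)).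
Qed.

End ReducedAndPrimes.

(** * A basis over the two parameters *)

Section FreeBasis.
Variables (K : fieldType) (I : {pred {mpoly K[2]}}) (m : nat) (c : 'I_m -> 'X_{1..2}).
Variables (l : nat) (j : 'I_l -> 'I_m).
Hypothesis m_gt1 : (1 < m)%N.
Hypothesis I_gen : I =i ideal_gen (monomials_of c [set: 'I_m]).
Hypothesis c_convex : convex c.
Hypothesis c_decr : forall i k : 'I_m, (i < k)%N -> (c k 0%R < c i 0%R)%N.
Hypothesis c_incr : forall i k : 'I_m, (i < k)%N -> (c i 1%R < c k 1%R)%N.
Hypothesis j_incr : forall k k' : 'I_l, (k < k')%N -> (j k < j k')%N.
Hypothesis cornerE : forall i : 'I_m, corner c i <-> exists k : 'I_l, i = j k.
Implicit Types (f g : {mpoly K[m]}) (s t : nat).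
Local Notation phi := (fiber_map c I).
Local Notation F := (fiber_cone I).

(** Corners numbered by all of [nat], so that neighbouring corners can be named by successors;
    beyond the last one the value is [m], where [zclass] vanishes. *)
Definition corner_index t : nat := if insub t is Some a then nat_of_ord (j a) else m.
Local Notation J := corner_index.

Lemma corner_indexE (a : 'I_l) : J a = j a.
Proof. by rewrite /J valK. Qed.

Lemma corner_index_lt s t : (s < t)%N -> (t < l)%N -> (J s < J t)%N.
Proof.
move=> st tl; have sl := ltn_trans st tl.
by rewrite -[s]/(nat_of_ord (Ordinal sl)) -[t]/(nat_of_ord (Ordinal tl)) !corner_indexE j_incr.
Qed.

Lemma corner_index_bound t : (t < l)%N -> (J t < m)%N.
Proof. by move=> tl; rewrite -[t]/(nat_of_ord (Ordinal tl)) corner_indexE. Qed.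

Definition zclass (n : nat) : F := phi (zvar K n).
Local Notation Z := zclass.

Lemma zclassE (i : 'I_m) : Z i = phi 'X_i.
Proof. by rewrite /Z zvarE. Qed.

Lemma zclassM (i k : 'I_m) : Z i * Z k = phi ('X_i * 'X_k).
Proof. by rewrite !zclassE /fiber_map rmorphM. Qed.

Lemma zclass_ge n : (m <= n)%N -> Z n = 0.
Proof.
move=> mn; rewrite /Z /zvar (_ : insub n = None) /=; first by rewrite /fiber_map rmorph0.
by apply: insubF; rewrite ltnNge mn.
Qed.

Lemma zclass_corner0 i t k : (i < J t)%N -> (J t < k)%N -> (t < l)%N -> Z i * Z k = 0.
Proof.
move=> it tk tl; have [mk|km] := leqP m k; first by rewrite (zclass_ge mk) mulr0.
have im : (i < m)%N by apply: ltn_trans (ltn_trans it tk) km.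
rewrite -[i]/(nat_of_ord (Ordinal im)) -[k]/(nat_of_ord (Ordinal km)) zclassM.
have ct : corner c (j (Ordinal tl)) by apply/cornerE; exists (Ordinal tl).
apply: (phi_corner0 m_gt1 I_gen c_convex _ ct).
by rewrite -corner_indexE /= it tk.
Qed.

Lemma zclass_flat i t k : (t.+1 < l)%N -> (J t <= i)%N -> (i < k)%N -> (k < J t.+1)%N ->
  Z i * Z k.+1 = Z i.+1 * Z k.
Proof.
move=> tl ti ik kt; have k1m : (k.+1 < m)%N by apply: leq_ltn_trans kt (corner_index_bound tl).
have km := ltnW k1m; have im := ltn_trans ik km; have i1m := leq_ltn_trans ik km.
rewrite -[i]/(nat_of_ord (Ordinal im)) -[k.+1]/(nat_of_ord (Ordinal k1m)).
rewrite -[(nat_of_ord _).+1]/(nat_of_ord (Ordinal i1m)) -[k]/(nat_of_ord (Ordinal km)) !zclassM.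
apply: (phi_flat I_gen c_convex) => //= h ihk.
apply: (no_corner_between j_incr cornerE (a := Ordinal (ltnW tl)) (a' := Ordinal tl)) => //.
by rewrite -!corner_indexE /=; lia.
Qed.

(* Every segment between consecutive corners has one end of each parity, so the
   sums of the corners of even and of odd index restrict to the two ends of each
   segment and form a system of parameters. *)
Definition theta (b : bool) : F := \sum_(t < l | odd t == b) Z (J t).

Lemma theta_one b (x : F) t : (t < l)%N -> odd t = b ->
  (forall s, (s < l)%N -> odd s = b -> s != t -> Z (J s) * x = 0) -> x * theta b = x * Z (J t).
Proof.
move=> tl tb others; rewrite /theta mulr_sumr (bigD1 (Ordinal tl)) /= ?tb //.
rewrite big1 ?addr0 // => s /andP[/eqP sb st]; rewrite mulrC others //.
Qed.

(** Every other corner of the parity of [t] is separated from [i] by the corner numbered [s.+1] or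
    [t.+1], so its product with z_i vanishes. *)
Lemma zclass_theta_left i t : (t.+1 < l)%N -> (J t <= i)%N -> (i < J t.+1)%N ->
  Z i * theta (odd t) = Z i * Z (J t).
Proof.
move=> tl ti it; apply: theta_one => //; first exact: ltnW.
move=> s sl st; rewrite neq_ltn => /orP[lt_st|lt_ts].
  have s1 : (s.+1 < t)%N by rewrite ltn_neqAle lt_st andbT; apply: contraPneq st => <- /=; case: odd.
  have h1 := corner_index_lt (ltnSn s) (ltn_trans s1 (ltnW tl)).
  have h2 := corner_index_lt s1 (ltnW tl).
  by apply: (zclass_corner0 (t := s.+1)) => //; lia.
have t1 : (t.+1 < s)%N by rewrite ltn_neqAle lt_ts andbT; apply: contraPneq st => <- /=; case: odd.
by rewrite mulrC; apply: (zclass_corner0 (t := t.+1)) => //; apply: corner_index_lt.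
Qed.

Lemma zclass_theta_right i t : (t.+1 < l)%N -> (J t < i)%N -> (i <= J t.+1)%N ->
  Z i * theta (~~ odd t) = Z i * Z (J t.+1).
Proof.
move=> tl ti it; apply: theta_one => //.
move=> s sl st; rewrite neq_ltn => /orP[lt_st|lt_ts].
  have lt_st' : (s < t)%N.
    by rewrite ltn_neqAle -ltnS lt_st andbT; apply: contraPneq st => ->; case: odd.
  by apply: (zclass_corner0 (t := t)) => //; [apply: corner_index_lt => //|]; apply: ltnW.
have h1 : (t.+2 < s)%N.
  by rewrite ltn_neqAle lt_ts andbT; apply: contraPneq st => <- /=; case: odd.
have h2 := corner_index_lt (ltnSn t.+1) (ltn_trans h1 sl).
have h3 := corner_index_lt h1 sl.
by rewrite mulrC; apply: (zclass_corner0 (t := t.+2)) => //; [lia|apply: ltn_trans h1 sl].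
Qed.

Lemma corner_index0 : J 0 = 0%N /\ (1 < l)%N.
Proof.
have [a [a' [ea' ja ja']]] := first_segment m_gt1 j_incr cornerE.
have a0 : nat_of_ord a = 0%N.
  apply/eqP; rewrite -leqn0 leqNgt; apply/negP => a_gt0.
  by have := corner_index_lt a_gt0 (ltn_ord a); rewrite corner_indexE ja.
split; first by have := corner_indexE a; rewrite a0 ja.
by have := ltn_ord a'; rewrite ea' a0.
Qed.

Lemma last_corner_index : J l.-1 = m.-1.
Proof.
have [_ l1] := corner_index0.
have im : (m.-1 < m)%N by rewrite prednK // ltnW.
have /cornerE[a ea] : corner c (Ordinal im) by apply: Or32; rewrite /= prednK // ltnW.
have l1l : (l.-1 < l)%N by lia.
have [lt_a|le_a] := ltnP a l.-1.
  have := corner_index_lt lt_a l1l; rewrite corner_indexE -ea /=.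
  by have := corner_index_bound l1l; lia.
have <- : nat_of_ord a = l.-1 by have := ltn_ord a; lia.
by rewrite corner_indexE -ea.
Qed.

Lemma zclass_corner_sq t : (t < l)%N -> Z (J t) * theta (odd t) = Z (J t) * Z (J t).
Proof.
move=> tl; have [_ l1] := corner_index0; have [t1l|lt1] := ltnP t.+1 l.
  by apply: zclass_theta_left => //; apply: corner_index_lt.
have [t' et] : exists t', t = t'.+1 by exists t.-1; lia.
rewrite et /=; apply: zclass_theta_right => //; rewrite -?et //.
by apply: corner_index_lt => //; rewrite et.
Qed.

(** A corner times the parameter of opposite parity keeps exactly its two neighbours. This gives the
    recursion for products of consecutive corners in [quadric_next]. *)
Lemma zclass_corner_next t : (t.+2 < l)%N ->
  Z (J t.+1) * theta (odd t) = Z (J t) * Z (J t.+1) + Z (J t.+1) * Z (J t.+2).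
Proof.
move=> tl; have t0 : (t < l)%N by lia.
have ot2 : odd t.+2 == odd t by rewrite /= negbK.
rewrite /theta mulr_sumr (bigD1 (Ordinal t0)) //= (bigD1 (Ordinal tl)) /=; last first.
  by rewrite negbK eqxx -val_eqE /=; lia.
rewrite mulrC big1 ?addr0 // => s /andP[/andP[/eqP st]]; rewrite -!val_eqE /= => s_t s_t2.
have st1 : nat_of_ord s != t.+1 by apply: contraPneq st => -> /=; case: odd.
have [lt_s|lt_s] := ltnP s t.
  by rewrite mulrC; apply: (zclass_corner0 (t := t)) => //; apply: corner_index_lt => //; lia.
have lt_s2 : (t.+2 < s)%N by lia.
by apply: (zclass_corner0 (t := t.+2)) => //; apply: corner_index_lt => //; lia.
Qed.

Lemma zclass_first : Z (J 0) * theta true = Z (J 0) * Z (J 1).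
Proof.
have [_ l1] := corner_index0; apply: theta_one => // s sl os s1.
have s2 : (1 < s)%N by case: s os s1 {sl} => [|[|]].
by rewrite mulrC; apply: (zclass_corner0 (t := 1%N)) => //; apply: corner_index_lt.
Qed.

(** The first two corners are left out because [theta false] and [theta true] replace them: all
    further corners are among the basis elements, so these two can be solved for. *)
Definition basis_index : pred 'I_m := [pred i | (nat_of_ord i != 0%N) && (nat_of_ord i != J 1)].

Definition parameter (x : 'I_2) : F := theta (x == 1).
Definition basis_elt (i : 'I_#|basis_index|) : F := Z (enum_val i).
Local Notation th := parameter.
Local Notation w := basis_elt.

Definition linear_form (x : F) : Prop :=
  exists (a : 'I_2 -> K) (b : 'I_#|basis_index| -> K), x = \sum_y a y *: th y + \sum_i b i *: w i.

Lemma linear_form0 : linear_form 0.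
Proof.
exists (fun=> 0), (fun=> 0).
by rewrite !big1 ?addr0 // => i _; rewrite scale0r.
Qed.

Lemma linear_formD x y : linear_form x -> linear_form y -> linear_form (x + y).
Proof.
move=> [a [b ->]] [a' [b' ->]]; exists (fun i => a i + a' i), (fun i => b i + b' i).
rewrite addrACA -!big_split /=.
by congr (_ + _); apply: eq_bigr => i _; rewrite scalerDl.
Qed.

Lemma linear_formN x : linear_form x -> linear_form (- x).
Proof.
move=> [a [b ->]]; exists (fun i => - a i), (fun i => - b i).
by rewrite opprD -!sumrN; congr (_ + _); apply: eq_bigr => i _; rewrite scaleNr.
Qed.

Lemma linear_form_th y : linear_form (th y).
Proof.
exists (fun x => (x == y)%:R), (fun=> 0).
rewrite (bigD1 y) //= eqxx scale1r !big1 ?addr0 // => [i _|x /negPf->];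
  by rewrite scale0r.
Qed.

Lemma linear_form_w i : linear_form (w i).
Proof.
exists (fun=> 0), (fun k => (k == i)%:R).
rewrite big1 ?add0r => [|x _]; last by rewrite scale0r.
rewrite (bigD1 i) //= eqxx scale1r !big1 ?addr0 // => x /negPf->.
by rewrite scale0r.
Qed.

Lemma linear_form_theta b : linear_form (theta b).
Proof.
have := linear_form_th (if b then 1 else 0); rewrite /parameter.
by case: b.
Qed.

Lemma linear_form_basis_index n : n != 0%N -> n != J 1 -> linear_form (Z n).
Proof.
move=> n0 n1; have [mn|nm] := leqP m n; first by rewrite zclass_ge //; apply: linear_form0.
have Wn : Ordinal nm \in basis_index by rewrite inE /= n0.
have := linear_form_w (enum_rank_in Wn (Ordinal nm)).
by rewrite /basis_elt enum_rankK_in.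
Qed.

Lemma linear_form_corner t : (t < 2)%N -> linear_form (Z (J t)).
Proof.
move=> t2; have [J0 l1] := corner_index0; have tl : (t < l)%N by apply: leq_trans t2 l1.
have -> : Z (J t) = theta (odd t) - \sum_(s < l | (odd s == odd t) && (s != Ordinal tl)) Z (J s).
  by rewrite /theta (bigD1 (Ordinal tl)) //= addrK.
apply: linear_formD; first exact: linear_form_theta.
apply: linear_formN; elim/big_rec: _ => [|s x /andP[/eqP st sNt]]; first exact: linear_form0.
apply: linear_formD; have s2 : (1 < s)%N.
  move: sNt st; rewrite -val_eqE /=.
  by case: (nat_of_ord s) t t2 {tl} => [|[|?]] [|[|?]].
have := corner_index_lt s2 (ltn_ord s).
have := corner_index_lt (ltn_trans (ltn0Sn 0) s2) (ltn_ord s); rewrite J0 => s0 s1.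
by apply: linear_form_basis_index; apply/eqP => e; [move: s0|move: s1]; rewrite e ltnn.
Qed.

Lemma linear_form_zclass n : linear_form (Z n).
Proof.
have [J0 _] := corner_index0.
have [->|n0] := eqVneq n 0%N; first by rewrite -J0; apply: linear_form_corner.
have [->|n1] := eqVneq n (J 1); first exact: linear_form_corner.
exact: linear_form_basis_index.
Qed.

Definition parameter_quadric (x : F) : Prop :=
  exists2 y : bool -> F, forall b, linear_form (y b) & x = \sum_b y b * theta b.
Local Notation T := parameter_quadric.

Lemma quadricD x y : T x -> T y -> T (x + y).
Proof.
move=> [u hu ->] [v hv ->]; exists (fun b => u b + v b).
  by move=> b; apply: linear_formD.
by rewrite -big_split; apply: eq_bigr => b _; rewrite mulrDl.
Qed.

Lemma quadricN x : T x -> T (- x).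
Proof.
move=> [u hu ->]; exists (fun b => - u b) => [b|]; first exact: linear_formN.
by rewrite -sumrN; apply: eq_bigr => b _; rewrite mulNr.
Qed.

Lemma quadric_theta b n : T (Z n * theta b).
Proof.
exists (fun b' => if b' == b then Z n else 0) => [b'|].
  by case: eqP => _; [apply: linear_form_zclass|apply: linear_form0].
by rewrite (bigD1 b) //= eqxx big1 ?addr0 // => b' /negPf->; rewrite mul0r.
Qed.

(** The first corner has only one neighbour, which settles the first product; each next product is a
    multiple of a parameter minus the previous one. *)
Lemma quadric_next t : (t.+1 < l)%N -> T (Z (J t) * Z (J t.+1)).
Proof.
elim: t => [_|t IHt tl]; first by rewrite -zclass_first; apply: quadric_theta.
have -> : Z (J t.+1) * Z (J t.+2) = Z (J t.+1) * theta (odd t) + - (Z (J t) * Z (J t.+1)).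
  by rewrite zclass_corner_next // addrC addKr.
by apply: quadricD; [apply: quadric_theta|apply/quadricN/IHt/ltnW].
Qed.

Lemma quadric_sq t : (t < l)%N -> T (Z (J t) * Z (J t)).
Proof. by move=> tl; rewrite -zclass_corner_sq //; apply: quadric_theta. Qed.

Lemma quadric_left t k : (t.+1 < l)%N -> (J t <= k)%N -> (k <= J t.+1)%N -> T (Z (J t) * Z k).
Proof.
move=> tl tk kt; have [->|kNt1] := eqVneq k (J t.+1); first exact: quadric_next.
have [->|kNt] := eqVneq k (J t); first by apply/quadric_sq/ltnW.
by rewrite mulrC -zclass_theta_left //; [apply: quadric_theta|lia].
Qed.

Lemma quadric_right t i : (t.+1 < l)%N -> (J t <= i)%N -> (i <= J t.+1)%N ->
  T (Z i * Z (J t.+1)).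
Proof.
move=> tl ti it; have [->|iNt1] := eqVneq i (J t.+1); first exact: quadric_sq.
have [->|iNt] := eqVneq i (J t); first exact: quadric_next.
by rewrite -zclass_theta_right //; [apply: quadric_theta|lia].
Qed.

(** The indices slide outward, against the direction of the reduction to standard monomials, until
    one of them is an end of the segment, where a parameter can be factored out. *)
Lemma quadric_segment t i k : (t.+1 < l)%N -> (J t <= i)%N -> (i <= k)%N -> (k <= J t.+1)%N ->
  T (Z i * Z k).
Proof.
move=> tl; elim: i k => [|i IHi] k ti ik kt.
  by have <- : J t = 0%N; [lia|apply: quadric_left => //; lia].
have [->|kNt1] := eqVneq k (J t.+1); first by apply: quadric_right => //; lia.
have [<-|iNt] := eqVneq (J t) i.+1; first by apply: quadric_left => //; lia.
by rewrite -(zclass_flat (t := t)) //; [apply: IHi; lia|lia|lia].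
Qed.

Lemma quadric_zclass i k : T (Z i * Z k).
Proof.
wlog ik : i k / (i <= k)%N => [wl|].
  by have [/wl//|/ltnW/wl] := leqP i k; rewrite mulrC.
have [mk|km] := leqP m k.
  have -> : Z i * Z k = Z i * theta true - Z i * theta true by rewrite (zclass_ge mk) mulr0 subrr.
  by apply: quadricD; [|apply: quadricN]; apply: quadric_theta.
have [_ l1] := corner_index0.
have [i1m|mi1] := ltnP i.+1 m; last first.
  have -> : i = J l.-1 by rewrite last_corner_index; lia.
  have -> : k = J l.-1 by rewrite last_corner_index; lia.
  by apply: quadric_sq; lia.
have [h|a [a' [ea' ja ja']]] := flat_segment j_incr cornerE m_gt1
  (i := Ordinal (ltnW i1m)) (k := Ordinal i1m) (ltnSn i); first by move=> /=; lia.
have al : (a.+1 < l)%N by rewrite -ea'.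
rewrite -!corner_indexE ea' /= in ja ja'.
have [kt|tk] := leqP k (J a.+1); first exact: (quadric_segment al).
by rewrite (zclass_corner0 _ tk al) //; have := quadricD (quadric_theta true i) (quadricN (quadric_theta true i)); rewrite subrr.
Qed.

Local Notation ev := (mmap (in_alg F) th).

Let evX y : ev 'X_y = th y. Proof. exact: evX. Qed.

Lemma mul_basis_elt k i : exists (u : 'I_2 -> {mpoly K[2]}) (v : 'I_#|basis_index| -> {mpoly K[2]}),
  [/\ forall y, u y \is 1.-homog, forall y, v y \is 1.-homog
    & w k * w i = \sum_y ev (u y) * th y + \sum_y ev (v y) * w y].
Proof.
have [y /choice[a /choice[b hy]] ->] := quadric_zclass (enum_val k) (enum_val i).
pose X (b : bool) : {mpoly K[2]} := if b then 'X_1 else 'X_0.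
have evXb b' : ev (X b') = theta b' by case: b'; rewrite /X evX.
have hom1 (d : bool -> K) : \sum_b' d b' *: X b' \is 1.-homog.
  by apply: rpred_sum => b' _; apply: rpredZ; case: b'; apply: dhomogXU.
have ev_sum (d : bool -> K) : ev (\sum_b' d b' *: X b') = \sum_b' d b' *: theta b'.
  by rewrite rmorph_sum; apply: eq_bigr => b' _; rewrite /= mmapZ /= mulr_algl evXb.
exists (fun x => \sum_b' a b' x *: X b'), (fun x => \sum_b' b b' x *: X b'); split=> //.
transitivity (\sum_b' (\sum_x (a b' x *: theta b') * th x + \sum_x (b b' x *: theta b') * w x)).
  apply: eq_bigr => b' _; rewrite hy mulrDl !mulr_suml.
  by congr (_ + _); apply: eq_bigr => x _; rewrite -!scalerAl mulrC.
rewrite big_split /=; congr (_ + _); rewrite exchange_big; apply: eq_bigr => x _;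
  by rewrite ev_sum mulr_suml.
Qed.

Let spanned (x : F) := exists (p0 : {mpoly K[2]}) (p : 'I_#|basis_index| -> {mpoly K[2]}),
  x = ev p0 + \sum_i ev (p i) * w i.

Let spannedD x y : spanned x -> spanned y -> spanned (x + y).
Proof.
move=> [p0 [p ->]] [q0 [q ->]]; exists (p0 + q0), (fun i => p i + q i).
rewrite rmorphD addrACA -big_split /=; congr (_ + _).
by apply: eq_bigr => i _; rewrite rmorphD mulrDl.
Qed.

Let spannedM q x : spanned x -> spanned (ev q * x).
Proof.
move=> [p0 [p ->]]; exists (q * p0), (fun i => q * p i).
rewrite rmorphM mulrDr [X in _ + X = _]mulr_sumr; congr (_ + _).
by apply: eq_bigr => i _; rewrite rmorphM mulrA.
Qed.

Let spanned_ev q : spanned (ev q).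
Proof. by exists q, (fun=> 0); rewrite big1 ?addr0 // => i _; rewrite rmorph0 mul0r. Qed.

Let spanned_w i : spanned (w i).
Proof.
exists 0, (fun k => (k == i)%:R); rewrite rmorph0 add0r (bigD1 i) //= eqxx rmorph1 mul1r.
by rewrite big1 ?addr0 // => k /negPf->; rewrite rmorph0 mul0r.
Qed.

Let spanned_sum n (G : 'I_n -> F) : (forall i, spanned (G i)) -> spanned (\sum_i G i).
Proof.
move=> hG; elim/big_rec: _ => [|i x _]; last exact: spannedD.
by rewrite -(rmorph0 (mmap (in_alg F) th)); apply: spanned_ev.
Qed.

Let spanned_wM i x : spanned x -> spanned (w i * x).
Proof.
move=> [p0 [p ->]]; rewrite mulrDr; apply: spannedD.
  by rewrite mulrC; apply/spannedM/spanned_w.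
rewrite [X in spanned X]mulr_sumr; apply: spanned_sum => k.
rewrite mulrCA; apply: spannedM; have [u [v [_ _ ->]]] := mul_basis_elt i k.
apply: spannedD; apply: spanned_sum => y; apply: spannedM; last exact: spanned_w.
by rewrite -evX; apply: spanned_ev.
Qed.

Let spanned_scale a x : spanned x -> spanned (a *: x).
Proof. by move=> hx; rewrite -mulr_algl -[_%:A](mmapC th (in_alg F) a); apply: spannedM. Qed.

Lemma basis_span x : spanned x.
Proof.
have [f ->] := fiber_cone_lift I_gen x; rewrite -[phi f]mulr1.
have : spanned 1 by rewrite -(rmorph1 (mmap (in_alg F) th)); apply: spanned_ev.
(* The unit is generalised to an arbitrary spanned [y], so that the case of a product composes the
   two induction hypotheses. *)
elim/mpoly_subring_ind: f 1 => [a|k|f g IHf IHg|f g IHf IHg] y hy.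
- by rewrite /fiber_map mmapC /= mulr_algl; apply: spanned_scale.
- rewrite -zclassE; have [a [b ->]] := linear_form_zclass k.
  rewrite mulrDl !mulr_suml; apply: spannedD; apply: spanned_sum => i;
    rewrite -scalerAl; apply: spanned_scale.
    by rewrite -evX; apply: spannedM.
  exact: spanned_wM.
- by rewrite /fiber_map rmorphD mulrDl; apply: spannedD; [apply: IHf|apply: IHg].
by rewrite /fiber_map rmorphM -mulrA; apply/IHf/IHg.
Qed.

Let parameter_lift (x : 'I_2) : {mpoly K[m]} := \sum_(t < l | odd t == (x == 1)) zvar K (J t).
Local Notation Th := parameter_lift.
Let G : {mpoly K[2]} -> {mpoly K[m]} := mmap (@mpolyC m K) Th.

Let evE p : ev p = phi (G p).
Proof.
pose g := phi \o G : {rmorphism {mpoly K[2]} -> F}.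
apply: (mpoly_rmorph_ext (f := mmap (in_alg F) th) (g := g)) => [a|x].
  by rewrite /g /= /G /fiber_map !mmapC.
transitivity (th x); first exact: evX.
rewrite /g /= /G mmapX mmap1U /parameter /theta /Th /fiber_map rmorph_sum.
exact: eq_bigr.
Qed.

(** On a segment the parameter with the parity of its left corner restricts to the left end and the
    other one to the right end. So K[th 0, th 1] maps through the substitution treated in
    [segment_independence]. *)
Let segment_G (a a' : 'I_l) (x0 x1 : 'I_2) p : a' = a.+1 :> nat -> x0 != x1 ->
  odd a = (x0 == 1) ->
  segment_map (j a) (j a') (G p) = msubst predT (fun x => mnm2 1 (if x == x0 then nat_of_ord (j a) else nat_of_ord (j a'))) p.
Proof.
move=> ea' x01 ox0; pose E := msubst (K := K) predT (fun x => mnm2 1 (if x == x0 then nat_of_ord (j a) else nat_of_ord (j a'))).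
pose g := segment_map (j a) (j a') \o G : {rmorphism {mpoly K[2]} -> {mpoly K[2]}}.
apply: (mpoly_rmorph_ext (f := g) (g := E)) => [b|x].
  by rewrite /g /E /= /G mmapC /segment_map !msubstC.
transitivity ('X_[mnm2 1 (if x == x0 then nat_of_ord (j a) else nat_of_ord (j a'))] : {mpoly K[2]}); last first.
  exact: (esym (msubstXU K predT _ x)).
rewrite /g /= /G mmapX mmap1U /Th rmorph_sum /=.
have segJ (t : 'I_l) : segment_map (j a) (j a') (zvar K (J t) : {mpoly K[m]}) =
    if (t == a) || (t == a') then 'X_[mnm2 1 (j t)] else 0.
  rewrite corner_indexE zvarE segment_mapXU; congr (if _ then _ else _).
  have [ta|at_|/val_inj->] := ltngtP t a; last by rewrite eqxx !leqnn /= ltnW // -!corner_indexE corner_index_lt // ea'.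
    have -> : (t == a) = false by rewrite -val_eqE /=; lia.
    have -> : (t == a') = false by rewrite -val_eqE /=; lia.
    by have := j_incr ta; lia.
  have [ta'|a't|/val_inj->] := ltngtP t a'; first by lia.
    have -> : (t == a) = false by rewrite -val_eqE /=; lia.
    have -> : (t == a') = false by rewrite -val_eqE /=; lia.
    by have := j_incr a't; lia.
  by rewrite eqxx orbT leqnn andbT ltnW // j_incr // ea'.
under eq_bigr do rewrite segJ.
have aa' : (a' == a) = false by rewrite -val_eqE /= ea'; lia.
have [->|xNx0] := eqVneq x x0.
  rewrite (bigD1 a) /=; last by rewrite ox0.
  rewrite eqxx big1 ?addr0 // => t /andP[/eqP ot /negPf ta]; rewrite ta /=.
  case: eqP => // et; have : odd a' = odd a by rewrite -et ot ox0.
  by rewrite ea' /=; case: odd.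
have -> : x = x1 by case: (ord2_cases x x01) xNx0 => // ->; rewrite eqxx.
have ox1 : odd a' = (x1 == 1).
  rewrite ea' /= ox0; move: x01; clear; case: x0 x1 => [[|[|//]] ?] [[|[|//]] ?] //.
rewrite (bigD1 a') /=; last by rewrite ox1.
rewrite eqxx orbT big1 ?addr0 // => t /andP[/eqP ot /negPf ta']; rewrite ta' orbF.
case: eqP => // et; have : odd a' = odd a by rewrite -et ot ox1.
by rewrite ea' /=; case: odd.
Qed.

(** Let [P k] be the coefficient of z_k in the relation. Restriction to a segment kills [P] at
    interior indices and gives a linear equation between [p0] and the values of [P] at the two ends.
    [P] vanishes at the first two corners, so the first segment yields [p0] equal to 0, and each
    later one carries the vanishing to its right end. *)
Lemma basis_free (p0 : {mpoly K[2]}) (p : 'I_#|basis_index| -> {mpoly K[2]}) :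
  ev p0 + \sum_i ev (p i) * w i = 0 -> p0 = 0 /\ forall i, p i = 0.
Proof.
move=> rel; pose P (k : 'I_m) := \sum_(i | enum_val i == k) p i.
have relL : phi (G p0 + \sum_(k < m) G (P k) * 'X_k) = 0.
  rewrite -rel /fiber_map rmorphD /= -!/(fiber_map c I _) -evE; congr (_ + _).
  rewrite /fiber_map rmorph_sum /= -!/(fiber_map c I _).
  rewrite [RHS](partition_big enum_val predT) //=; apply: eq_bigr => k _.
  rewrite /fiber_map rmorphM /= -!/(fiber_map c I _) -evE -zclassE /P rmorph_sum mulr_suml.
  by apply: eq_bigr => i /eqP ik; rewrite /basis_elt ik.
have segment (a a' : 'I_l) (x0 x1 : 'I_2) : a' = a.+1 :> nat -> x0 != x1 -> odd a = (x0 == 1) ->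
    p0 + P (j a) * 'X_x0 + P (j a') * 'X_x1 = 0 /\
    forall k : 'I_m, (j a < k < j a')%N -> P k = 0.
  move=> ea' x01 ox0; have jaa' : (j a < j a')%N by apply: j_incr; rewrite ea'.
  apply: (segment_independence (x0 := x0) (x1 := x1)) => //.
  have := segment_map_phi m_gt1 I_gen c_convex c_decr c_incr j_incr cornerE ea' (f := G p0 + \sum_(k < m) G (P k) * 'X_k) (g := 0).
  rewrite relL /fiber_map rmorph0 rmorph0 => /(_ erefl) seg_rel.
  rewrite -[RHS]seg_rel.
  have segE q := segment_G q ea' x01 ox0.
  rewrite [RHS]rmorphD [X in _ = _ + X]rmorph_sum /= segE.
  under [X in _ = _ + X]eq_bigr do rewrite rmorphM /= segE segment_mapXU.
  rewrite [X in _ = _ + X](bigD1 (j a)) //= [X in _ = _ + (_ + X)](bigD1 (j a')) /=; last first.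
    by rewrite -val_eqE /= gtn_eqF.
  rewrite !leqnn (ltnW jaa') /= !rmorphD !rmorphM /= !msubstXU /= eqxx eq_sym (negPf x01).
  rewrite !addrA; congr (_ + _).
  rewrite big_mkcond [RHS]big_mkcond; apply: eq_bigr => k _ /=.
  rewrite -!val_eqE /=; case: ltngtP => ak; case: ltngtP => ka //=; rewrite ?mulr0 //; lia.
have P_first k : ~~ basis_index k -> P k = 0.
  move=> nk; apply: big1 => i /eqP ik; have := enum_valP i; rewrite ik => nc.
  by case/negP: nk.
have [J0 l1] := corner_index0.
have parity (a : 'I_l) : exists x0 x1 : 'I_2, x0 != x1 /\ odd a = (x0 == 1).
  by exists (if odd a then 1 else 0), (if odd a then 0 else 1); case: odd.
have P01 (a : 'I_l) : (a < 2)%N -> P (j a) = 0.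
  move=> a2; apply: P_first; rewrite /basis_index /= -corner_indexE.
  by case: (nat_of_ord a) a2 => [|[|//]] _; rewrite ?J0 ?eqxx ?andbF.
have p00 : p0 = 0.
  have [x0 [x1 [x01 ox0]]] := parity (Ordinal (ltnW l1)).
  have [e _] := segment (Ordinal (ltnW l1)) (Ordinal l1) _ _ erefl x01 ox0.
  by move: e; rewrite !P01 // !mul0r !addr0.
have P_corner t (tl : (t < l)%N) : P (j (Ordinal tl)) = 0.
  elim: t tl => [|[|t] IHt] tl; [exact: P01|exact: P01|].
  have [x0 [x1 [x01 ox0]]] := parity (Ordinal (ltnW tl)).
  have [e _] := segment (Ordinal (ltnW tl)) (Ordinal tl) _ _ erefl x01 ox0.
  move: e; rewrite p00 IHt mul0r !add0r => /eqP.
  by rewrite mulf_eq0 (negPf (mpolyXU_neq0 _ _)) orbF => /eqP.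
have P0 k : P k = 0.
  have [[a ->]|nc] := pselect (exists a, k = j a).
    by have -> : a = Ordinal (ltn_ord a) by apply: val_inj.
  have km : (k.+1 < m)%N.
    rewrite ltnNge; apply/negP => mk; apply: nc; apply/cornerE.
    by apply: Or32; apply/eqP; rewrite eqn_leq ltn_ord mk.
  have [h|a [a' [ea' ja ja']]] := flat_segment j_incr cornerE m_gt1
    (i := k) (k := Ordinal km) (ltnSn k); first by move=> /=; lia.
  have [x0 [x1 [x01 ox0]]] := parity a.
  have [_] := segment _ _ _ _ ea' x01 ox0; apply; rewrite ja' andbT ltn_neqAle ja andbT.
  by apply/eqP => /val_inj e; apply: nc; exists a.
split=> // i; rewrite -(P0 (enum_val i)) /P (big_pred1 i) // => k.
by rewrite /= (inj_eq enum_val_inj).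
Qed.

End FreeBasis.

(** * Cohen-Macaulay and Koszul properties *)

Section GradedStructure.
Variables (K : fieldType) (I : {pred {mpoly K[2]}}) (m : nat) (c : 'I_m -> 'X_{1..2}).
Variables (l : nat) (j : 'I_l -> 'I_m).
Hypothesis m_gt1 : (1 < m)%N.
Hypothesis I_gen : I =i ideal_gen (monomials_of c [set: 'I_m]).
Hypothesis c_convex : convex c.
Hypothesis c_decr : forall i k : 'I_m, (i < k)%N -> (c k 0%R < c i 0%R)%N.
Hypothesis c_incr : forall i k : 'I_m, (i < k)%N -> (c i 1%R < c k 1%R)%N.
Hypothesis j_incr : forall k k' : 'I_l, (k < k')%N -> (j k < j k')%N.
Hypothesis cornerE : forall i : 'I_m, corner c i <-> exists k : 'I_l, i = j k.
Implicit Types (f g : {mpoly K[m]}).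
Local Notation phi := (fiber_map c I).
Local Notation F := (fiber_cone I).

Lemma phiC a : phi a%:MP = a%:A.
Proof. exact: mmapC. Qed.

Lemma phi_normal_form f : exists2 g, phi f = phi g &
  forall t, t \in msupp g -> standard t /\ exists2 e, e \in msupp f & mdeg t = mdeg e.
Proof.
have [g fg std_g] := corner_normal_form j_incr cornerE m_gt1 f; exists g => //.
move: fg; rewrite (corner_idealE m_gt1 I_gen c_convex c_decr c_incr j_incr cornerE) inE.
by rewrite /fiber_map rmorphB subr_eq0 => /eqP.
Qed.

Lemma fiber_gr_standard : standard_graded (fiber_gr I).
Proof.
split.
- move=> k; split=> [|a x y].
    by apply/(fiber_grP I_gen); exists 0; rewrite ?rpred0 // /fiber_map rmorph0.
  move=> /(fiber_grP I_gen)[f fk ->] /(fiber_grP I_gen)[g gk ->].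
  apply/(fiber_grP I_gen); exists (a *: f + g); first by rewrite rpredD // rpredZ.
  by rewrite -phi_scale /fiber_map rmorphD.
- move=> k n x y /(fiber_grP I_gen)[f fk ->] /(fiber_grP I_gen)[g gn ->].
  apply/(fiber_grP I_gen); exists (f * g); first exact: dhomogM.
  by rewrite /fiber_map rmorphM.
- move=> x; have [f ->] := fiber_cone_lift I_gen x.
  exists (msize f), (fun k => phi (pihomog mdeg k f)); split.
    by move=> k; apply/(fiber_grP I_gen); exists (pihomog mdeg k f) => //; apply: pihomogP.
  rewrite {1}(pihomog_partitionE (mf := mdeg) (leqnn (msize f))).
  by rewrite /fiber_map rmorph_sum.
- move=> n x grx sum0.
  (* Normal forms keep degrees, so each component has a homogeneous standard representative. The sum
     of these then vanishes as a polynomial, and there the degrees separate. *)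
  have /choice[g hg] : forall k, exists g, [/\ x k = phi g, g \is k.-homog &
      forall t, t \in msupp g -> standard t].
    move=> k; have /(fiber_grP I_gen)[f /dhomogP fk ->] := grx k.
    have [g fg std_g] := phi_normal_form f; exists g; split=> // [|t /std_g[]//].
    by apply/dhomogP => t /std_g[_ [e /fk ek et]]; apply: etrans et ek.
  have g0 : \sum_(k < n) g k = 0.
    apply: (standard_relation0 m_gt1 I_gen c_convex c_decr c_incr) => [t|].
      move=> /msupp_sum_le/flattenP[s /mapP[k _ ->]]; by have [_ _] := hg k; apply.
    rewrite /fiber_map rmorph_sum -[RHS]sum0; apply: eq_bigr => k _.
    by have [] := hg k.
  move=> k kn; have [-> gk _] := hg k; suff -> : g k = 0 by rewrite /fiber_map rmorph0.
  have := congr1 (pihomog mdeg k) g0; rewrite raddf0 raddf_sum (bigD1 (Ordinal kn)) //=.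
  rewrite pihomog_dE // big1 ?addr0 // => i ik.
  apply: (pihomog_ne0 (d := i)); last by have [] := hg i.
  by rewrite -val_eqE in ik.
- move=> x; split=> [/(fiber_grP I_gen)[f /dhomogP f0 ->]|[a ->]].
    exists (f@_0); rewrite -phiC; congr phi; apply/mpolyP => e.
    rewrite mcoeffC; have [->|e0] := eqVneq e 0%MM; first by rewrite mulr1.
    rewrite mulr0; apply/memN_msupp_eq0/negP => /f0 de.
    by case/negP: e0; rewrite -mdeg_eq0; apply/eqP.
  apply/(fiber_grP I_gen); exists a%:MP; last by rewrite phiC.
  by rewrite -alg_mpolyC rpredZ // dhomog1.
exists m, (fun i => fiber_class I 'X_[c i]); split=> [i|x].
  apply/(fiber_grP I_gen); exists 'X_i; first exact: dhomogXU.
  by rewrite /fiber_map mmapX mmap1U.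
exact: fiber_cone_lift.
Qed.

Lemma phi_gr1 n : zclass I c n \in fiber_gr I 1.
Proof.
apply/(fiber_grP I_gen); exists (zvar K n) => //.
by rewrite /zvar; case: insub => [i|] /=; rewrite ?rpred0 ?dhomogXU.
Qed.

Lemma gr1_closed : submod_closed (fiber_gr I 1).
Proof. exact: (sg_submod fiber_gr_standard 1). Qed.

Lemma parameter_gr1 x : parameter I c j x \in fiber_gr I 1.
Proof.
have [V0 Vlin] := gr1_closed; rewrite /parameter /theta.
elim/big_rec: _ => [//|t y _ Vy]; rewrite -[zclass _ _ _]scale1r.
by apply: Vlin => //; apply: phi_gr1.
Qed.

Lemma irrelevant_gr1 x : x \in fiber_gr I 1 -> x \in irrelevant (fiber_gr I).
Proof. by move=> x1; apply: mem_ideal_gen; apply/asboolP; exists 1%N. Qed.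

Lemma irrelevantP x : x \in irrelevant (fiber_gr I) <->
  exists (a : 'I_2 -> F) (b : 'I_#|basis_index j| -> F),
    x = \sum_y a y * parameter I c j y + \sum_i b i * basis_elt I c i.
Proof.
split=> [irr_x|[a [b ->]]]; last first.
  have irr_sum n (u v : 'I_n -> F) : (forall i, v i \in irrelevant (fiber_gr I)) ->
      \sum_i u i * v i \in irrelevant (fiber_gr I).
    by move=> hv; apply: ideal_gen_sum => i; apply: ideal_genM.
  apply: ideal_genD; apply: irr_sum => i; apply: irrelevant_gr1.
    exact: parameter_gr1.
  exact: phi_gr1.
pose M (x : F) := exists (a : 'I_2 -> F) (b : 'I_#|basis_index j| -> F),
    x = \sum_y a y * parameter I c j y + \sum_i b i * basis_elt I c i.
have M0 : M 0.
  by exists (fun=> 0), (fun=> 0); rewrite !big1 ?addr0 // => i _; rewrite mul0r.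
have MD y z : M y -> M z -> M (y + z).
  move=> [a [b ->]] [a' [b' ->]]; exists (fun i => a i + a' i), (fun i => b i + b' i).
  rewrite addrACA -!big_split /=.
  by congr (_ + _); apply: eq_bigr => i _; rewrite mulrDl.
have MM u y : M y -> M (u * y).
  move=> [a [b ->]]; exists (fun i => u * a i), (fun i => u * b i).
  by rewrite mulrDr !mulr_sumr; congr (_ + _); apply: eq_bigr => i _; rewrite mulrA.
have MZ n : M (zclass I c n).
  have [a [b ->]] := linear_form_zclass I m_gt1 j_incr cornerE n.
  exists (fun y => (a y)%:A), (fun i => (b i)%:A).
  by congr (_ + _); apply: eq_bigr => i _; rewrite mulr_algl.
change (M x); move: irr_x => /ideal_genP[n [a [s [sS ->]]]].
elim/big_rec: _ => [//|i y _]; apply: (MD).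
apply: (MM); have /asboolP[k k_gt0 /(fiber_grP I_gen)[f /dhomogP fk ->]] := sS i.
rewrite (mpolyE f) /fiber_map rmorph_sum big_seq.
elim/big_rec: _ => [//|e z /fk de]; apply: (MD).
rewrite /= -!/(fiber_map c I _) phi_scale -mulr_algl; apply: (MM).
have [q eq] : exists q, e q != 0%N.
  apply/existsP; apply: contraLR k_gt0 => /existsPn e0; rewrite -de lt0n negbK.
  by rewrite -[X in X == _]/(mdeg e) mdegE sum_nat_eq0; apply/forallP => q; have := e0 q; rewrite negbK.
rewrite -(submK (m := U_(q)) (m' := e)) ?lep1mP // mpolyXD /fiber_map rmorphM.
by apply: (MM); rewrite /= -/(fiber_map c I _) -zclassE.
Qed.

(** Otherwise 1 is the image of some [f] without constant term, and [fiber_relation] for [f - 1] at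
    the standard monomial 1 would make the coefficient -1 vanish. *)
Lemma irrelevant1 : 1 \notin irrelevant (fiber_gr I).
Proof.
apply/negP => /ideal_genP[n [a [s [sS e1]]]].
have [f ef f0] : exists2 f, \sum_(i < n) a i * s i = phi f & f@_0 = 0.
  elim/big_rec: _ => [|i y _ [f -> f0]]; first by exists 0; rewrite ?mcoeff0 // /fiber_map rmorph0.
  have /asboolP[k k_gt0 /(fiber_grP I_gen)[g gk ->]] := sS i.
  have [h ->] := fiber_cone_lift I_gen (a i).
  exists (h * g + f); first by rewrite /fiber_map rmorphD rmorphM.
  rewrite mcoeffD f0 addr0 rmorphM /= (dhomog_nemf_coeff gk) ?mulr0 //.
  by rewrite -[X in X != _]/(mdeg 0) mdeg0 neq_ltn k_gt0.
have rel : phi (f - 1) = 0 by rewrite /fiber_map rmorphB rmorph1 /= -/(fiber_map c I f) -ef -e1 subrr.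
have std0 : standard (0%MM : 'X_{1..m}) by apply/standardP => i k _; left; rewrite mnm0E.
have := fiber_relation I_gen m_gt1 c_convex c_decr c_incr rel std0.
rewrite (eq_bigl (pred1 0%MM)) => [|e /=]; last first.
  rewrite mdeg0 mdeg_eq0; apply/andP/eqP => [[/eqP]//|->]; by rewrite !eqxx.
rewrite big_mkcond (bigD1_seq 0%MM) ?msupp_uniq ?eqxx //=; last first.
  by rewrite mcoeff_msupp mcoeffB f0 mcoeff1 eqxx sub0r oppr_eq0 oner_neq0.
rewrite big1 ?addr0 => [|e /negPf-> //].
by move/eqP; rewrite mcoeffB f0 mcoeff1 eqxx sub0r oppr_eq0 oner_eq0.
Qed.

Lemma fiber_cone_growth : quadratic_growth F.
Proof.
pose V d : {pred F} := [pred x | `[< exists2 f, x = phi f &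
  forall e, e \in msupp f -> (mdeg e <= d)%N >]].
exists V, m; split.
- move=> x; have [f ->] := fiber_cone_lift I_gen x; exists (msize f).
  by apply/asboolP; exists f => // e /msize_mdeg_lt/ltnW.
- move=> d e de x /asboolP[f -> hf]; apply/asboolP; exists f => // u /hf ud.
  exact: leq_trans de.
- apply/asboolP; exists 1; first by rewrite /fiber_map rmorph1.
  by move=> e; rewrite msupp1 inE => /eqP->; rewrite mdeg0.
- move=> d e x y /asboolP[f -> hf] /asboolP[g -> hg]; apply/asboolP.
  exists (f * g); first by rewrite /fiber_map rmorphM.
  move=> u /msuppM_le/allpairsP[[u1 u2] /= [/hf h1 /hg h2 ->]].
  by rewrite mdegD leq_add.
(* Normal forms of degree at most d involve only products z_q^a z_(q+1)^b with q < m and a, b <= d,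
   which accounts for the constant [m]. *)
move=> d; pose T : finType := ('I_m * 'I_d.+1 * 'I_d.+1)%type.
pose G (t : T) : F := zclass I c t.1.1 ^+ t.1.2 * zclass I c t.1.1.+1 ^+ t.2.
exists #|{: T}|, (fun i => G (enum_val i)); split.
  by rewrite !card_prod !card_ord -mulnA mulnn.
move=> x /asboolP[f -> hf]; have [g -> hg] := phi_normal_form f.
have /choice[idx hidx] : forall e, exists t : T, e \in msupp g -> phi 'X_[e] = G t.
  move=> e; have [eg|] := boolP (e \in msupp g); last first.
    by exists (Ordinal (ltnW m_gt1), ord0, ord0).
  have [std_e [u /hf ud deu]] := hg e eg; rewrite -deu in ud.
  have [q [q1 [a [b [eq1 ee]]]]] := standard_form m_gt1 std_e.
  have [ad bd] : (a < d.+1)%N /\ (b < d.+1)%N.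
    by move: ud; rewrite ee mdegD !mdegMn !mdeg1; lia.
  exists (q, Ordinal ad, Ordinal bd) => _.
  by rewrite /G /= -eq1 !zclassE ee mpolyXD -!mpolyXn /fiber_map rmorphM !rmorphXn.
exists (fun i => \sum_(e <- msupp g | idx e == enum_val i) g@_e).
rewrite {1}(mpolyE g) /fiber_map rmorph_sum big_seq.
transitivity (\sum_(t : T) (\sum_(e <- msupp g | idx e == t) g@_e) *: G t).
  under [RHS]eq_bigr do rewrite scaler_suml.
  rewrite (partition_big idx predT) //=; apply: eq_bigr => t _.
  rewrite [RHS]big_seq_cond; apply: eq_bigr => e /andP[eg /eqP <-].
  by rewrite /= -!/(fiber_map c I _) phi_scale hidx.
by rewrite (reindex (enum_val : 'I_#|{: T}| -> T)) //; apply: onW_bij; apply: enum_val_bij.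
Qed.

Lemma fiber_cone_basis : algebra_basis (parameter I c j) (@basis_elt K I m c l j).
Proof.
split; first exact: basis_span.
exact: basis_free.
Qed.

Lemma fiber_cone_cohen_macaulay : cohen_macaulay (fiber_gr I).
Proof.
apply: (basis_cohen_macaulay fiber_cone_basis fiber_gr_standard fiber_cone_growth).
- exact: (fiber_cone_prime_chain m_gt1 I_gen c_convex c_decr c_incr j_incr cornerE).
- by move=> x; apply/irrelevant_gr1/parameter_gr1.
exact: irrelevant1.
Qed.

Lemma fiber_cone_koszul : koszul (fiber_gr I).
Proof.
split; first exact: fiber_gr_standard.
apply: (linear_resolution fiber_cone_basis).
- exact: mul_basis_elt.
- exact: gr1_closed.
- exact: parameter_gr1.
- by move=> i; apply: phi_gr1.
exact: irrelevantP.
Qed.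

End GradedStructure.

(** * The prime ideal of a variable has height at most one *)

Section VariableHeight.
Variables (K : fieldType) (n : nat) (x : 'I_n).

Lemma subst0_ker_prime : prime_ideal [pred f : {mpoly K[n]} | subst0 x f == 0].
Proof.
split; first split.
- by rewrite inE rmorph0.
- by rewrite inE rmorph1 oner_eq0.
- by move=> a f g; rewrite !inE rmorphD rmorphM /= => /eqP-> /eqP->; rewrite mulr0 addr0.
by move=> f g; rewrite !inE rmorphM mulf_eq0.
Qed.

(** A prime strictly inside (x) does not contain x. Any [f] in it is g x with g again in the prime
    and of smaller degree, so descent gives f = 0, and nothing lies strictly below. *)
Lemma subst0_ker_height (P : nat -> {pred {mpoly K[n]}}) :
  prime_chain 2 P -> ~ P 2%N =i [pred f | subst0 x f == 0].
Proof.
move=> [Pprime Plt] P2E.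
have [P12 nP21] := Plt 1%N isT; have [_ nP10] := Plt 0%N isT.
have [[P10 _ P1lin] P1prime] := Pprime 1%N isT.
have [[P00 _ _] _] := Pprime 0%N isT.
have P1x : 'X_x \notin P 1%N.
  apply/negP => P1x; apply: nP21 => f; rewrite P2E inE => /eqP/subst0_eq0[g ->].
  by rewrite -[g * _]addr0 P1lin.
apply: nP10 => f P1f; suff -> : f = 0 by [].
have [N] := ubnP (msize f); elim: N f P1f => // N IHN f P1f le_f.
have := P12 f P1f; rewrite P2E inE => /eqP/subst0_eq0[g ef].
have P1g : g \in P 1%N.
  by move: P1f; rewrite ef => /P1prime; rewrite (negPf P1x) orbF.
have [g0|g0] := eqVneq g 0; first by rewrite ef g0 mul0r.
rewrite ef (IHN g) ?mul0r //.
have : (U_(x) + mlead g)%MM \in msupp f.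
  by rewrite ef (perm_mem (msuppMX _ _)); apply/map_f/mlead_supp.
move=> /msize_mdeg_lt; rewrite mdegD mdeg1 -(mlead_deg g0); lia.
Qed.

End VariableHeight.

(** * Minimality and height two: strictly monotone exponents, at least two generators *)

Section Generators.
Variables (K : fieldType) (m : nat) (c : 'I_m -> 'X_{1..2}) (I : {pred {mpoly K[2]}}).
Hypothesis I_min : minimal_monomial_generators c I.

(** If one generator divided another, the latter could be dropped, against minimality. *)
Lemma generators_antichain i k : i != k -> ~~ (c i <= c k)%MM.
Proof.
have [I_gen min _] := I_min; move=> ik; apply/negP => le_ik.
apply: (min [set~ k]); first by rewrite properT; apply/eqP => /setP/(_ k); rewrite !inE eqxx.
move=> f; rewrite I_gen; apply/idP/idP; apply: ideal_gen_sub => s /existsP[h /andP[hB /eqP->]].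
  have [->|hk] := eqVneq h k; last first.
    by apply/mem_ideal_gen/existsP; exists h; rewrite !inE hk eqxx.
  rewrite -(submK le_ik) mpolyXD; apply/ideal_genM/mem_ideal_gen/existsP.
  by exists i; rewrite !inE ik eqxx.
by apply/mem_ideal_gen/existsP; exists h; rewrite inE eqxx.
Qed.

Lemma generators_decr (i k : 'I_m) : (i < k)%N -> (c k 0%R < c i 0%R)%N.
Proof.
have [_ _ lex] := I_min; move=> /[dup] ik /lex/existsP[x /andP[/forallP agree lt_x]].
case: (ord2_cases (x0 := 0) (x1 := 1) x isT) agree lt_x => -> // agree lt_x.
have /negP[] : ~~ (c k <= c i)%MM by apply: generators_antichain; rewrite -val_eqE /=; lia.
apply/mnm_lepP => y; case: (ord2_cases (x0 := 0) (x1 := 1) y isT) => ->; last exact: ltnW.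
by have /implyP/(_ isT)/eqP-> := agree 0.
Qed.

Lemma generators_incr (i k : 'I_m) : (i < k)%N -> (c i 1%R < c k 1%R)%N.
Proof.
move=> ik; rewrite ltnNge; apply/negP => le1.
have /negP[] : ~~ (c k <= c i)%MM by apply: generators_antichain; rewrite -val_eqE /=; lia.
apply/mnm_lepP => y; case: (ord2_cases (x0 := 0) (x1 := 1) y isT) => -> //.
exact/ltnW/generators_decr.
Qed.

(** With at most one generator, either [I] is the unit ideal, which no prime contains, so that every
    height bound holds vacuously; or [I] lies in the prime ideal of a variable, below which there is
    no chain of length 2. *)
Lemma height2_generators : is_height I 2 -> (1 < m)%N.
Proof.
move=> [ht2 not_ht3]; have [I_gen _ _] := I_min; rewrite ltnNge; apply/negP => m1.
have c_neq0 i : c i != 0%MM.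
  apply/negP => /eqP ci; apply: not_ht3 => Q [[_ Q1 _] _] IQ; case/negP: Q1; apply: IQ.
  rewrite I_gen; apply/mem_ideal_gen/existsP; exists i.
  by rewrite inE ci mpolyX0 eqxx.
have [x cx] : exists x : 'I_2, forall i, c i x != 0%N.
  (* For m = 0 the ideal is zero and any variable will do. *)
  have [i0|none] := pickP (pred_of_simpl (@predT 'I_m)); last by exists 0 => i; have := none i.
  move=> _; have [x cx] : exists x, c i0 x != 0%N.
    apply/existsP; apply: contraNT (c_neq0 i0) => /existsPn cx; apply/eqP/mnmP => x.
    by have := cx x; rewrite negbK mnm0E => /eqP.
  exists x => i; suff -> : i = i0 by [].
  by apply: val_inj => /=; have := ltn_ord i; have := ltn_ord i0; lia.
have [|P P_chain PE] := ht2 _ (subst0_ker_prime K x); last exact: (subst0_ker_height P_chain PE).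
move=> f; rewrite I_gen => /ideal_genP[N [a [s [sS ->]]]].
rewrite inE rmorph_sum big1 // => i _; rewrite rmorphM /=.
have /existsP[h /andP[_ /eqP->]] := sS i.
have le_x : (U_(x) <= c h)%MM by rewrite lep1mP.
by rewrite -(submK le_x) mpolyXD rmorphM /= subst0X eqxx !mulr0.
Qed.

End Generators.

Theorem theorem2p10 (K : fieldType) (I : {pred {mpoly K[2]}})
    (m : nat) (c : 'I_m -> 'X_{1..2}) (l : nat) (j : 'I_l -> 'I_m)
    (hI : is_height I 2)
    (hG : minimal_monomial_generators c I)
    (hconvex : convex c)
    (hj : forall k k' : 'I_l, (k < k')%N -> (j k < j k')%N)
    (hcorner : forall i : 'I_m, corner c i <-> exists k : 'I_l, i = j k) :
  {subset corner_binomials K j <= fiber_ideal c I} /\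
  {subset corner_monomials K j <= fiber_ideal c I} /\
  init_ideal (corner_ideal K j) =i ideal_gen (nonadjacent_products K m) /\
  corner_ideal K j =i fiber_ideal c I /\
  (reduced (fiber_cone I) /\
   cohen_macaulay (fiber_gr I) /\
   koszul (fiber_gr I)).
Proof.
have m_gt1 := height2_generators hG hI.
have [I_gen _ _] := hG.
have decr := generators_decr hG; have incr := generators_incr hG.
split; first exact: (corner_binomials_sub m_gt1 I_gen hconvex hj hcorner).
split; first exact: (corner_monomials_sub m_gt1 I_gen hconvex hj hcorner).
split; first exact: (corner_ideal_init m_gt1 I_gen hconvex decr incr hj hcorner).
split; first exact: (corner_idealE m_gt1 I_gen hconvex decr incr hj hcorner).
split; first exact: (fiber_cone_reduced m_gt1 I_gen hconvex decr incr hj hcorner).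
split; first exact: (fiber_cone_cohen_macaulay m_gt1 I_gen hconvex decr incr hj hcorner).
exact: (fiber_cone_koszul m_gt1 I_gen hconvex decr incr hj hcorner).
Qed.
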